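(* Let $0<\alpha<1$, and let $f,h\in L_2(\mathbb{R}_+)$ belong to the class of functions whose Mellin transforms satisfy $s f^*(s),\ s h^*(s)\in L_2(\sigma)$. Then the singular integral equation (with $h$ given and $f$ unknown) $$\frac{\cos^2(\pi\alpha)}{\pi^2}\int_0^\infty\frac{\log(x)-\log(t)}{x-t}f(t)\,dt-\frac{\sin(2\pi\alpha)}{\pi}\int_0^\infty\frac{f(t)}{t-x}\,dt-\cos(2\pi\alpha)f(x)=h(x),\quad x>0, \tag{A}$$ has the unique solution $$f(x)=\frac{\cos^2(\pi\alpha)}{\pi^2}\int_0^\infty\frac{\log(x)-\log(t)}{x-t}\left(\frac{x}{t}\right)^{\alpha-1/2}h(t)\,dt+\frac{\sin(2\pi\alpha)}{\pi}\int_0^\infty\left(\frac{x}{t}\right)^{\alpha-1/2}\frac{h(t)}{t-x}\,dt-\cos(2\pi\alpha)h(x),\quad x>0. \tag{B}$$ Conversely, the singular integral equation (B) (with $f$ given and $h$ unknown) has the unique solution $h$ given by (A).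
   Context: $\mathbb{R}_+=(0,\infty)$; functions are complex-valued. $\sigma=\{s\in\mathbb{C}:\mathrm{Re}\,s=1/2\}$, with $L_2(\sigma)$ taken with respect to $|ds|$. The Mellin transform of $f\in L_2(\mathbb{R}_+)$ is $f^*(s)=\int_0^\infty f(t)t^{s-1}dt$, $s\in\sigma$ (convergence in mean square in $L_2(\sigma)$), with inversion $f(x)=\frac{1}{2\pi i}\int_{\sigma}f^*(s)x^{-s}ds$. If $s f^*(s)\in L_2(\sigma)$ then $f^*\in L_1(\sigma)$, and in pointwise statements $f$ denotes the continuous function given by this inversion integral (likewise for $h$). Integrals with kernel $\frac{1}{t-x}$ are Cauchy principal values at $t=x$; the kernel $\frac{\log x-\log t}{x-t}$ has a removable singularity at $t=x$. Uniqueness is understood within the class of functions described in the claim. *)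

(* Defs.v *)
From HB Require Import structures.
From mathcomp Require Import all_boot all_order all_algebra.
From mathcomp Require Import all_classical all_reals all_analysis.
From mathcomp Require Import complex.

Set Implicit Arguments.
Unset Strict Implicit.
Unset Printing Implicit Defensive.

Import Order.TTheory GRing.Theory Num.Theory.
Import numFieldNormedType.Exports.

Local Open Scope classical_set_scope.
Local Open Scope ring_scope.
Local Open Scope complex_scope.

(* A function on the positive half-line is a total function R -> R[i] of      *)
(* which only the values at positive arguments are ever used; a function on   *)
(* the critical line is a total function R[i] -> R[i] of which only the       *)
(* values at the points 1/2 + i tau are ever used.                            *)

(* Unqualified Re and Im denote the projections of a numClosedFieldType.      *)
Local Notation Re := complex.Re.
Local Notation Im := complex.Im.
Local Notation normc := ComplexField.Normc.normc.

Section defs.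
Context {R : realType}.
Implicit Types (D : set R) (f g h : R -> R[i]) (F : R[i] -> R[i]).

Local Notation mu := (@lebesgue_measure R).

Definition Rpos : set R := [set t | 0 < t].

Definition cintegrable D g : Prop :=
  mu.-integrable D (fun t => (Re (g t))%:E) /\
  mu.-integrable D (fun t => (Im (g t))%:E).

Definition cintegral D g : R[i] :=
  (\int[mu]_(t in D) Re (g t)) +i* (\int[mu]_(t in D) Im (g t)).

Definition sqnorm D g : \bar R := (\int[mu]_(t in D) ((normc (g t)) ^+ 2)%:E)%E.

Definition in_L2 D g : Prop :=
  [/\ measurable_fun D (fun t => Re (g t)),
      measurable_fun D (fun t => Im (g t)) &
      (sqnorm D g < +oo)%E].

(* The base x is a positive real, so x^s = e^(s ln x) with the real ln.       *)
Definition cpow (x : R) (s : R[i]) : R[i] :=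
  (x `^ Re s)%:C * (cos (Im s * ln x) +i* sin (Im s * ln x)).

(* Parametrization of the line Re s = 1/2, for which |ds| = d tau.            *)
Definition sigma (tau : R) : R[i] := 2^-1 +i* tau.

Definition in_L2sigma F : Prop := in_L2 setT (fun tau => F (sigma tau)).

Definition mellin_trunc f (a : R) (s : R[i]) : R[i] :=
  cintegral `[a^-1, a] (fun t => f t * cpow t (s - 1)).

(* F is the Mellin transform of f: the truncated integrals over [1/a, a]      *)
(* converge to F in L_2(sigma) as a tends to +oo. This determines F only      *)
(* almost everywhere on sigma.                                                *)
Definition is_mellin f F : Prop :=
  in_L2sigma F /\
  sqnorm setT (fun tau => F (sigma tau) - mellin_trunc f a (sigma tau))
    @[a --> +oo] --> 0%E.

(* (2 pi i)^-1 \int_sigma F(s) x^(-s) ds, where ds = i d tau.                 *)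
Definition mellin_inv F (x : R) : R[i] :=
  ((2 * pi)%:C * 'i%C)^-1 *
  cintegral setT (fun tau => F (sigma tau) * cpow x (- sigma tau) * 'i%C).

(* The functions of L_2(R_+) with s f*(s) in L_2(sigma), each represented by  *)
(* its continuous version, namely the inversion integral of f*.               *)
Definition mellin_class f : Prop :=
  in_L2 Rpos f /\
  exists F, [/\ is_mellin f F,
                in_L2sigma (fun s => s * F s) &
                forall x, 0 < x -> f x = mellin_inv F x].

Definition is_cintegral D g (v : R[i]) : Prop :=
  cintegrable D g /\ cintegral D g = v.

(* v is the Cauchy principal value at t = x of \int_0^oo g(t) dt.             *)
Definition is_pv (x : R) g (v : R[i]) : Prop :=
  let D (e : R) := [set t | 0 < t /\ e < `|t - x|] in
  (forall e, 0 < e -> cintegrable (D e) g) /\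
  normc (cintegral (D e) g - v) @[e --> 0^'+] --> (0 : R).

(* At t = x this is 0 by the convention x / 0 = 0 rather than the limit x^-1, *)
(* which does not affect integrals.                                           *)
Definition logker (x t : R) : R := (ln x - ln t) / (x - t).

(* Validity of the two equations includes convergence of their integrals.     *)
Definition equationA (alpha : R) f h : Prop :=
  forall x, 0 < x -> exists I J : R[i],
    [/\ is_cintegral Rpos (fun t => (logker x t)%:C * f t) I,
        is_pv x (fun t => f t / (t - x)%:C) J &
        (cos (pi * alpha) ^+ 2 / pi ^+ 2)%:C * I
        - (sin (2 * pi * alpha) / pi)%:C * J
        - (cos (2 * pi * alpha))%:C * f x = h x].

Definition equationB (alpha : R) f h : Prop :=
  forall x, 0 < x -> exists I J : R[i],
    [/\ is_cintegral Rpos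
          (fun t => (logker x t)%:C * ((x / t) `^ (alpha - 2^-1))%:C * h t) I,
        is_pv x (fun t => ((x / t) `^ (alpha - 2^-1))%:C * (h t / (t - x)%:C)) J &
        f x = (cos (pi * alpha) ^+ 2 / pi ^+ 2)%:C * I
              + (sin (2 * pi * alpha) / pi)%:C * J
              - (cos (2 * pi * alpha))%:C * h x].

End defs.

(* Main.v *)
Require Import Defs.
From HB Require Import structures.
From mathcomp Require Import all_boot all_order all_algebra.
From mathcomp Require Import all_classical all_reals all_analysis.
From mathcomp Require Import measurable_realfun complex ring lra.

(** The theorem is true because both equations are diagonalized by the Mellin
    transform, and the two multipliers obtained are inverse to each other.

    The substitution [t = x exp (- y)] turns both kernels, including the factor
    [(x / t) ^ b] with [b = alpha - 1/2] of the second equation, into functions of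
    [y] alone.  If [f] is the inversion integral of [G], the multiplication formula
    of the Fourier transform then gives (lemma [minv_kernel]) that the operator of
    kernel [k] takes [f] to the inversion integral of [G] times the bilateral
    Laplace transform of [k] on the line [Re s = 1/2 + b].  For the logarithmic
    kernel this transform is [pi^2 / sin^2 (pi s)] ([logintE]), and for the Cauchy
    kernel it is [pi cot (pi s)] ([cauintE]).  Put [u = exp (- 2 pi tau)] and
    [w = exp (i pi alpha)].  On the line [Re s = 1/2] of the first equation the
    combination with the given coefficients collapses to
      [- (w^2 u - 1)^2 / (w^2 (1 + u)^2)],
    and on the line [Re s = alpha] of the second one to the inverse of that number
    ([symbolAE], [symbolBE]).  Both symbols are bounded, the second because
    [|w^2 u - 1| >= (1 + u) sin (pi alpha)].  So the multiplication by either symbol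
    preserves the class of [G] with [s G] square integrable, and it is inverse to
    the multiplication by the other ([reciprocal_equations]).

    The first transform is computed without contour integration.  It has the same
    double poles at [0] and [1] as [pi^2 / sin^2 (pi s)] and obeys the same
    duplication formula, and each use of this formula halves a bound of the
    difference.  The second one is minus a primitive of the first, which is
    integrated along the segment from [1/2] to [s].

    The principal value is the only conditionally convergent integral.  Truncation
    at distance [e] from [x] amounts to truncation in [y] at the relative distance
    [e / x], which is symmetric in [y] up to an error of order [e] ([farint_half]).
    The truncated transforms grow at most like [|tau|^(1/4)] uniformly in [e]
    ([farint_bound]), and the integrability of [|G| |tau|^(1/4)] allows the
    passage to the limit under the inversion integral ([pv_eval]).

    Two facts about the transform itself remain: that the inversion integral of
    such a [G] is in the class, with Mellin transform [G] ([mellin_class_minv]),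
    and that it determines [G] almost everywhere ([minv_inj]).  Both rest on the
    Plancherel theorem, which is proved here for integrable square integrable
    functions.  The Poisson means of [|four G|^2] differ from [2 pi] times the
    square norm of [G] by averages of the squared distances between [G] and its
    translates, which tend to [0] by the continuity of translation in the mean
    square. *)

Set Implicit Arguments.
Unset Strict Implicit.
Unset Printing Implicit Defensive.

Import Order.TTheory GRing.Theory Num.Theory.
Import numFieldNormedType.Exports.

Local Open Scope classical_set_scope.
Local Open Scope ring_scope.
Local Open Scope complex_scope.

Local Notation Re := complex.Re.
Local Notation Im := complex.Im.
Local Notation normc := ComplexField.Normc.normc.

(** * Complex numbers *)

(** Locked, so that a rewriting rule for products does not unfold it. *)
HB.lock Definition cexp {R : realType} (z : R[i]) : R[i] :=
  (expR (Re z))%:C * (cos (Im z) +i* sin (Im z)).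

Section complex_numbers.
Context {R : realType}.
Implicit Types (z w : R[i]) (x : R).

Lemma normcE2 z : normc z = Num.sqrt (Re z ^+ 2 + Im z ^+ 2).
Proof. by case: z. Qed.

Lemma sqr_normc2 z : normc z ^+ 2 = Re z ^+ 2 + Im z ^+ 2.
Proof. by rewrite normcE2 sqr_sqrtr// addr_ge0 ?sqr_ge0. Qed.

Lemma normc_ge0 z : 0 <= normc z.
Proof. by rewrite normcE2 sqrtr_ge0. Qed.

Lemma normcMl z w : normc (z * w) = normc z * normc w.
Proof. exact: ComplexField.Normc.normcM. Qed.

Lemma normcR x : normc x%:C = `|x|.
Proof. by rewrite normcE2 /= expr0n/= addr0 sqrtr_sqr. Qed.

Lemma normc_conj z : normc z^* = normc z.
Proof. by rewrite !normcE2; case: z => a b /=; rewrite sqrrN. Qed.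

Lemma le_normc_add z w : normc (z + w) <= normc z + normc w.
Proof. exact: le_normcD. Qed.

Lemma normc_opp z : normc (- z) = normc z.
Proof. by rewrite !normcE2; case: z => a b /=; rewrite !sqrrN. Qed.

Lemma le_normc_sub z w : normc (z - w) <= normc z + normc w.
Proof. by rewrite (le_trans (le_normc_add _ _))// normc_opp. Qed.

Lemma normc_Re z : `|Re z| <= normc z.
Proof. by rewrite normcE2 -sqrtr_sqr ler_sqrt ?lerDl ?addr_ge0 ?sqr_ge0. Qed.

Lemma normc_Im z : `|Im z| <= normc z.
Proof. by rewrite normcE2 -sqrtr_sqr ler_sqrt ?lerDr ?addr_ge0 ?sqr_ge0. Qed.

Lemma normc_ReIm z : normc z <= `|Re z| + `|Im z|.
Proof.
rewrite -(ler_pXn2r (ltn0Sn 1)) ?nnegrE ?normc_ge0 ?addr_ge0//.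
rewrite sqr_normc2 sqrrD !real_normK ?num_real// -addrA lerD2l lerDr.
by rewrite mulrn_wge0 ?mulr_ge0.
Qed.

Lemma normc_eq0 z : (normc z == 0) = (z == 0).
Proof.
apply/eqP/eqP => [/ComplexField.Normc.eq0_normc//|->].
by rewrite normcE2 /= expr0n /= addr0 sqrtr0.
Qed.

Lemma normc_inv z : normc z^-1 = (normc z)^-1.
Proof. exact: ComplexField.Normc.normcV. Qed.

Lemma cReD z w : Re (z + w) = Re z + Re w. Proof. by case: z w => ? ? []. Qed.
Lemma cImD z w : Im (z + w) = Im z + Im w. Proof. by case: z w => ? ? []. Qed.
Lemma cReN z : Re (- z) = - Re z. Proof. by case: z. Qed.
Lemma cImN z : Im (- z) = - Im z. Proof. by case: z. Qed.
Lemma cReM z w : Re (z * w) = Re z * Re w - Im z * Im w.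
Proof. by case: z w => ? ? []. Qed.
Lemma cImM z w : Im (z * w) = Re z * Im w + Im z * Re w.
Proof. by case: z w => ? ? []. Qed.
Lemma cRe_conj z : Re z^* = Re z. Proof. by case: z. Qed.
Lemma cIm_conj z : Im z^* = - Im z. Proof. by case: z. Qed.

Definition reimE := (cReD, cImD, cReN, cImN, cReM, cImM, cRe_conj, cIm_conj).

Lemma complex_eq z w : Re z = Re w -> Im z = Im w -> z = w.
Proof. by case: z w => a b [c d] /= -> ->. Qed.

Lemma cRe_inv z : Re z^-1 = Re z / (Re z ^+ 2 + Im z ^+ 2).
Proof. by case: z. Qed.

Lemma cIm_inv z : Im z^-1 = - Im z / (Re z ^+ 2 + Im z ^+ 2).
Proof. by case: z => a b; rewrite /= mulNr. Qed.

Lemma normcX2 z : (normc z ^+ 2)%:C = z * conjc z.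
Proof. by apply: complex_eq; rewrite !reimE ?sqr_normc2/=; ring. Qed.

Lemma Re_cexp z : Re (cexp z) = expR (Re z) * cos (Im z).
Proof. by rewrite [@cexp]unlock reimE/= mul0r subr0. Qed.

Lemma Im_cexp z : Im (cexp z) = expR (Re z) * sin (Im z).
Proof. by rewrite [@cexp]unlock reimE/= mul0r addr0. Qed.

Lemma cexpD z w : cexp (z + w) = cexp z * cexp w.
Proof.
by apply: complex_eq; rewrite !(Re_cexp, Im_cexp, reimE) expRD ?cosD ?sinD; ring.
Qed.

Lemma cexp0 : cexp (0 : R[i]) = 1.
Proof.
by apply: complex_eq; rewrite !(Re_cexp, Im_cexp)/= expR0 ?cos0 ?sin0; ring.
Qed.

Lemma normc_cexp z : normc (cexp z) = expR (Re z).
Proof.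
rewrite [@cexp]unlock normcMl normcR ger0_norm ?expR_ge0// normcE2 /= cos2Dsin2 sqrtr1.
by rewrite mulr1.
Qed.

Lemma cexp_neq0 z : cexp z != 0.
Proof. by rewrite -normc_eq0 normc_cexp gt_eqF// expR_gt0. Qed.

Lemma cexpN z : cexp (- z) = (cexp z)^-1.
Proof.
apply: (mulfI (cexp_neq0 z)); rewrite divff ?cexp_neq0//.
by rewrite -cexpD subrr cexp0.
Qed.

Lemma conj_cexp z : (cexp z)^* = cexp z^*.
Proof.
by apply: complex_eq; rewrite !(Re_cexp, Im_cexp, cRe_conj, cIm_conj) ?cosN ?sinN ?mulrN.
Qed.

Lemma cexpR x : cexp x%:C = (expR x)%:C.
Proof. by apply: complex_eq; rewrite !(Re_cexp, Im_cexp)/= ?cos0 ?sin0; ring. Qed.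

(** The unitary characters of the line. *)
Definition ce x : R[i] := cexp (x *i).

Lemma ceE x : ce x = cos x +i* sin x.
Proof. by apply: complex_eq; rewrite /ce ?Re_cexp ?Im_cexp/= expR0 mul1r. Qed.

Lemma normc_ce x : normc (ce x) = 1.
Proof. by rewrite normc_cexp expR0. Qed.

Lemma ceD x y : ce (x + y) = ce x * ce y.
Proof. by rewrite /ce -cexpD; congr cexp; apply: complex_eq; rewrite reimE/= ?addr0. Qed.

Lemma ce0 : ce 0 = 1.
Proof. by rewrite ceE cos0 sin0. Qed.

Lemma conj_ce x : (ce x)^* = ce (- x).
Proof. by rewrite /ce conj_cexp; congr cexp; apply: complex_eq; rewrite /= ?oppr0. Qed.

End complex_numbers.

(** * Measurability and integrability of complex functions *)

Section complex_measurability.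
Context {R : realType} {d : measure_display} {T : measurableType d}.
Implicit Types (D : set T) (f g : T -> R[i]).

Definition cmeas D f : Prop :=
  measurable_fun D (fun t => Re (f t)) /\ measurable_fun D (fun t => Im (f t)).

Lemma cmeasD D f g : cmeas D f -> cmeas D g -> cmeas D (fun t => f t + g t).
Proof.
move=> [f1 f2] [g1 g2]; split.
  by under eq_fun do rewrite cReD; exact: measurable_funD.
by under eq_fun do rewrite cImD; exact: measurable_funD.
Qed.

Lemma cmeasN D f : cmeas D f -> cmeas D (fun t => - f t).
Proof.
move=> [f1 f2]; split.
  by under eq_fun do rewrite cReN; exact: measurableT_comp.
by under eq_fun do rewrite cImN; exact: measurableT_comp.
Qed.

Lemma cmeasB D f g : cmeas D f -> cmeas D g -> cmeas D (fun t => f t - g t).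
Proof. by move=> mf mg; apply: cmeasD => //; exact: cmeasN. Qed.

Lemma cmeasM D f g : cmeas D f -> cmeas D g -> cmeas D (fun t => f t * g t).
Proof.
move=> [f1 f2] [g1 g2]; split.
  under eq_fun do rewrite cReM.
  by apply: measurable_funB; exact: measurable_funM.
under eq_fun do rewrite cImM.
by apply: measurable_funD; exact: measurable_funM.
Qed.

Lemma cmeas_cst D (z : R[i]) : cmeas D (fun=> z).
Proof. by split; exact: measurable_cst. Qed.

Lemma cmeas_real D (f : T -> R) :
  measurable_fun D f -> cmeas D (fun t => (f t)%:C).
Proof. by move=> mf; split => //=; exact: measurable_cst. Qed.

Lemma cmeas_conj D f : cmeas D f -> cmeas D (fun t => (f t)^*).
Proof.
move=> [f1 f2]; split; first by under eq_fun do rewrite cRe_conj.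
by under eq_fun do rewrite cIm_conj; exact: measurableT_comp.
Qed.

Lemma cmeas_sqr_normc D f : cmeas D f ->
  measurable_fun D (fun t => normc (f t) ^+ 2).
Proof.
move=> [f1 f2]; under eq_fun do rewrite sqr_normc2.
by apply: measurable_funD; exact: measurable_funX.
Qed.

Lemma cmeas_normc D f : cmeas D f -> measurable_fun D (fun t => normc (f t)).
Proof.
move=> mf; under eq_fun do rewrite -[normc _]ger0_norm ?normc_ge0// -sqrtr_sqr.
under eq_fun do rewrite -powR12_sqrt ?sqr_ge0//.
apply: (@measurableT_comp _ _ _ _ _ _ (@powR R ^~ 2^-1)).
  exact: measurable_powR.
exact: cmeas_sqr_normc.
Qed.

Lemma measurable_funV D (f : T -> R) :
  measurable_fun D f -> measurable_fun D (fun t => (f t)^-1).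
Proof.
move=> mf.
have -> : (fun t => (f t)^-1) = (fun t => f t * (f t ^+ 2) `^ (-1)).
  apply/funext => t; rewrite powR_inv1 ?sqr_ge0//.
  by have [->|ft0] := eqVneq (f t) 0; rewrite ?mul0r ?invr0//; field.
apply: measurable_funM => //.
apply: (@measurableT_comp _ _ _ _ _ _ (@powR R ^~ (-1))).
  exact: measurable_powR.
exact: measurable_funX.
Qed.

Lemma cmeasV D f : cmeas D f -> cmeas D (fun t => (f t)^-1).
Proof.
move=> mf; have [f1 f2] := mf.
have m2 : measurable_fun D (fun t => (Re (f t) ^+ 2 + Im (f t) ^+ 2)^-1).
  apply: measurable_funV.
  by apply: measurable_funD; exact: measurable_funX.
split.
  under eq_fun do rewrite cRe_inv.
  exact: measurable_funM.
under eq_fun do rewrite cIm_inv.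
apply: measurable_funM => //; exact: measurableT_comp.
Qed.

Lemma cmeas_cexp D f : cmeas D f -> cmeas D (fun t => cexp (f t)).
Proof.
move=> [f1 f2]; split.
  under eq_fun do rewrite Re_cexp.
  apply: measurable_funM; first exact: (measurableT_comp (@measurable_expR R)).
  apply: (measurableT_comp _ f2).
  by apply: continuous_measurable_fun; exact: continuous_cos.
under eq_fun do rewrite Im_cexp.
apply: measurable_funM; first exact: (measurableT_comp (@measurable_expR R)).
apply: (measurableT_comp _ f2).
by apply: continuous_measurable_fun; exact: continuous_sin.
Qed.

Lemma cmeas_ce D (f : T -> R) : measurable_fun D f -> cmeas D (fun t => ce (f t)).
Proof. by move=> mf; apply: cmeas_cexp; split => //=; exact: measurable_cst. Qed.

Lemma cmeasS D E f : measurable E -> D `<=` E -> cmeas E f -> cmeas D f.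
Proof. by move=> mE DE [f1 f2]; split; exact: (measurable_funS mE). Qed.

Lemma cmeasT D f : cmeas setT f -> cmeas D f.
Proof. exact: cmeasS. Qed.

End complex_measurability.

Lemma cmeas_comp {R : realType} d d' (T : measurableType d) (U : measurableType d')
  (f : U -> R[i]) (g : T -> U) :
  cmeas setT f -> measurable_fun setT g -> cmeas setT (fun t => f (g t)).
Proof.
by move=> [f1 f2] mg; split; [exact: (measurableT_comp f1)|exact: (measurableT_comp f2)].
Qed.

Section complex_integration.
Context {R : realType}.
Local Notation mu := (@lebesgue_measure R).
Implicit Types (D : set R) (f g : R -> R[i]) (h : R -> R).

Definition rintegrable D h : Prop := mu.-integrable D (fun t => (h t)%:E).

Lemma rintegrable_meas D h : measurable D -> rintegrable D h -> measurable_fun D h.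
Proof. by move=> mD /(measurable_int mu)/measurable_EFinP. Qed.

Lemma rintegrable_le D h k : measurable D -> measurable_fun D h ->
  rintegrable D k -> (forall t, D t -> `|h t| <= k t) -> rintegrable D h.
Proof.
move=> mD mh ik hk; apply: le_integrable ik => //; first exact/measurable_EFinP.
by move=> t Dt; rewrite lee_fin (le_trans (hk t Dt))// ler_norm.
Qed.

Lemma rintegrableD D h k : measurable D -> rintegrable D h -> rintegrable D k ->
  rintegrable D (fun t => h t + k t).
Proof. by move=> mD ih ik; have := @integrableD _ _ _ mu D mD _ _ ih ik; apply: eq_integrable. Qed.

Lemma rintegrableZ D h r : measurable D -> rintegrable D h ->
  rintegrable D (fun t => r * h t).
Proof. by move=> mD ih; have := @integrableZl _ _ _ mu D mD r _ ih; apply: eq_integrable. Qed.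

Lemma rintegrableN D h : measurable D -> rintegrable D h ->
  rintegrable D (fun t => - h t).
Proof. by move=> mD ih; have := @integrableN _ _ _ mu D _ ih; apply: eq_integrable. Qed.

Lemma rintegrableB D h k : measurable D -> rintegrable D h -> rintegrable D k ->
  rintegrable D (fun t => h t - k t).
Proof. by move=> mD ih ik; have := @integrableB _ _ _ mu D mD _ _ ih ik; apply: eq_integrable. Qed.

Lemma rintegrableS D E h : measurable D -> measurable E -> D `<=` E ->
  rintegrable E h -> rintegrable D h.
Proof. by move=> mD mE DE; exact: integrableS. Qed.

Lemma cintegrable_meas D f : measurable D -> cintegrable D f -> cmeas D f.
Proof. by move=> mD [f1 f2]; split; exact: rintegrable_meas. Qed.

Lemma cintegrable_normc D f : measurable D -> cintegrable D f ->
  rintegrable D (fun t => normc (f t)).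
Proof.
move=> mD cf; have [f1 f2] := cf.
apply: (@rintegrable_le _ _ (fun t => `|Re (f t)| + `|Im (f t)|)) => //.
- by apply: cmeas_normc; exact: cintegrable_meas.
- by apply: rintegrableD => //; exact: integrable_norm.
- by move=> t _; rewrite ger0_norm ?normc_ge0// normc_ReIm.
Qed.

Lemma cintegrable_le D f k : measurable D -> cmeas D f -> rintegrable D k ->
  (forall t, D t -> normc (f t) <= k t) -> cintegrable D f.
Proof.
move=> mD [f1 f2] ik fk; split.
  apply: (rintegrable_le mD f1 ik) => t Dt.
  exact: le_trans (normc_Re _) (fk t Dt).
apply: (rintegrable_le mD f2 ik) => t Dt.
exact: le_trans (normc_Im _) (fk t Dt).
Qed.

Lemma cintegrableS D E f : measurable D -> measurable E -> D `<=` E ->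
  cintegrable E f -> cintegrable D f.
Proof. by move=> mD mE DE [f1 f2]; split; exact: rintegrableS DE _. Qed.

Lemma cintegrableD D f g : measurable D -> cintegrable D f -> cintegrable D g ->
  cintegrable D (fun t => f t + g t).
Proof.
move=> mD [f1 f2] [g1 g2]; split.
  by under eq_fun do rewrite cReD; exact: rintegrableD.
by under eq_fun do rewrite cImD; exact: rintegrableD.
Qed.

Lemma cintegrableZ D f (z : R[i]) : measurable D -> cintegrable D f ->
  cintegrable D (fun t => z * f t).
Proof.
move=> mD [f1 f2]; split.
  under eq_fun do rewrite cReM.
  by apply: rintegrableB => //; exact: rintegrableZ.
under eq_fun do rewrite cImM.
by apply: rintegrableD => //; exact: rintegrableZ.
Qed.

Lemma cintegrableN D f : measurable D -> cintegrable D f ->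
  cintegrable D (fun t => - f t).
Proof.
move=> mD [f1 f2]; split.
  by under eq_fun do rewrite cReN; exact: rintegrableN.
by under eq_fun do rewrite cImN; exact: rintegrableN.
Qed.

Lemma cintegrableB D f g : measurable D -> cintegrable D f -> cintegrable D g ->
  cintegrable D (fun t => f t - g t).
Proof. by move=> mD cf cg; apply: cintegrableD => //; exact: cintegrableN. Qed.

Lemma eq_cintegral D f g : (forall t, D t -> f t = g t) ->
  cintegral D f = cintegral D g.
Proof.
move=> fg; apply: complex_eq => /=.
  by apply: eq_Rintegral => t; rewrite inE => Dt; rewrite fg.
by apply: eq_Rintegral => t; rewrite inE => Dt; rewrite fg.
Qed.

Lemma eq_cintegrable D f g : measurable D -> (forall t, D t -> f t = g t) ->
  cintegrable D f -> cintegrable D g.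
Proof.
move=> mD fg [f1 f2]; split.
  by apply: eq_integrable f1 => // t; rewrite inE => Dt; rewrite fg.
by apply: eq_integrable f2 => // t; rewrite inE => Dt; rewrite fg.
Qed.

Lemma cintegralD D f g : measurable D -> cintegrable D f -> cintegrable D g ->
  cintegral D (fun t => f t + g t) = cintegral D f + cintegral D g.
Proof.
move=> mD [f1 f2] [g1 g2]; apply: complex_eq; rewrite reimE/=.
  by under eq_Rintegral do rewrite cReD; rewrite RintegralD.
by under eq_Rintegral do rewrite cImD; rewrite RintegralD.
Qed.

Lemma cintegralZ D f (z : R[i]) : measurable D -> cintegrable D f ->
  cintegral D (fun t => z * f t) = z * cintegral D f.
Proof.
move=> mD [f1 f2]; apply: complex_eq; rewrite reimE/=.
  under eq_Rintegral do rewrite cReM.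
  by rewrite RintegralB//= ?RintegralZl//; exact: rintegrableZ.
under eq_Rintegral do rewrite cImM.
by rewrite RintegralD//= ?RintegralZl//; exact: rintegrableZ.
Qed.

Lemma cintegralN D f : measurable D -> cintegrable D f ->
  cintegral D (fun t => - f t) = - cintegral D f.
Proof.
move=> mD cf; rewrite -mulN1r -cintegralZ//.
by apply: eq_cintegral => t _; rewrite mulN1r.
Qed.

Lemma cintegralB D f g : measurable D -> cintegrable D f -> cintegrable D g ->
  cintegral D (fun t => f t - g t) = cintegral D f - cintegral D g.
Proof.
by move=> mD cf cg; rewrite cintegralD ?cintegralN//; exact: cintegrableN.
Qed.

Lemma cintegral_conj D f : measurable D -> cintegrable D f ->
  cintegral D (fun t => (f t)^*) = (cintegral D f)^*.
Proof.
move=> mD [f1 f2]; apply: complex_eq; rewrite reimE/=.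
  by apply: eq_Rintegral => t _; rewrite cRe_conj.
under eq_Rintegral do rewrite cIm_conj -mulN1r.
by rewrite RintegralZl// mulN1r.
Qed.

Lemma cintegrable_conj D f : measurable D -> cintegrable D f ->
  cintegrable D (fun t => (f t)^*).
Proof.
move=> mD [f1 f2]; split; first by under eq_fun do rewrite cRe_conj.
by under eq_fun do rewrite cIm_conj; exact: rintegrableN.
Qed.

Lemma cintegrable_real D h : rintegrable D h -> cintegrable D (fun t => (h t)%:C).
Proof. by move=> ih; split => //; exact: integrable0. Qed.

Lemma cintegral_real D h :
  cintegral D (fun t => (h t)%:C) = (\int[mu]_(t in D) h t)%:C.
Proof.
by apply: complex_eq => //=; rewrite /Rintegral integral0.
Qed.

(** Rotating the integrand by the conjugate of its integral makes the integral
   real, which reduces the triangle inequality to the real one. *)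
Lemma le_normc_cintegral D f : measurable D -> cintegrable D f ->
  normc (cintegral D f) <= \int[mu]_(t in D) normc (f t).
Proof.
move=> mD cf; set I := cintegral D f.
have nf := cintegrable_normc mD cf.
have [/eqP I0|I0] := boolP (normc I == 0).
  by rewrite I0; apply: Rintegral_ge0 => t _; exact: normc_ge0.
have Igt0 : 0 < normc I by rewrite lt_neqAle eq_sym I0 normc_ge0.
rewrite -(ler_pM2l Igt0) -expr2.
have -> : normc I ^+ 2 = Re (I^* * I).
  by rewrite sqr_normc2 !reimE; ring.
rewrite -cintegralZ//= -RintegralZl//.
have [cI _] := cintegrableZ I^* mD cf.
apply: le_Rintegral => //; first exact: rintegrableZ.
move=> t Dt; rewrite (le_trans (ler_norm _))// (le_trans (normc_Re _))//.
by rewrite normcMl normc_conj.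
Qed.

Lemma le_normc_cintegral_dom D f k : measurable D -> cmeas D f -> rintegrable D k ->
  (forall t, D t -> normc (f t) <= k t) ->
  normc (cintegral D f) <= \int[mu]_(t in D) k t.
Proof.
move=> mD mf ik fk; have cf := cintegrable_le mD mf ik fk.
rewrite (le_trans (le_normc_cintegral mD cf))// le_Rintegral//.
exact: cintegrable_normc.
Qed.

Lemma rintegrable_mkcond D h : measurable D ->
  rintegrable D h <-> rintegrable setT (fun t => \1_D t * h t).
Proof.
move=> mD; rewrite /rintegrable integrable_mkcond//.
suff -> : ((fun t => (h t)%:E) \_ D) = (fun t => (\1_D t * h t)%:E) by [].
apply/funext => t; rewrite patchE indicE.
by case: (t \in D); rewrite ?mul1r ?mul0r.
Qed.

Lemma rintegral_mkcond D h :
  \int[mu]_(t in D) h t = \int[mu]_t (\1_D t * h t).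
Proof.
rewrite Rintegral_mkcond; apply: eq_Rintegral => t _; rewrite patchE indicE.
by case: (t \in D); rewrite ?mul1r ?mul0r.
Qed.

Lemma cintegrable_mkcond D f : measurable D ->
  cintegrable D f <-> cintegrable setT (fun t => (\1_D t)%:C * f t).
Proof.
move=> mD; rewrite /cintegrable.
have -> : (fun t => (Re ((\1_D t)%:C * f t))%:E) = (fun t => (\1_D t * Re (f t))%:E).
  by apply/funext => t; rewrite cReM/= mul0r subr0.
have -> : (fun t => (Im ((\1_D t)%:C * f t))%:E) = (fun t => (\1_D t * Im (f t))%:E).
  by apply/funext => t; rewrite cImM/= mul0r addr0.
have [p q] := rintegrable_mkcond (fun t => Re (f t)) mD.
have [p' q'] := rintegrable_mkcond (fun t => Im (f t)) mD.
by split=> -[f1 f2]; split; [exact: p|exact: p'|exact: q|exact: q'].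
Qed.

Lemma cintegral_mkcond D f :
  cintegral D f = cintegral setT (fun t => (\1_D t)%:C * f t).
Proof.
apply: complex_eq => /=; rewrite rintegral_mkcond; apply: eq_Rintegral => t _.
  by rewrite cReM/= mul0r subr0.
by rewrite cImM/= mul0r addr0.
Qed.

Lemma rintegral_dct D (h_ : nat -> R -> R) h k : measurable D ->
  (forall n, measurable_fun D (h_ n)) -> rintegrable D k ->
  (forall n t, D t -> `|h_ n t| <= k t) ->
  (forall t, D t -> h_ n t @[n --> \oo] --> h t) ->
  rintegrable D h /\
  \int[mu]_(t in D) h_ n t @[n --> \oo] --> \int[mu]_(t in D) h t.
Proof.
move=> mD mh ik hk hh.
have mh' : measurable_fun D h by apply: (measurable_fun_cvg mh) => t Dt; exact: hh.
have ih : rintegrable D h.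
  apply: (rintegrable_le mD mh' ik) => t Dt.
  have hn : `|h_ n t| @[n --> \oo] --> `|h t| by apply: cvg_norm; exact: hh.
  rewrite -(cvg_lim _ hn)//; apply: limr_le; first exact: (cvgP _ hn).
  by apply: nearW => n; exact: hk.
split=> //; rewrite /Rintegral; apply: fine_cvg; rewrite fineK; last first.
  exact: integrable_fin_num.
apply: (@dominated_cvg _ _ _ mu _ mD (fun n t => (h_ n t)%:E) _ (fun t => (k t)%:E)) => //.
- by move=> n; apply/measurable_EFinP; exact: mh.
- by move=> t Dt; apply: cvg_EFin; [exact: nearW|exact: hh].
Qed.

(** Dominated convergence, with the convergence of complex sequences expressed
   by the modulus of the difference. *)
Lemma cintegral_dct D (f_ : nat -> R -> R[i]) f k : measurable D ->
  (forall n, cmeas D (f_ n)) -> rintegrable D k ->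
  (forall n t, D t -> normc (f_ n t) <= k t) ->
  (forall t, D t -> normc (f_ n t - f t) @[n --> \oo] --> 0) ->
  cintegrable D f /\
  normc (cintegral D (f_ n) - cintegral D f) @[n --> \oo] --> 0.
Proof.
move=> mD mf ik fk ff.
have [iRe cRe] : rintegrable D (fun t => Re (f t)) /\
    \int[mu]_(t in D) Re (f_ n t) @[n --> \oo] --> \int[mu]_(t in D) Re (f t).
  apply: (@rintegral_dct _ _ _ k) => //.
  - by move=> n; case: (mf n).
  - by move=> n t Dt; exact: le_trans (normc_Re _) (fk n t Dt).
  - move=> t Dt; apply/subr_cvg0/norm_cvg0P; apply: (squeeze_cvgr _ (cvg_cst 0) (ff t Dt)).
    apply: nearW => n; rewrite normr_ge0/=.
    by rewrite -cReN -cReD normc_Re.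
have [iIm cIm] : rintegrable D (fun t => Im (f t)) /\
    \int[mu]_(t in D) Im (f_ n t) @[n --> \oo] --> \int[mu]_(t in D) Im (f t).
  apply: (@rintegral_dct _ _ _ k) => //.
  - by move=> n; case: (mf n).
  - by move=> n t Dt; exact: le_trans (normc_Im _) (fk n t Dt).
  - move=> t Dt; apply/subr_cvg0/norm_cvg0P; apply: (squeeze_cvgr _ (cvg_cst 0) (ff t Dt)).
    apply: nearW => n; rewrite normr_ge0/=.
    by rewrite -cImN -cImD normc_Im.
split=> //.
have cR0 : `|\int[mu]_(t in D) Re (f_ n t) - \int[mu]_(t in D) Re (f t)|
    @[n --> \oo] --> 0 by apply/norm_cvg0P/subr_cvg0.
have cI0 : `|\int[mu]_(t in D) Im (f_ n t) - \int[mu]_(t in D) Im (f t)|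
    @[n --> \oo] --> 0 by apply/norm_cvg0P/subr_cvg0.
have cRI : `|\int[mu]_(t in D) Re (f_ n t) - \int[mu]_(t in D) Re (f t)| +
    `|\int[mu]_(t in D) Im (f_ n t) - \int[mu]_(t in D) Im (f t)|
    @[n --> \oo] --> 0 by rewrite -[X in _ --> X]addr0; exact: cvgD.
apply: (squeeze_cvgr _ (cvg_cst 0) cRI); rewrite ?fctE.
apply: nearW => n; apply/andP; split; first exact: normc_ge0.
by apply: le_trans (normc_ReIm _) _; rewrite !reimE/= lerD.
Qed.

Lemma rintegrable_prod (K : R -> R -> R) h k :
  measurable_fun setT (fun p : R * R => K p.1 p.2) ->
  rintegrable setT h -> rintegrable setT k ->
  (forall x y, `|K x y| <= h x * k y) ->
  (mu \x mu)%E.-integrable setT (fun p : R * R => (K p.1 p.2)%:E).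
Proof.
move=> mK ih ik Khk; apply/integrable12ltyP; first exact/measurable_EFinP.
have mh := rintegrable_meas measurableT ih.
have mk := rintegrable_meas measurableT ik.
pose I : \bar R := (\int[mu]_y `|k y|%:E)%E.
have Ioo : (I < +oo)%E.
  by have /integrableP[_] := ik.
have I0 : (0 <= I)%E by apply: integral_ge0 => y _; rewrite lee_fin.
apply: (@le_lt_trans _ _ (\int[mu]_x (`|h x|%:E * I))%E).
  apply: ge0_le_integral => //.
  - by move=> x _; apply: integral_ge0 => y _; rewrite lee_fin.
  - apply: (measurable_fun_fubini_tonelli_F (m2 := mu)
      (fun p : R * R => `|(K p.1 p.2)%:E|%E)) => //.
    by apply: measurableT_comp => //; exact/measurable_EFinP.
  - apply: emeasurable_funM => //.
    by apply/measurable_EFinP; exact: measurableT_comp.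
  - move=> x _; rewrite -ge0_integralZl//.
    + apply: ge0_le_integral => //.
      * apply/measurable_EFinP; apply: measurableT_comp => //.
        exact: (measurableT_comp mK (measurable_pair1 x)).
      * apply/measurable_EFinP; apply: measurable_funM => //.
        exact: measurableT_comp.
      * move=> y _; rewrite lee_fin (le_trans (Khk x y))//.
        by rewrite -normrM ler_norm.
    + by apply/measurable_EFinP; exact: measurableT_comp.
rewrite ge0_integralZr//; last by apply/measurable_EFinP; exact: measurableT_comp.
apply: lte_mul_pinfty => //.
- by apply: integral_ge0 => y _; rewrite lee_fin.
- have /integrableP[mm oo] := ih; rewrite ge0_fin_numE//.
  by apply: integral_ge0 => y _; rewrite lee_fin.
Qed.

Lemma rintegrable_section (K : R -> R -> R) h k x :
  measurable_fun setT (fun p : R * R => K p.1 p.2) ->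
  rintegrable setT k -> (forall x y, `|K x y| <= h x * k y) ->
  rintegrable setT (K x).
Proof.
move=> mK ik Khk; apply: (@rintegrable_le _ _ (fun y => h x * k y)) => //.
- exact: (measurableT_comp mK (measurable_pair1 x)).
- exact: rintegrableZ.
Qed.

Lemma rfubini_integrable (K : R -> R -> R) h k :
  measurable_fun setT (fun p : R * R => K p.1 p.2) ->
  rintegrable setT h -> rintegrable setT k ->
  (forall x y, `|K x y| <= h x * k y) ->
  rintegrable setT (fun x => \int[mu]_y K x y).
Proof.
move=> mK ih ik Khk.
have iK := rintegrable_prod mK ih ik Khk.
apply: (@eq_integrable _ _ _ mu setT _ (fubini_F mu (fun p : R * R => (K p.1 p.2)%:E))).
- by [].
- move=> x _; rewrite /fubini_F /Rintegral fineK//.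
  by apply: integrable_fin_num => //; exact: (rintegrable_section x mK ik Khk).
- exact: integrable_fubini_F.
Qed.

Lemma rfubini (K : R -> R -> R) h k :
  measurable_fun setT (fun p : R * R => K p.1 p.2) ->
  rintegrable setT h -> rintegrable setT k ->
  (forall x y, `|K x y| <= h x * k y) ->
  \int[mu]_x (\int[mu]_y K x y) = \int[mu]_y (\int[mu]_x K x y).
Proof.
move=> mK ih ik Khk.
have iK := rintegrable_prod mK ih ik Khk.
have mK' : measurable_fun setT (fun p : R * R => K p.2 p.1).
  have := measurableT_comp mK (@measurable_swap _ _ R R).
  by apply.
have Kkh x y : `|K y x| <= k x * h y by rewrite mulrC.
rewrite {1 3}/Rintegral; congr fine.
transitivity (\int[mu]_x \int[mu]_y (K x y)%:E)%E.
  apply: eq_integral => x _; rewrite /Rintegral fineK//.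
  by apply: integrable_fin_num => //; exact: (rintegrable_section x mK ik Khk).
rewrite (Fubini iK); apply: eq_integral => y _; rewrite /Rintegral fineK//.
apply: integrable_fin_num => //.
exact: (@rintegrable_section (fun x y => K y x) k h y mK' ih Kkh).
Qed.

Lemma cfubini_integrable (K : R -> R -> R[i]) h k :
  cmeas setT (fun p : R * R => K p.1 p.2) ->
  rintegrable setT h -> rintegrable setT k ->
  (forall x y, normc (K x y) <= h x * k y) ->
  cintegrable setT (fun x => cintegral setT (K x)).
Proof.
move=> [m1 m2] ih ik Khk; split.
  apply: (@rfubini_integrable (fun x y => Re (K x y)) h k m1 ih ik) => x y.
  exact: le_trans (normc_Re _) (Khk x y).
apply: (@rfubini_integrable (fun x y => Im (K x y)) h k m2 ih ik) => x y.
exact: le_trans (normc_Im _) (Khk x y).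
Qed.

(** A product majorant provides the integrability on the plane. *)
Lemma cfubini (K : R -> R -> R[i]) h k :
  cmeas setT (fun p : R * R => K p.1 p.2) ->
  rintegrable setT h -> rintegrable setT k ->
  (forall x y, normc (K x y) <= h x * k y) ->
  cintegral setT (fun x => cintegral setT (fun y => K x y)) =
  cintegral setT (fun y => cintegral setT (fun x => K x y)).
Proof.
move=> [m1 m2] ih ik Khk; apply: complex_eq => /=.
  apply: (@rfubini (fun x y => Re (K x y)) h k m1 ih ik) => x y.
  exact: le_trans (normc_Re _) (Khk x y).
apply: (@rfubini (fun x y => Im (K x y)) h k m2 ih ik) => x y.
exact: le_trans (normc_Im _) (Khk x y).
Qed.

End complex_integration.

(** * Changes of variables *)

Section density.
Context {R : realType}.
Local Notation mu := (@lebesgue_measure R).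
Import HBNNSimple.

(** The measure of density [p] with respect to the Lebesgue measure; the proofs
   are arguments so that the measure structure can be attached to it. *)
Definition density_measure (p : R -> R) (p0 : forall t, 0 <= p t)
    (mp : measurable_fun setT p) (A : set (measurableTypeR R)) : \bar R :=
  (\int[mu]_(t in A) (p t)%:E)%E.

Section measure.
Variables (p : R -> R) (p0 : forall t, 0 <= p t) (mp : measurable_fun setT p).
Local Notation nu := (density_measure p0 mp).

Let nu0 : nu set0 = 0%E.
Proof. by rewrite /density_measure integral_set0. Qed.

Let nu_ge0 A : (0 <= nu A)%E.
Proof. by apply: integral_ge0 => t _; rewrite lee_fin. Qed.

Let nu_sigma_additive : semi_sigma_additive nu.
Proof.
move=> F mF tF mUF; rewrite /density_measure ge0_integral_bigcup//.
- apply: is_cvg_ereal_nneg_natsum_cond => n _ _.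
  by apply: integral_ge0 => t _; rewrite lee_fin.
- by apply/measurable_EFinP; exact: measurable_funTS.
- by move=> t _; rewrite lee_fin.
Qed.

HB.instance Definition _ := isMeasure.Build _ _ _
  (density_measure p0 mp) nu0 nu_ge0 nu_sigma_additive.
End measure.

Lemma ge0_integral_density (p : R -> R) (p0 : forall t, 0 <= p t)
    (mp : measurable_fun setT p) (f : R -> \bar R) :
  measurable_fun setT f -> (forall t, 0 <= f t)%E ->
  (\int[density_measure p0 mp]_t f t = \int[mu]_t (f t * (p t)%:E))%E.
Proof.
move=> mf f0; set nu := density_measure p0 mp.
have mp' : measurable_fun setT (fun t => (p t)%:E) by exact/measurable_EFinP.
pose f_ := nnsfun_approx (@measurableT _ (measurableTypeR R)) mf.
have pos n r x : 0 <= r * \1_(f_ n @^-1` [set r]) x :> R.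
  have [r0|r0] := ltP r 0; first by rewrite preimage_nnfun0// indic0 mulr0.
  by rewrite mulr_ge0// indicE.
have step n : (\int[nu]_t (f_ n t)%:E = \int[mu]_t ((f_ n t)%:E * (p t)%:E))%E.
  under [LHS]eq_integral do rewrite fimfunE -fsumEFin//.
  rewrite [LHS]ge0_integral_fsum//; last 2 first.
    - by move=> r; exact/measurable_EFinP/measurableT_comp.
    - by move=> r x _; rewrite lee_fin pos.
  under [RHS]eq_integral.
    move=> x xD; rewrite fimfunE -fsumEFin// ge0_mule_fsuml; last first.
      by move=> r; rewrite lee_fin pos.
    over.
  rewrite [RHS]ge0_integral_fsum//; last 2 first.
    - by move=> r; apply: emeasurable_funM => //; exact/measurable_EFinP/measurableT_comp.
    - by move=> r x _; rewrite mule_ge0 ?lee_fin// pos.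
  apply: eq_fsbigr => r _.
  have [r0|r0] := ltP r 0.
    rewrite !integral0_eq// => x _; rewrite preimage_nnfun0// indic0 mulr0//.
    by rewrite mul0e.
  have mr : measurable (f_ n @^-1` [set r]) by exact: measurable_sfunP.
  under eq_integral do rewrite EFinM.
  rewrite ge0_integralZl ?lee_fin//; last first.
    by apply/measurable_EFinP; exact: measurable_indic.
  rewrite integral_indic// setIT.
  under [RHS]eq_integral do rewrite EFinM -muleA.
  rewrite ge0_integralZl ?lee_fin//; last 2 first.
    - by apply: emeasurable_funM => //; apply/measurable_EFinP; exact: measurable_indic.
    - by move=> x _; rewrite mule_ge0 ?lee_fin.
  congr (_ * _)%E; rewrite /nu/= /density_measure [LHS]integral_mkcond.
  apply: eq_integral => x _; rewrite patchE indicE.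
  by case: (x \in _); rewrite ?mul1e ?mul0e.
have cf t : (f_ n t)%:E @[n --> \oo] --> f t by exact: cvg_nnsfun_approx.
transitivity (limn (fun n => \int[nu]_t (f_ n t)%:E)%E).
  rewrite -monotone_convergence//=.
  - by apply: eq_integral => x _; apply/esym/cvg_lim => //; exact: cf.
  - by move=> n; exact/measurable_EFinP.
  - by move=> n x _; rewrite lee_fin.
  - by move=> x _ a b ab; rewrite lee_fin//; exact/lefP/nd_nnsfun_approx.
under eq_fun do rewrite step.
rewrite -monotone_convergence//=.
- apply: eq_integral => x _; apply/cvg_lim => //.
  by apply: cvgeZr => //; exact: cf.
- by move=> n; apply: emeasurable_funM => //; exact/measurable_EFinP.
- by move=> n x _; rewrite mule_ge0 ?lee_fin.
- move=> x _ a b ab; apply: lee_pmul; rewrite ?lee_fin//.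
  exact/lefP/nd_nnsfun_approx.
Qed.

End density.

Section substitution.
Context {R : realType}.
Local Notation mu := (@lebesgue_measure R).
Implicit Types (D : set R) (phi w : R -> R).

(** [phi] carries the measure of density [w] to the Lebesgue measure of [D]. *)
Record subst_rule D phi w : Prop := SubstRule {
  subst_dom : measurable D;
  subst_meas : measurable_fun setT phi;
  subst_wmeas : measurable_fun setT w;
  subst_w0 : forall y, 0 <= w y;
  subst_in : forall y, D (phi y);
  subst_ge0 : forall f : R -> \bar R, measurable_fun setT f ->
    (forall t, 0 <= f t)%E ->
    (\int[mu]_(t in D) f t = \int[mu]_y (f (phi y) * (w y)%:E))%E }.

Lemma subst_ge0_dom D phi w (f : R -> \bar R) : subst_rule D phi w ->
  measurable_fun D f -> (forall t, D t -> 0 <= f t)%E ->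
  (\int[mu]_(t in D) f t = \int[mu]_y (f (phi y) * (w y)%:E))%E.
Proof.
move=> [mD mphi mw w0 Dphi rule] mf f0.
transitivity (\int[mu]_(t in D) (f \_ D) t)%E.
  by apply: eq_integral => t Dt; rewrite patchE Dt.
rewrite rule; last 2 first.
- exact/(measurable_restrictT _ _).1.
- by move=> t; rewrite patchE; case: ifPn => // /[!inE] /f0.
by apply: eq_integral => y _; rewrite patchE mem_set.
Qed.

Lemma rintegral_subst D phi w (f : R -> R) : subst_rule D phi w -> measurable_fun D f ->
  \int[mu]_(t in D) f t = \int[mu]_y (w y * f (phi y)).
Proof.
move=> S mf; have w0 := subst_w0 S.
rewrite /Rintegral; congr fine; rewrite [LHS]integralE [RHS]integralE.
congr (_ - _)%E.
  rewrite (subst_ge0_dom S); last 2 first.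
  - by apply: measurable_funepos; exact/measurable_EFinP.
  - by move=> t _; exact: funepos_ge0.
  apply: eq_integral => y _; rewrite !funeposE -!EFin_max -EFinM; congr EFin.
  by rewrite mulrC maxr_pMr// mulr0.
rewrite (subst_ge0_dom S); last 2 first.
- by apply: measurable_funeneg; exact/measurable_EFinP.
- by move=> t _; exact: funeneg_ge0.
apply: eq_integral => y _; rewrite !funenegE -!EFinN -!EFin_max -EFinM; congr EFin.
by rewrite mulrC maxr_pMr// mulr0 mulrN.
Qed.

Lemma subst_comp_meas D phi w (f : R -> R) : subst_rule D phi w -> measurable_fun D f ->
  measurable_fun setT (fun y => f (phi y)).
Proof.
move=> [mD mphi mw w0 Dphi rule] mf.
have -> : (fun y => f (phi y)) = (fun y => (f \_ D) (phi y)).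
  by apply/funext => y; rewrite patchE mem_set.
apply: (measurableT_comp _ mphi).
exact/(measurable_restrictT _ _).1.
Qed.

Lemma rintegrable_subst D phi w (f : R -> R) : subst_rule D phi w -> measurable_fun D f ->
  rintegrable D f <-> rintegrable setT (fun y => w y * f (phi y)).
Proof.
move=> S mf; have w0 := subst_w0 S.
have mf' := subst_comp_meas S mf.
have E : (\int[mu]_(t in D) `|(f t)%:E| = \int[mu]_y `|(w y * f (phi y))%:E|)%E.
  rewrite (subst_ge0_dom S) => //; last first.
    by apply: measurableT_comp => //; exact/measurable_EFinP.
  by apply: eq_integral => y _; rewrite /= normrM [in RHS]ger0_norm// EFinM muleC.
split => /integrableP[m i]; apply/integrableP; split.
- apply/measurable_EFinP; apply: measurable_funM => //; exact: subst_wmeas S.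
- by rewrite -E.
- exact/measurable_EFinP.
- by rewrite E.
Qed.

Lemma cintegral_subst D phi w (f : R -> R[i]) : subst_rule D phi w -> cmeas D f ->
  cintegral D f = cintegral setT (fun y => (w y)%:C * f (phi y)).
Proof.
move=> S [f1 f2]; apply: complex_eq => /=; rewrite (rintegral_subst S)//.
  by apply: eq_Rintegral => t _; rewrite cReM/= mul0r subr0.
by apply: eq_Rintegral => t _; rewrite cImM/= mul0r addr0.
Qed.

Lemma cintegrable_subst D phi w (f : R -> R[i]) : subst_rule D phi w -> cmeas D f ->
  cintegrable D f <-> cintegrable setT (fun y => (w y)%:C * f (phi y)).
Proof.
move=> S [f1 f2]; rewrite /cintegrable.
have -> : (fun t => (Re ((w t)%:C * f (phi t)))%:E) =
  (fun t => (w t * Re (f (phi t)))%:E).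
  by apply/funext => t; rewrite cReM/= mul0r subr0.
have -> : (fun t => (Im ((w t)%:C * f (phi t)))%:E) =
  (fun t => (w t * Im (f (phi t)))%:E).
  by apply/funext => t; rewrite cImM/= mul0r addr0.
have [p q] := rintegrable_subst S f1; have [p' q'] := rintegrable_subst S f2.
by split=> -[i1 i2]; split; [exact: p|exact: p'|exact: q|exact: q'].
Qed.

(** A measure that is translated, dilated or reflected back to the Lebesgue
   measure is recognized on intervals. *)
Lemma subst_affine (r c : R) : 0 < r ->
  subst_rule setT (fun y => r * y + c) (fun=> r).
Proof.
move=> r0.
have mphi : measurable_fun setT (fun y => r * y + c : measurableTypeR R).
  by apply: measurable_funD => //; exact: measurable_funM.
split=> //; first by move=> _; exact: ltW.
move=> f mf f0.
pose nu := pushforward mu (fun y => r * y + c : measurableTypeR R).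
have nuE (A : set R) : measurable A -> mu A = mscale (NngNum (ltW r0)) nu A.
  move=> mA; apply: lebesgue_measure_unique => // _ [[a b]] _ <-.
  rewrite /mscale/= /nu /pushforward.
  rewrite [X in _ = (_ * mu X)%E](_ : _ = `](a - c) / r, (b - c) / r]%classic); last first.
    apply/seteqP; split=> y /=; rewrite !in_itv/= ltr_pdivrMr// ler_pdivlMr//.
      by rewrite mulrC ltrBlDr lerBrDr.
    by rewrite mulrC ltrBlDr lerBrDr.
  rewrite !lebesgue_measure_itv/= !lte_fin ltr_pM2r ?invr_gt0// ltrD2r.
  case: ifPn => _; last by rewrite mule0.
  by rewrite -!EFinB -EFinM; congr EFin; field; rewrite gt_eqF.
rewrite (@eq_measure_integral _ _ _ _ (mscale (NngNum (ltW r0)) nu)); last first.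
  by move=> A mA _; exact: nuE.
rewrite ge0_integral_mscale//= ge0_integral_pushforward//= preimage_setT.
rewrite -ge0_integralZl//; last 2 first.
- exact: (measurableT_comp mf).
- by rewrite lee_fin ltW.
by apply: eq_integral => y _; rewrite muleC.
Qed.

Lemma subst_opp : subst_rule setT (fun y : R => - y) (fun=> 1).
Proof.
have mN : measurable_fun setT (fun y : R => - y : measurableTypeR R).
  exact: oppr_measurable.
split=> // f mf f0.
pose nu := pushforward mu (fun y : R => - y : measurableTypeR R).
rewrite (@eq_measure_integral _ _ _ _ nu); last first.
  by move=> A mA _; exact/esym/lebesgue_measureN.
rewrite ge0_integral_pushforward//= preimage_setT.
by apply: eq_integral => y _; rewrite mule1.
Qed.

Lemma integral_inv_itv (a b : R) : 0 < a -> a < b ->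
  (\int[mu]_(t in `]a, b]) (t^-1)%:E = (ln b - ln a)%:E)%E.
Proof.
move=> a0 ab.
have inv_cont t : 0 < t -> {for t, continuous (fun u : R => u^-1)}.
  by move=> t0; apply: inv_continuous; rewrite gt_eqF.
rewrite integral_itv_obnd_cbnd; last first.
  by apply/measurable_EFinP; exact: measurable_funV.
rewrite (continuous_FTC2 (F := @ln R))// ?EFinB//.
- apply: continuous_in_subspaceT => t; rewrite inE/= in_itv/= => /andP[at_ _].
  by apply: inv_cont; exact: lt_le_trans at_.
- split=> [t||].
  + rewrite in_itv/= => /andP[at_ _]; apply: ex_derive.
    by apply: is_derive1_ln; exact: lt_trans at_.
  + by apply: cvg_at_right_filter; exact: continuous_ln.
  + by apply: cvg_at_left_filter; apply: continuous_ln; exact: lt_trans ab.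
- move=> t; rewrite in_itv/= => /andP[at_ _]; rewrite derive1E.
  by apply: derive_val; apply: is_derive1_ln; exact: lt_trans at_.
Qed.

(** The logarithm carries [dt / t] to the Lebesgue measure of the line. *)
Lemma subst_exp : subst_rule (@Rpos R) expR expR.
Proof.
have mpos : measurable (@Rpos R).
  by rewrite (_ : Rpos = `]0, +oo[%classic)//; apply/seteqP; split=> t /=;
    rewrite in_itv/= andbT.
split; [exact: mpos|exact: measurable_expR|exact: measurable_expR|exact: expR_ge0|exact: expR_gt0|]; move=> f mf f0.
pose p (t : R) : R := \1_(@Rpos R) t * t^-1.
have p0 t : 0 <= p t.
  rewrite /p indicE; case: (boolP (t \in _)) => [|_]; last by rewrite mul0r.
  by rewrite inE => t0; rewrite mul1r invr_ge0 ltW.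
have mp : measurable_fun setT p.
  apply: measurable_funM; first exact: measurable_indic.
  exact: measurable_funV.
have mln : measurable_fun setT (@ln R : R -> measurableTypeR R) by exact: measurable_ln.
pose nu := pushforward (density_measure p0 mp) (@ln R : R -> measurableTypeR R).
have nuE (A : set R) : measurable A -> mu A = nu A.
  move=> mA; apply: lebesgue_measure_unique => // _ [[a b]] /= ab <-.
  rewrite /nu /pushforward /= /density_measure lebesgue_measure_itv/= lte_fin.
  have -> : (\int[mu]_(t in @ln R @^-1` `]a, b]) (p t)%:E =
      \int[mu]_(t in `]expR a, expR b]) (t^-1)%:E)%E.
    rewrite [LHS]integral_mkcond [RHS]integral_mkcond.
    apply: eq_integral => t _; rewrite !patchE /p indicE.
    have [t0|t0] := ltP 0 t; last first.
      rewrite [t \in Rpos]memNset/= ?mul0r ?if_same; last by move/lt_geF; rewrite t0.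
      rewrite memNset// /= in_itv/= => /andP[at_ _].
      by move: (lt_le_trans at_ t0); rewrite ltNge expR_ge0.
    rewrite [t \in Rpos]mem_set// mul1r.
    have -> : (t \in @ln R @^-1` `]a, b]) = (t \in `]expR a, expR b]%classic); last by [].
    rewrite -[in RHS](lnK (x := t)) ?posrE//.
    by apply/idP/idP; rewrite !inE/= !in_itv/= ltr_expR ler_expR.
  case: ltP => ab'.
    by rewrite integral_inv_itv ?expR_gt0 ?ltr_expR// !expRK.
  by rewrite set_itv_ge ?integral_set0// bnd_simp -leNgt ler_expR.
pose g y := (f (expR y) * (expR y)%:E)%E.
have mg : measurable_fun setT g.
  apply: emeasurable_funM; first exact: measurableT_comp.
  by apply/measurable_EFinP; exact: measurable_expR.
have g0 y : (0 <= g y)%E by rewrite mule_ge0// lee_fin expR_ge0.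
rewrite -[RHS]/(\int[mu]_y g y)%E.
rewrite [in RHS](@eq_measure_integral _ _ _ _ nu); last by move=> A mA _; exact: nuE.
rewrite ge0_integral_pushforward//= ge0_integral_density//; last first.
  exact: (measurableT_comp mg).
rewrite integral_mkcond; apply: eq_integral => t _; rewrite patchE /g /p indicE /=.
case: ifPn => [|_]; last by rewrite mul0r mule0.
rewrite inE => t0; rewrite lnK ?posrE// mul1r -muleA -EFinM divff ?mule1//.
by rewrite gt_eqF.
Qed.

End substitution.

(** * Derivatives and the fundamental theorem for complex functions *)

Lemma normc_cvg_unique {R : realType} (T : Type) (F : set_system T)
    {PF : ProperFilter F} (u : T -> R[i]) (a b : R[i]) :
  normc (u x - a) @[x --> F] --> (0 : R) ->
  normc (u x - b) @[x --> F] --> (0 : R) -> a = b.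
Proof.
move=> ua ub; apply/eqP; rewrite -subr_eq0 -normc_eq0 eq_le normc_ge0 andbT.
have h : normc (u x - a) + normc (u x - b) @[x --> F] --> (0 : R).
  by rewrite -[X in _ --> X]addr0; exact: cvgD.
rewrite -(cvg_lim _ h)//; apply: limr_ge; first exact: cvgP h.
apply: nearW => x /=; rewrite [leRHS]addrC.
have -> : a - b = (u x - b) - (u x - a) by ring.
exact: le_normc_sub.
Qed.

Section complex_derivative.
Context {R : realType}.
Local Notation mu := (@lebesgue_measure R).
Implicit Types (f g : R -> R[i]).

Lemma rderivD (f g : R -> R) (x a b : R) : is_derive x 1 f a -> is_derive x 1 g b ->
  is_derive x 1 (fun t => f t + g t) (a + b).
Proof. by move=> fa gb; exact: is_deriveD. Qed.

Lemma rderivN (f : R -> R) (x a : R) : is_derive x 1 f a ->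
  is_derive x 1 (fun t => - f t) (- a).
Proof. by move=> fa; exact: is_deriveN. Qed.

Lemma rderivM (f g : R -> R) (x a b : R) : is_derive x 1 f a -> is_derive x 1 g b ->
  is_derive x 1 (fun t => f t * g t) (a * g x + f x * b).
Proof.
move=> fa gb; have := is_deriveM fa gb.
move/is_derive_eq; apply.
by rewrite /GRing.scale/= addrC; congr (_ + _); rewrite mulrC.
Qed.

Lemma rderivV (f : R -> R) (x a : R) : f x != 0 -> is_derive x 1 f a ->
  is_derive x 1 (fun t => (f t)^-1) (- a / f x ^+ 2).
Proof.
move=> fx fa; have := is_deriveV fx fa.
by move/is_derive_eq; apply; rewrite /GRing.scale/= mulNr mulrC mulNr.
Qed.

Lemma rderiv_comp (f g : R -> R) (x a b : R) : is_derive (g x) 1 f a ->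
  is_derive x 1 g b -> is_derive x 1 (fun t => f (g t)) (a * b).
Proof. by move=> fa gb; exact: is_derive1_comp. Qed.

Lemma rderiv_cont (f : R -> R) (x a : R) : is_derive x 1 f a -> {for x, continuous f}.
Proof. by move=> fa; apply/differentiable_continuous/derivable1_diffP/ex_derive. Qed.

Lemma rderiv_derive1 (f : R -> R) (x a : R) : is_derive x 1 f a -> derive1 f x = a.
Proof. by move=> fa; rewrite derive1E; exact: derive_val. Qed.

(** The derivative of a complex function of a real variable, by parts, as the
   real fundamental theorem of calculus applies to each part. *)
Definition cderiv f (x : R) (d : R[i]) : Prop :=
  is_derive x 1 (fun t => Re (f t)) (Re d) /\
  is_derive x 1 (fun t => Im (f t)) (Im d).

Lemma cderiv_eq f x d e : cderiv f x d -> d = e -> cderiv f x e.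
Proof. by move=> h <-. Qed.

Lemma cderivD f g x a b : cderiv f x a -> cderiv g x b ->
  cderiv (fun t => f t + g t) x (a + b).
Proof.
move=> [f1 f2] [g1 g2]; split; rewrite reimE.
  by under eq_fun do rewrite cReD; exact: rderivD.
by under eq_fun do rewrite cImD; exact: rderivD.
Qed.

Lemma cderivN f x a : cderiv f x a -> cderiv (fun t => - f t) x (- a).
Proof.
move=> [f1 f2]; split; rewrite reimE.
  by under eq_fun do rewrite cReN; exact: rderivN.
by under eq_fun do rewrite cImN; exact: rderivN.
Qed.

Lemma cderivM f g x a b : cderiv f x a -> cderiv g x b ->
  cderiv (fun t => f t * g t) x (a * g x + f x * b).
Proof.
move=> [f1 f2] [g1 g2]; split.
  under eq_fun do rewrite cReM.
  apply: (is_derive_eq (rderivD (rderivM f1 g1) (rderivN (rderivM f2 g2)))).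
  by rewrite !reimE; ring.
under eq_fun do rewrite cImM.
apply: (is_derive_eq (rderivD (rderivM f1 g2) (rderivM f2 g1))).
by rewrite !reimE; ring.
Qed.

Lemma cderiv_cst (z : R[i]) x : cderiv (fun=> z) x 0.
Proof. by split => /=; exact: is_derive_cst. Qed.

Lemma cderivZ f x a (z : R[i]) : cderiv f x a -> cderiv (fun t => z * f t) x (z * a).
Proof.
move=> fa; apply: cderiv_eq; first exact: (cderivM (cderiv_cst z x) fa).
by rewrite mul0r add0r.
Qed.

Lemma cderiv_real (f : R -> R) (x a : R) : is_derive x 1 f a ->
  cderiv (fun t => (f t)%:C) x a%:C.
Proof. by move=> fa; split => //=; exact: is_derive_cst. Qed.

Lemma cderiv_id (x : R) : cderiv (fun t => t%:C) x 1.
Proof. by apply: cderiv_real; exact: is_derive_id. Qed.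

Lemma cderiv_cexp f x a : cderiv f x a ->
  cderiv (fun t => cexp (f t)) x (a * cexp (f x)).
Proof.
move=> [f1 f2]; split.
  under eq_fun do rewrite Re_cexp.
  apply: (is_derive_eq (rderivM (rderiv_comp (is_derive_expR _) f1)
                    (rderiv_comp (is_derive_cos _) f2))).
  by rewrite reimE Re_cexp Im_cexp; ring.
under eq_fun do rewrite Im_cexp.
apply: (is_derive_eq (rderivM (rderiv_comp (is_derive_expR _) f1)
                  (rderiv_comp (is_derive_sin _) f2))).
by rewrite reimE Re_cexp Im_cexp; ring.
Qed.

Lemma cderivV f x a : f x != 0 -> cderiv f x a ->
  cderiv (fun t => (f t)^-1) x (- a / f x ^+ 2).
Proof.
move=> fx0 [f1 f2].
have n0 : Re (f x) ^+ 2 + Im (f x) ^+ 2 != 0.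
  by rewrite -sqr_normc2 sqrf_eq0 normc_eq0.
have E : (Re (f x) ^+ 2 - Im (f x) ^+ 2) ^+ 2 +
    (Re (f x) * Im (f x) + Im (f x) * Re (f x)) ^+ 2 =
    (Re (f x) ^+ 2 + Im (f x) ^+ 2) ^+ 2 by ring.
have d2 : is_derive x 1 (fun t => (Re (f t) * Re (f t) + Im (f t) * Im (f t))^-1)
   (- (Re a * Re (f x) + Re (f x) * Re a + (Im a * Im (f x) + Im (f x) * Im a)) /
    (Re (f x) * Re (f x) + Im (f x) * Im (f x)) ^+ 2).
  by apply: rderivV; [rewrite -!expr2|exact: (rderivD (rderivM f1 f1) (rderivM f2 f2))].
split.
  under eq_fun do rewrite cRe_inv !expr2.
  apply: (is_derive_eq (rderivM f1 d2)).
  by rewrite expr2 !(reimE, cRe_inv, cIm_inv) -!expr2 E; field.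
under eq_fun do rewrite cIm_inv !expr2.
apply: (is_derive_eq (rderivM (rderivN f2) d2)).
by rewrite expr2 !(reimE, cRe_inv, cIm_inv) -!expr2 E; field.
Qed.

Definition cderivable f (x : R) : Prop := exists d, cderiv f x d.

Lemma cderivable_cont f x : cderivable f x ->
  {for x, continuous (fun t => Re (f t))} /\ {for x, continuous (fun t => Im (f t))}.
Proof. by move=> [d [d1 d2]]; split; exact: rderiv_cont. Qed.

Lemma cderivable_cmeas f : (forall x, cderivable f x) -> cmeas setT f.
Proof.
by move=> df; split; apply: continuous_measurable_fun => x;
  case: (cderivable_cont (df x)).
Qed.

Let rFTC (F f : R -> R) (a b : R) : a < b ->
  (forall x, a <= x <= b -> is_derive x 1 F (f x)) ->
  (forall x, a <= x <= b -> {for x, continuous f}) ->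
  \int[mu]_(t in `[a, b]) f t = F b - F a.
Proof.
move=> ab dF cf; rewrite /Rintegral (continuous_FTC2 (F := F))//.
- apply: continuous_in_subspaceT => t; rewrite inE/= in_itv/=; exact: cf.
- have h x : a <= x <= b -> {for x, continuous F}.
    by move=> /dF; exact: rderiv_cont.
  split=> [t||].
  + by rewrite in_itv/= => /andP[a1 a2]; apply: ex_derive; apply: dF; rewrite !ltW.
  + by apply: cvg_at_right_filter; apply: h; rewrite lexx ltW.
  + by apply: cvg_at_left_filter; apply: h; rewrite lexx ltW.
- move=> t; rewrite in_itv/= => /andP[a1 a2]; rewrite derive1E.
  by apply: derive_val; apply: dF; rewrite !ltW.
Qed.

Lemma cFTC (F f : R -> R[i]) (a b : R) : a < b ->
  (forall x, a <= x <= b -> cderiv F x (f x)) ->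
  (forall x, a <= x <= b -> cderivable f x) ->
  cintegral `[a, b] f = F b - F a.
Proof.
move=> ab dF cf; apply: complex_eq; rewrite !reimE/=.
  apply: (@rFTC (fun t => Re (F t)) (fun t => Re (f t)) a b ab).
  - by move=> x /dF[].
  - by move=> x /cf/cderivable_cont[].
apply: (@rFTC (fun t => Im (F t)) (fun t => Im (f t)) a b ab).
- by move=> x /dF[].
- by move=> x /cf/cderivable_cont[].
Qed.

(** The integral over a half-line is a limit of integrals over segments by
   dominated convergence. *)
Lemma cFTCy (F f : R -> R[i]) (l : R[i]) :
  (forall x, 0 <= x -> cderiv F x (f x)) ->
  (forall x, 0 <= x -> cderivable f x) ->
  normc (F n%:R - l) @[n --> \oo] --> 0 ->
  cintegrable `[0, +oo[ f ->
  cintegral `[0, +oo[ f = l - F 0.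
Proof.
move=> dF df Fl cf.
have mI : measurable (`[0, +oo[%classic : set R) by [].
pose f_ n t := (\1_(`[0, n%:R]%classic : set R) t)%:C * f t.
have [|||_ cvf] := @cintegral_dct _ _ f_ f _ mI _ (cintegrable_normc mI cf).
- move=> n; apply: cmeasM; last exact: cintegrable_meas.
  by apply: cmeas_real; exact: measurable_indic.
- move=> n t _; rewrite /f_ normcMl normcR indicE.
  by case: (_ \in _); rewrite ?normr1 ?normr0 ?mul1r// mul0r normc_ge0.
- move=> t; rewrite /= in_itv/= andbT => t0.
  apply: cvg_near_cst; near=> n.
  rewrite /f_ indicE mem_set ?mul1r ?subrr ?normc_eq0//.
    by apply/eqP; rewrite normc_eq0.
  rewrite /= in_itv/= t0/=; near: n; exact: nbhs_infty_ger.
have cvF : normc (cintegral `[0, +oo[ (f_ n) - (l - F 0)) @[n --> \oo] --> 0.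
  apply: cvg_trans Fl; apply: near_eq_cvg; near=> n.
  have n0 : 0 < n%:R :> R by rewrite ltr0n; near: n; exact: nbhs_infty_gt.
  have -> : cintegral `[0, +oo[ (f_ n) = F n%:R - F 0.
    rewrite -(@cFTC F f _ _ n0); last 2 first.
    - by move=> x /andP[x0 _]; exact: dF.
    - by move=> x /andP[x0 _]; exact: df.
    rewrite [RHS]cintegral_mkcond [LHS]cintegral_mkcond.
    apply: eq_cintegral => t _; rewrite mulrA -rmorphM/= !indicE; congr (_%:C * _).
    have [t0|t0] := leP 0 t.
      by rewrite [t \in `[0, +oo[%classic]mem_set ?mul1r// /= in_itv/= t0.
    by rewrite memNset ?mul0r ?memNset//= in_itv/= leNgt t0.
  by congr normc; ring.
exact: normc_cvg_unique cvf cvF.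
Unshelve. all: by end_near. Qed.

End complex_derivative.

(** * Exponential integrals on a half-line *)

Section half_line.
Context {R : realType}.
Local Notation mu := (@lebesgue_measure R).
Implicit Types (f g : R -> R[i]).

Lemma cvg_expRNM (a : R) : 0 < a -> expR (- (a * n%:R)) @[n --> \oo] --> (0 : R).
Proof.
move=> a0.
have -> : (fun n : nat => expR (- (a * n%:R))) = (fun n => expR (- a) ^+ n).
  by apply/funext => n; rewrite -mulNr expRM_natr.
apply: cvg_expr.
by rewrite ger0_norm ?expR_ge0// expR_lt1 oppr_lt0.
Qed.

Lemma itv0yP (y : R) : (`[0, +oo[%classic : set R) y -> 0 <= y.
Proof. by rewrite /= in_itv/= andbT. Qed.

Lemma cvgM0 (c : R) (u : nat -> R) :
  u n @[n --> \oo] --> (0 : R) -> c * u n @[n --> \oo] --> (0 : R).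
Proof. by move=> u0; rewrite -[X in _ --> X](mulr0 c); apply: cvgM => //; exact: cvg_cst. Qed.

Lemma rintegrable_expRN (a : R) : 0 < a ->
  rintegrable `[0, +oo[ (fun y => expR (- (a * y))).
Proof.
move=> a0.
have dF (x : R) : is_derive x 1 (fun y => - a^-1 * expR (- (a * y))) (expR (- (a * x))).
  have h : is_derive x 1 (fun y : R => - (a * y)) (- (0 * x + a * 1)).
    by apply: rderivN; apply: rderivM.
  have h1 := rderivM (is_derive_cst (- a^-1) x 1) (rderiv_comp (is_derive_expR _) h).
  apply: (is_derive_eq h1).
  by rewrite /cst; field; rewrite gt_eqF.
have ce : continuous (fun y : R => expR (- (a * y))).
  move=> x; apply: continuous_comp; last exact: continuous_expR.
  by apply: cvgN; apply: cvgM; [exact: cvg_cst|exact: cvg_id].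
apply/integrableP; split.
  by apply/measurable_EFinP; apply: measurable_funTS; exact: continuous_measurable_fun.
under eq_integral do rewrite gee0_abs ?lee_fin ?expR_ge0//.
rewrite (ge0_continuous_FTC2y (F := fun y => - a^-1 * expR (- (a * y))) (l := 0))//.
- by rewrite -EFinB ltry.
- exact: continuous_subspaceT.
- rewrite -[X in _ --> X](mulr0 (- a^-1)); apply: cvgM; first exact: cvg_cst.
  have -> : (fun y : R => expR (- (a * y))) = (fun y => expR (- y)) \o (fun y => a * y) by [].
  apply: (cvg_comp _ _ _ (@cvgr_expR R)).
  by apply: gt0_cvgMry => //; exact: cvg_id.
- by apply: cvg_at_right_filter; exact: (rderiv_cont (dF 0)).
- by move=> x _; exact: (rderiv_derive1 (dF x)).
Qed.

Lemma le_mul_expRN (a y : R) : 0 < a -> 0 <= y ->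
  y * expR (- (a * y)) <= 2 / a * expR (- (a / 2 * y)).
Proof.
move=> a0 y0.
have -> : expR (- (a * y)) = expR (- (a / 2 * y)) * expR (- (a / 2 * y)).
  by rewrite -expRD; congr expR; field.
rewrite mulrA ler_pM2r ?expR_gt0// expRN ler_pdivrMr ?expR_gt0//.
rewrite -ler_pdivrMl ?divr_gt0// invf_div.
by rewrite (le_trans _ (expR_ge1Dx _))// lerDr.
Qed.

Lemma rintegrable_mul_expRN (a : R) : 0 < a ->
  rintegrable `[0, +oo[ (fun y => y * expR (- (a * y))).
Proof.
move=> a0; apply: (@rintegrable_le _ _ _ (fun y => 2 / a * expR (- (a / 2 * y)))) => //.
- apply: measurable_funM => //.
  by apply: measurableT_comp => //; apply: measurableT_comp => //; exact: measurable_funM.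
- by apply: rintegrableZ => //; apply: rintegrable_expRN; rewrite divr_gt0.
- move=> y /itv0yP y0.
  by rewrite ger0_norm ?mulr_ge0 ?expR_ge0// le_mul_expRN.
Qed.

Lemma cderiv_cexpM (z : R[i]) (x : R) :
  cderiv (fun y => cexp (- (z * y%:C))) x (- z * cexp (- (z * x%:C))).
Proof.
apply: cderiv_cexp; apply: cderivN.
by apply: (cderiv_eq (cderivZ z (cderiv_id x))); rewrite mulr1.
Qed.

Lemma Re_mulR (z : R[i]) (x : R) : Re (z * x%:C) = Re z * x.
Proof. by rewrite reimE/= mulr0 subr0. Qed.

Lemma normc_cexpM (z : R[i]) (y : R) :
  normc (cexp (- (z * y%:C))) = expR (- (Re z * y)).
Proof. by rewrite normc_cexp reimE Re_mulR. Qed.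

Lemma half_line_cexp (z : R[i]) : 0 < Re z ->
  cintegrable `[0, +oo[ (fun y => cexp (- (z * y%:C))) /\
  cintegral `[0, +oo[ (fun y => cexp (- (z * y%:C))) = z^-1.
Proof.
move=> z0.
have z_neq0 : z != 0 by apply: contraTneq z0 => ->; rewrite ltxx.
have ci : cintegrable `[0, +oo[ (fun y => cexp (- (z * y%:C))).
  apply: (@cintegrable_le _ _ _ (fun y => expR (- (Re z * y)))) => //.
  - apply: cmeasT; apply: cderivable_cmeas => x.
    by eexists; exact: cderiv_cexpM.
  - exact: rintegrable_expRN.
  - by move=> y _; rewrite normc_cexpM.
split=> //.
rewrite (@cFTCy _ (fun y => - z^-1 * cexp (- (z * y%:C))) _ 0)//.
- by rewrite mulr0 oppr0 cexp0; field.
- move=> x _; apply: (cderiv_eq (cderivZ _ (cderiv_cexpM z x))).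
  by field.
- by move=> x _; eexists; exact: cderiv_cexpM.
- under eq_fun do rewrite subr0 normcMl normc_opp normc_cexpM.
  by apply: cvgM0; exact: cvg_expRNM.
Qed.

Lemma half_line_mul_cexp (z : R[i]) : 0 < Re z ->
  cintegrable `[0, +oo[ (fun y => y%:C * cexp (- (z * y%:C))) /\
  cintegral `[0, +oo[ (fun y => y%:C * cexp (- (z * y%:C))) = z^-1 ^+ 2.
Proof.
move=> z0.
have z_neq0 : z != 0 by apply: contraTneq z0 => ->; rewrite ltxx.
have df x := cderivM (cderiv_id x) (cderiv_cexpM z x).
have ci : cintegrable `[0, +oo[ (fun y => y%:C * cexp (- (z * y%:C))).
  apply: (@cintegrable_le _ _ _ (fun y => y * expR (- (Re z * y)))) => //.
  - by apply: cmeasT; apply: cderivable_cmeas => x; eexists; exact: df.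
  - exact: rintegrable_mul_expRN.
  - move=> y /itv0yP y0.
    by rewrite normcMl normc_cexpM normcR ger0_norm.
split=> //.
rewrite (@cFTCy _ (fun y => - z^-1 * (y%:C * cexp (- (z * y%:C))) +
    - z^-1 ^+ 2 * cexp (- (z * y%:C))) _ 0)//.
- by rewrite mulr0 oppr0 cexp0 mul0r mulr0 add0r; ring.
- move=> x _; apply: (cderiv_eq (cderivD (cderivZ _ (df x)) (cderivZ _ (cderiv_cexpM z x)))).
  by field.
- by move=> x _; eexists; exact: df.
- have c1 : normc z^-1 * (2 / Re z * expR (- (Re z / 2 * n%:R))) +
     normc (- z^-1 ^+ 2) * expR (- (Re z * n%:R)) @[n --> \oo] --> (0 : R).
    rewrite -[X in _ --> X]addr0; apply: cvgD.
      by do 2 apply: cvgM0; apply: cvg_expRNM; rewrite divr_gt0.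
    by apply: cvgM0; exact: cvg_expRNM.
  apply: (squeeze_cvgr _ (cvg_cst 0) c1); apply: nearW => n.
  rewrite normc_ge0/= subr0 (le_trans (le_normc_add _ _))// lerD//.
    rewrite !normcMl normc_opp normc_cexpM normcR ler_wpM2l ?normc_ge0//.
    by rewrite ger0_norm// le_mul_expRN.
  by rewrite normcMl normc_cexpM.
Qed.

(** Folding an integral over the line onto the half-line. *)
Lemma rintegrable_fold (h : R -> R) : measurable_fun setT h ->
  rintegrable `[0, +oo[ h -> rintegrable `[0, +oo[ (fun y => h (- y)) ->
  rintegrable setT h.
Proof.
move=> mh i1 i2.
have mI : measurable (`[0, +oo[%classic : set R) by [].
have mJ : measurable (`]-oo, 0]%classic : set R) by [].
have j1 := (rintegrable_mkcond h mI).1 i1.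
have j2 : rintegrable setT (fun y => \1_(`]-oo, 0]%classic : set R) y * h y).
  apply/(rintegrable_subst subst_opp).
    by apply: measurable_funM => //; exact: measurable_indic.
  have -> : (fun y : R => 1 * (\1_(`]-oo, 0]%classic : set R) (- y) * h (- y))) =
      (fun y : R => \1_(`[0, +oo[%classic : set R) y * h (- y)).
    apply/funext => y; rewrite mul1r !indicE; congr ((nat_of_bool _)%:R * _).
    by apply/idP/idP; rewrite !inE/= !in_itv/= andbT oppr_le0.
  exact: (rintegrable_mkcond (fun y => h (- y)) mI).1.
apply: (@rintegrable_le _ _ _ (fun y => `|\1_(`[0, +oo[%classic : set R) y * h y| +
   `|\1_(`]-oo, 0]%classic : set R) y * h y|)) => //.
  by apply: rintegrableD => //; exact: integrable_norm.
move=> y _; rewrite !indicE; have [y0|y0] := leP 0 y.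
  by rewrite [y \in _]mem_set ?mul1r ?lerDl// /= in_itv/= y0.
rewrite [y \in `]-oo, 0]%classic]mem_set ?mul1r ?lerDr//= in_itv/=.
exact: ltW.
Qed.

Lemma rintegral_fold (h : R -> R) : rintegrable setT h ->
  \int[mu]_y h y = \int[mu]_(y in `[0, +oo[) h y + \int[mu]_(y in `[0, +oo[) h (- y).
Proof.
move=> ih.
have mh := rintegrable_meas measurableT ih.
have mI : measurable (`[0, +oo[%classic : set R) by [].
have mJ : measurable (`]-oo, 0[%classic : set R) by [].
have ihN : rintegrable setT (fun y => h (- y)).
  have [+ _] := rintegrable_subst subst_opp mh => /(_ ih).
  by under eq_fun do rewrite mul1r.
have E (y : R) : h y = \1_(`[0, +oo[%classic : set R) y * h y +
    \1_(`]-oo, 0[%classic : set R) y * h y.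
  rewrite -mulrDl !indicE; have [y0|y0] := leP 0 y.
    rewrite [y \in `[0, +oo[%classic]mem_set ?memNset/= ?in_itv/= ?y0//.
      by rewrite addr0 mul1r.
    by rewrite ltNge y0.
  rewrite [y \in `[0, +oo[%classic]memNset ?mem_set/= ?in_itv/= ?y0//.
    by rewrite add0r mul1r.
  by rewrite leNgt y0.
under eq_Rintegral do rewrite E.
have ihI : rintegrable `[0, +oo[ h by apply: rintegrableS ih.
have ihJ : rintegrable `]-oo, 0[ h by apply: rintegrableS ih.
rewrite RintegralD//; last 2 first.
- exact: (rintegrable_mkcond _ mI).1.
- exact: (rintegrable_mkcond _ mJ).1.
rewrite -rintegral_mkcond; congr (_ + _).
rewrite (rintegral_subst subst_opp); last first.
  by apply: measurable_funM => //; exact: measurable_indic.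
rewrite -Rintegral_itv_obnd_cbnd; last by apply: rintegrableS ihN.
rewrite [RHS]rintegral_mkcond; apply: eq_Rintegral => y _.
rewrite mul1r !indicE; congr ((nat_of_bool _)%:R * _).
by apply/idP/idP; rewrite !inE/= !in_itv/= andbT oppr_lt0.
Qed.

Lemma cintegral_fold f : cintegrable setT f ->
  cintegral setT f = cintegral `[0, +oo[ (fun y => f y + f (- y)).
Proof.
move=> cf; have [f1 f2] := cf.
have [g1 g2] : cintegrable setT (fun y => f (- y)).
  have mf := cintegrable_meas measurableT cf.
  have [+ _] := cintegrable_subst subst_opp mf => /(_ cf).
  by under eq_fun do rewrite mul1r.
rewrite cintegralD//; last 2 first.
- exact: cintegrableS cf.
- by apply: (@cintegrableS _ _ setT).
by apply: complex_eq; rewrite reimE; exact: rintegral_fold.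
Qed.

Definition poisson (d u : R) : R := 2 * d / (d ^+ 2 + u ^+ 2).

Lemma rintegrable_expR_abs (d : R) : 0 < d ->
  rintegrable setT (fun y => expR (- (d * `|y|))).
Proof.
move=> d0; have m : measurable_fun setT (fun y : R => expR (- (d * `|y|))).
  apply: measurableT_comp => //; apply: measurableT_comp => //.
  exact: measurable_funM.
have i : rintegrable `[0, +oo[ (fun y => expR (- (d * `|y|))).
  apply: (@rintegrable_le _ _ _ (fun y => expR (- (d * y)))) => //.
  - exact: measurable_funTS.
  - exact: rintegrable_expRN.
  - move=> y /itv0yP y0.
    by rewrite [`|y|]ger0_norm// ger0_norm ?expR_ge0.
apply: rintegrable_fold => //; apply: eq_integrable i => // y _.
by rewrite normrN.
Qed.

(** The Fourier transform of the two-sided exponential is the Poisson kernel. *)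
Lemma cintegral_expR_abs (d u : R) : 0 < d ->
  cintegral setT (fun y => (expR (- (d * `|y|)))%:C * ce (u * y)) = (poisson d u)%:C.
Proof.
move=> d0.
have mce : cmeas setT (fun y : R => ce (u * y)).
  by apply: cmeas_ce; exact: measurable_funM.
have ci : cintegrable setT (fun y => (expR (- (d * `|y|)))%:C * ce (u * y)).
  apply: (@cintegrable_le _ _ _ (fun y => expR (- (d * `|y|)))) => //.
  - apply: cmeasM => //; apply: cmeas_real.
    by apply: rintegrable_meas => //; exact: rintegrable_expR_abs.
  - exact: rintegrable_expR_abs.
  - by move=> y _; rewrite normcMl normc_ce mulr1 normcR ger0_norm ?expR_ge0.
rewrite cintegral_fold//.
have [i1 E1] := @half_line_cexp (d -i* u) d0.
have [i2 E2] := @half_line_cexp (d +i* u) d0.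
transitivity (cintegral `[0, +oo[ (fun y =>
   cexp (- ((d -i* u) * y%:C)) + cexp (- ((d +i* u) * y%:C)))).
  apply: eq_cintegral => y /itv0yP y0.
  rewrite normrN ger0_norm//; congr (_ + _); rewrite -cexpR /ce -cexpD;
    by congr cexp; apply: complex_eq; rewrite !reimE/=; ring.
rewrite cintegralD// E1 E2.
have n0 : d ^+ 2 + u ^+ 2 != 0 by rewrite gt_eqF// ltr_wpDr ?sqr_ge0// exprn_gt0.
apply: complex_eq; rewrite !(reimE, cRe_inv, cIm_inv)/= ?sqrrN /poisson; last by ring.
by field.
Qed.

Lemma poisson_ge0 (d u : R) : 0 < d -> 0 <= poisson d u.
Proof.
move=> d0; rewrite /poisson divr_ge0 ?mulr_ge0 ?(ltW d0)//.
by rewrite addr_ge0 ?sqr_ge0.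
Qed.

Lemma poisson_le (d u : R) : 0 < d -> poisson d u <= 2 / d.
Proof.
move=> d0; rewrite /poisson ler_pdivrMr; last first.
  by rewrite ltr_wpDr ?sqr_ge0// exprn_gt0.
have -> : 2 / d * (d ^+ 2 + u ^+ 2) = 2 * d + 2 / d * u ^+ 2 by field; rewrite gt_eqF.
by rewrite lerDl mulr_ge0 ?sqr_ge0// divr_ge0 ?(ltW d0).
Qed.

Lemma poissonN (d u : R) : poisson d (- u) = poisson d u.
Proof. by rewrite /poisson sqrrN. Qed.

Lemma poisson_meas (d : R) : measurable_fun setT (poisson d).
Proof.
apply: measurable_funM => //; apply: measurable_funV.
by apply: measurable_funD.
Qed.

Lemma poisson_integral (d : R) : 0 < d ->
  (\int[mu]_u (poisson d u)%:E = (2 * pi)%:E)%E.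
Proof.
move=> d0.
have I0 (x : R) : is_derive x 1 (fun u => 2 * atan (u / d)) (poisson d x).
  have h : is_derive x 1 (fun u : R => u * d^-1) (1 * d^-1 + x * 0).
    exact: rderivM.
  apply: (is_derive_eq (rderivM (is_derive_cst (2 : R) x 1)
     (rderiv_comp (is_derive1_atan _) h))).
  rewrite /poisson /cst; field; apply/andP; split; last by rewrite gt_eqF.
  by rewrite gt_eqF// ltr_wpDr ?sqr_ge0// exprn_gt0.
have cp : continuous (poisson d).
  move=> x; apply: cvgM; first exact: cvg_cst.
  apply: cvgV; last by apply: cvgD; [exact: cvg_cst|exact: exprn_continuous].
  by rewrite gt_eqF// ltr_wpDr ?sqr_ge0// exprn_gt0.
have half : (\int[mu]_(u in `[0%R, +oo[) (poisson d u)%:E = pi%:E)%E.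
  rewrite (ge0_continuous_FTC2y (F := fun u => 2 * atan (u / d)) (l := pi))//.
  - by rewrite mul0r atan0 mulr0 sube0.
  - by move=> x _; exact: poisson_ge0.
  - exact: continuous_subspaceT.
  - have -> : (pi : R) = 2 * (pi / 2) by field.
    apply: cvgM; first exact: cvg_cst.
    have -> : (fun y : R => atan (y / d)) = (@atan R) \o (fun y => d^-1 * y).
      by apply/funext => y /=; rewrite mulrC.
    apply: (cvg_comp _ _ _ (@cvgy_atan R)).
    by apply: gt0_cvgMry; rewrite ?invr_gt0//; exact: cvg_id.
  - by apply: cvg_at_right_filter; exact: (rderiv_cont (I0 0)).
  - by move=> x _; exact: (rderiv_derive1 (I0 x)).
rewrite ge0_symfun_integralT//; last 2 first.
- by move=> x; exact: poisson_ge0.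
- by move=> x /=; rewrite poissonN.
rewrite (_ : [set x | 0 <= x] = `[0, +oo[%classic); last first.
  by apply/seteqP; split=> t /=; rewrite in_itv/= andbT.
by rewrite half -EFinM.
Qed.

Lemma poisson_integrable (d : R) : 0 < d -> rintegrable setT (poisson d).
Proof.
move=> d0; apply/integrableP; split.
  by apply/measurable_EFinP; exact: poisson_meas.
under eq_integral do rewrite gee0_abs ?lee_fin ?poisson_ge0//.
by rewrite poisson_integral// ltry.
Qed.
End half_line.

(** * The Fourier transform and the Plancherel theorem *)

Section fourier.
Context {R : realType}.
Local Notation mu := (@lebesgue_measure R).
Implicit Types (F G k : R -> R[i]).

Definition four F (y : R) : R[i] := cintegral setT (fun t => F t * ce (t * y)).

Definition sq_integrable F : Prop :=
  cmeas setT F /\ rintegrable setT (fun t => normc (F t) ^+ 2).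

Definition sqn F : R := \int[mu]_t normc (F t) ^+ 2.

Lemma sqn_ge0 F : 0 <= sqn F.
Proof. by apply: Rintegral_ge0 => t _; exact: sqr_ge0. Qed.

Lemma sqnE F : sq_integrable F ->
  (\int[mu]_t (normc (F t) ^+ 2)%:E = (sqn F)%:E)%E.
Proof.
move=> [mF iF]; rewrite /sqn /Rintegral fineK//.
exact: integrable_fin_num.
Qed.

Lemma cmeas_mulce F y : cmeas setT F -> cmeas setT (fun t => F t * ce (t * y)).
Proof.
move=> mF; apply: cmeasM => //; apply: cmeas_ce; exact: measurable_funM.
Qed.

Lemma cintegrable_mulce F y : cintegrable setT F ->
  cintegrable setT (fun t => F t * ce (t * y)).
Proof.
move=> cF; apply: (@cintegrable_le _ _ _ (fun t => normc (F t))) => //.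
- by apply: cmeas_mulce; exact: cintegrable_meas.
- exact: cintegrable_normc.
- by move=> t _; rewrite normcMl normc_ce mulr1.
Qed.

Lemma normc_four_le F y : cintegrable setT F ->
  normc (four F y) <= \int[mu]_t normc (F t).
Proof.
move=> cF; apply: le_normc_cintegral_dom => //.
- by apply: cmeas_mulce; exact: cintegrable_meas.
- exact: cintegrable_normc.
- by move=> t _; rewrite normcMl normc_ce mulr1.
Qed.

Let four_kernel_meas k F (s : R) : cmeas setT k -> cmeas setT F ->
  cmeas setT (fun p : R * R => k p.1 * F p.2 * ce (s * (p.1 * p.2))).
Proof.
move=> mk mF; apply: cmeasM; first apply: cmeasM.
- exact: (cmeas_comp mk measurable_fst).
- exact: (cmeas_comp mF measurable_snd).
- apply: cmeas_ce; apply: measurable_funM => //.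
  by apply: measurable_funM; [exact: measurable_fst|exact: measurable_snd].
Qed.

Let four_kernel_le k F s x y :
  normc (k x * F y * ce (s * (x * y))) <= normc (k x) * normc (F y).
Proof. by rewrite !normcMl normc_ce mulr1. Qed.

Let four_kernelE k F s y : cintegrable setT F ->
  cintegral setT (fun t => k y * F t * ce (s * (y * t))) = k y * four F (s * y).
Proof.
move=> cF; rewrite /four -cintegralZ//; last exact: cintegrable_mulce.
by apply: eq_cintegral => t _; rewrite [RHS]mulrA; congr (_ * ce _); ring.
Qed.

Lemma cintegrable_mul_four k F (s : R) : cintegrable setT k -> cintegrable setT F ->
  cintegrable setT (fun y => k y * four F (s * y)).
Proof.
move=> ck cF.
have mk := cintegrable_meas measurableT ck.
have mF := cintegrable_meas measurableT cF.
have h := @cfubini_integrable R (fun y t => k y * F t * ce (s * (y * t))) _ _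
  (four_kernel_meas s mk mF) (cintegrable_normc measurableT ck)
  (cintegrable_normc measurableT cF) (four_kernel_le k F s).
apply: eq_cintegrable h => // y _; exact: four_kernelE.
Qed.

(** The multiplication formula: the Fourier transform is its own transpose. *)
Lemma four_swap k F (s : R) : cintegrable setT k -> cintegrable setT F ->
  cintegral setT (fun y => k y * four F (s * y)) =
  cintegral setT (fun t => F t * four k (s * t)).
Proof.
move=> ck cF.
have mk := cintegrable_meas measurableT ck.
have mF := cintegrable_meas measurableT cF.
have h := @cfubini R (fun y t => k y * F t * ce (s * (y * t))) _ _
  (four_kernel_meas s mk mF) (cintegrable_normc measurableT ck)
  (cintegrable_normc measurableT cF) (four_kernel_le k F s).
transitivity (cintegral setT (fun y =>
    cintegral setT (fun t => k y * F t * ce (s * (y * t))))).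
  by apply: eq_cintegral => y _; rewrite four_kernelE.
rewrite h; apply: eq_cintegral => t _; rewrite -four_kernelE//.
by apply: eq_cintegral => y _; rewrite [k y * _]mulrC [y * t]mulrC.
Qed.

Lemma cmeas_four F : cintegrable setT F -> cmeas setT (four F).
Proof.
move=> cF.
have ie : cintegrable setT (fun y : R => (expR (- (1 * `|y|)))%:C).
  by apply: cintegrable_real; exact: rintegrable_expR_abs.
have me := cintegrable_meas measurableT (cintegrable_mul_four 1 ie cF).
have -> : four F = (fun y => (expR `|y|)%:C * ((expR (- (1 * `|y|)))%:C * four F (1 * y))).
  apply/funext => y; rewrite mulrA -rmorphM/= -expRD !mul1r subrr expR0.
  by rewrite mul1r.
apply: cmeasM => //; apply: cmeas_real.
exact: measurableT_comp.
Qed.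

Lemma four_conj F y : cintegrable setT F ->
  conjc (four F y) = four (fun t => conjc (F t)) (- y).
Proof.
move=> cF; rewrite /four -cintegral_conj//; last exact: cintegrable_mulce.
by apply: eq_cintegral => t _; rewrite rmorphM/= conj_ce mulrN.
Qed.

(** Pairing of a function with its Poisson means: by the multiplication formula
   it is a weighted square norm of the Fourier transform. *)
Lemma four_poisson G (d : R) : 0 < d -> cintegrable setT G ->
  cintegral setT (fun y => (normc (four G y) ^+ 2 * expR (- (d * `|y|)))%:C) =
  cintegral setT (fun a => cintegral setT (fun b =>
    G a * conjc (G b) * (poisson d (a - b))%:C)).
Proof.
move=> d0 cG.
have cGc := cintegrable_conj measurableT cG.
have ie : cintegrable setT (fun y : R => (expR (- (d * `|y|)))%:C).
  by apply: cintegrable_real; exact: rintegrable_expR_abs.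
pose k y := (expR (- (d * `|y|)))%:C * conjc (four G y).
have ck : cintegrable setT k.
  have := cintegrable_mul_four (-1) ie cGc; apply: eq_cintegrable => // y _.
  by rewrite /k (four_conj y cG) mulN1r.
transitivity (cintegral setT (fun y => k y * four G (1 * y))).
  apply: eq_cintegral => y _; rewrite mul1r /k -mulrA [conjc _ * _]mulrC -normcX2.
  by rewrite rmorphM mulrC.
rewrite four_swap//; apply: eq_cintegral => a _; rewrite mul1r.
have cea : cintegrable setT (fun y => (expR (- (d * `|y|)))%:C * ce (y * a)).
  exact: cintegrable_mulce.
have -> : four k a = cintegral setT (fun b => conjc (G b) * (poisson d (a - b))%:C).
  transitivity (cintegral setT (fun y => ((expR (- (d * `|y|)))%:C * ce (y * a)) *
     four (fun t => conjc (G t)) (- 1 * y))).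
    apply: eq_cintegral => y _; rewrite /k -mulrA [RHS]mulrC mulN1r -(four_conj y cG).
    by rewrite !mulrA; congr (_ * _); rewrite mulrC.
  rewrite four_swap//; apply: eq_cintegral => b _; congr (_ * _).
  rewrite -cintegral_expR_abs//; apply: eq_cintegral => y _.
  by rewrite -mulrA -ceD; congr (_ * ce _); ring.
rewrite -cintegralZ//; last first.
  apply: (@cintegrable_le _ _ _ (fun b => 2 / d * normc (G b))) => //.
  - apply: cmeasM; first exact: cintegrable_meas.
    apply: cmeas_real; apply: (measurableT_comp (poisson_meas d)).
    exact: measurable_funB.
  - by apply: rintegrableZ => //; exact: cintegrable_normc.
  - move=> b _; rewrite normcMl normc_conj normcR ger0_norm ?poisson_ge0// mulrC.
    by rewrite ler_wpM2r ?normc_ge0// poisson_le.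
by apply: eq_cintegral => b _; rewrite mulrA.
Qed.

End fourier.

Section plancherel.
Context {R : realType}.
Local Notation mu := (@lebesgue_measure R).
Implicit Types (F G : R -> R[i]).

Definition shift_diff G (u : R) : R -> R[i] := fun b => G (b + u) - G b.

Lemma normc_sub_sqr (z w : R[i]) :
  normc (z - w) ^+ 2 = normc z ^+ 2 + normc w ^+ 2 - 2 * Re (z * conjc w).
Proof. by rewrite !sqr_normc2 !reimE; ring. Qed.

Lemma normc_sub_sqr_le (z w : R[i]) :
  normc (z - w) ^+ 2 <= 2 * normc z ^+ 2 + 2 * normc w ^+ 2.
Proof.
have : 0 <= normc (z + w) ^+ 2 by exact: sqr_ge0.
by rewrite !sqr_normc2 !reimE; lra.
Qed.

Lemma subst_shift (c : R) : subst_rule setT (fun y => y + c) (fun=> 1).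
Proof.
have := subst_affine c (@ltr01 R).
by under eq_fun do rewrite mul1r.
Qed.

Lemma integral_shift (f : R -> \bar R) c : measurable_fun setT f ->
  (forall t, 0 <= f t)%E -> (\int[mu]_t f (t + c)%R = \int[mu]_t f t)%E.
Proof.
move=> mf f0; rewrite [RHS](subst_ge0 (subst_shift c))//.
by apply: eq_integral => t _; rewrite mule1.
Qed.

Lemma sq_integrable_shift G c : sq_integrable G -> sq_integrable (fun t => G (t + c)).
Proof.
move=> [mG iG]; have S := subst_shift c.
split; first by apply: (cmeas_comp mG); exact: subst_meas S.
have [+ _] := rintegrable_subst S (cmeas_sqr_normc mG) => /(_ iG).
by under eq_fun do rewrite mul1r.
Qed.

Lemma sqn_shift G c : sq_integrable G -> sqn (fun t => G (t + c)) = sqn G.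
Proof.
move=> [mG iG]; rewrite [RHS](rintegral_subst (subst_shift c)).
  by apply: eq_Rintegral => t _; rewrite mul1r.
exact: cmeas_sqr_normc.
Qed.

Lemma sq_integrableB F G : sq_integrable F -> sq_integrable G ->
  sq_integrable (fun t => F t - G t).
Proof.
move=> [mF iF] [mG iG]; split; first exact: cmeasB.
apply: (@rintegrable_le _ _ _ (fun t => 2 * normc (F t) ^+ 2 + 2 * normc (G t) ^+ 2)) => //.
- by apply: cmeas_sqr_normc; exact: cmeasB.
- by apply: rintegrableD => //; exact: rintegrableZ.
- by move=> t _; rewrite ger0_norm ?sqr_ge0// normc_sub_sqr_le.
Qed.

Lemma sqnB_le F G : sq_integrable F -> sq_integrable G ->
  sqn (fun t => F t - G t) <= 2 * sqn F + 2 * sqn G.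
Proof.
move=> F2 G2; have [_ iFG] := sq_integrableB F2 G2.
have [_ iF] := F2; have [_ iG] := G2.
rewrite /sqn -!RintegralZl// -RintegralD//; last 2 first.
- exact: rintegrableZ.
- exact: rintegrableZ.
apply: le_Rintegral => //; first by apply: rintegrableD => //; exact: rintegrableZ.
by move=> t _; exact: normc_sub_sqr_le.
Qed.

Lemma sq_integrable_shift_diff G u : sq_integrable G -> sq_integrable (shift_diff G u).
Proof.
by move=> G2; apply: sq_integrableB => //; exact: sq_integrable_shift.
Qed.

Lemma shift_diff_le G u : sq_integrable G -> sqn (shift_diff G u) <= 4 * sqn G.
Proof.
move=> G2; have := sqnB_le (sq_integrable_shift u G2) G2.
by rewrite sqn_shift//; rewrite /shift_diff; lra.
Qed.

Let mfst (f : R -> R) : measurable_fun setT f ->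
  measurable_fun setT (fun p : R * R => f p.1).
Proof. by move=> mf; exact: (measurableT_comp mf measurable_fst). Qed.

Let msnd (f : R -> R) : measurable_fun setT f ->
  measurable_fun setT (fun p : R * R => f p.2).
Proof. by move=> mf; exact: (measurableT_comp mf measurable_snd). Qed.

Let mpoisson_sub d : measurable_fun setT (fun p : R * R => poisson d (p.1 - p.2)).
Proof.
apply: (measurableT_comp (poisson_meas d)).
by apply: measurable_funB; [exact: measurable_fst|exact: measurable_snd].
Qed.

Section poisson_mean.
Variables (G : R -> R[i]) (d : R).
Hypotheses (d0 : 0 < d) (cG : cintegrable setT G) (G2 : sq_integrable G).

Let mG : cmeas setT G. Proof. by case: G2. Qed.

Let X (p : R * R) : R := Re (G p.1 * conjc (G p.2)) * poisson d (p.1 - p.2).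
Let Y (p : R * R) : R :=
  2^-1 * (normc (G p.1) ^+ 2 + normc (G p.2) ^+ 2) * poisson d (p.1 - p.2).
Let Z (p : R * R) : R := 2^-1 * normc (G p.1 - G p.2) ^+ 2 * poisson d (p.1 - p.2).

Definition poisson_mean : R := \int[mu]_y (normc (four G y) ^+ 2 * expR (- (d * `|y|))).

Let YE p : Y p = X p + Z p.
Proof. by rewrite /X /Y /Z normc_sub_sqr; field. Qed.

Let cm1 : cmeas setT (fun p : R * R => G p.1).
Proof. exact: (cmeas_comp mG measurable_fst). Qed.
Let cm2 : cmeas setT (fun p : R * R => G p.2).
Proof. exact: (cmeas_comp mG measurable_snd). Qed.

Let mX : measurable_fun setT X.
Proof.
apply: measurable_funM => //.
by have [+ _] := cmeasM cm1 (cmeas_conj cm2).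
Qed.

Let mY : measurable_fun setT Y.
Proof.
apply: measurable_funM => //; apply: measurable_funM => //.
by apply: measurable_funD; exact: cmeas_sqr_normc.
Qed.

Let mZ : measurable_fun setT Z.
Proof.
apply: measurable_funM => //; apply: measurable_funM => //.
by apply: cmeas_sqr_normc; exact: cmeasB.
Qed.

Let Y0 p : 0 <= Y p.
Proof. by rewrite mulr_ge0 ?poisson_ge0// mulr_ge0 ?addr_ge0 ?sqr_ge0 ?invr_ge0. Qed.

Let Z0 p : 0 <= Z p.
Proof. by rewrite mulr_ge0 ?poisson_ge0// mulr_ge0 ?sqr_ge0 ?invr_ge0. Qed.

Let X_le x y : `|X (x, y)| <= 2 / d * normc (G x) * normc (G y).
Proof.
rewrite /X /= normrM [`|poisson _ _|]ger0_norm ?poisson_ge0//.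
rewrite -mulrA mulrC ler_pM ?poisson_ge0 ?poisson_le//.
by rewrite (le_trans (normc_Re _))// normcMl normc_conj.
Qed.

Let iXk : rintegrable setT (fun x => 2 / d * normc (G x)).
Proof. by apply: rintegrableZ => //; exact: cintegrable_normc. Qed.

Let iXl : rintegrable setT (fun x => normc (G x)).
Proof. exact: cintegrable_normc. Qed.

Let mX' : measurable_fun setT (fun p : R * R => X (p.1, p.2)).
Proof. by move: mX; rewrite (_ : X = fun p => X (p.1, p.2))//; apply/funext => -[]. Qed.

Let iX : (mu \x mu)%E.-integrable setT (fun p : R * R => (X p)%:E).
Proof.
have := @rintegrable_prod R (fun x y => X (x, y)) _ _ mX' iXk iXl X_le.
by apply: eq_integrable => // -[].
Qed.

Let intX : (\int[mu \x mu]_p (X p)%:E = poisson_mean%:E)%E.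
Proof.
have iXx x := @rintegrable_section R (fun x y => X (x, y)) _ _ x mX' iXl X_le.
have iXX := @rfubini_integrable R (fun x y => X (x, y)) _ _ mX' iXk iXl X_le.
rewrite -integral12_prod_meas1//.
have -> : poisson_mean = \int[mu]_a (\int[mu]_b X (a, b)).
  have /(congr1 (@complex.Re R)) := four_poisson d0 cG.
  rewrite cintegral_real [LHS]/= -/poisson_mean => ->.
  rewrite [LHS]/=; apply: eq_Rintegral => a _; apply: eq_Rintegral => b _.
  by rewrite Re_mulR.
rewrite [in RHS]/Rintegral fineK; last exact: integrable_fin_num.
apply: eq_integral => a _; rewrite /fubini_F /Rintegral fineK//.
by apply: integrable_fin_num => //; exact: iXx.
Qed.

Let poisson_shift a : (\int[mu]_b (poisson d (b - a)%R)%:E = (2 * pi)%:E)%E.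
Proof.
rewrite -(poisson_integral d0).
apply: (integral_shift (f := fun b => (poisson d b)%:E)).
  by apply/measurable_EFinP; exact: poisson_meas.
by move=> t; rewrite lee_fin poisson_ge0.
Qed.

Let intY : (\int[mu \x mu]_p (Y p)%:E = (2 * pi * sqn G)%:E)%E.
Proof.
pose g (t : R) := 2^-1 * normc (G t) ^+ 2.
have g0 t : 0 <= g t by rewrite mulr_ge0 ?sqr_ge0 ?invr_ge0.
have mg : measurable_fun setT g.
  by apply: measurable_funM => //; exact: cmeas_sqr_normc.
have intg : (\int[mu]_t ((g t)%:E * (2 * pi)%:E) = (pi * sqn G)%:E)%E.
  rewrite ge0_integralZr//; last 3 first.
  - exact/measurable_EFinP.
  - by move=> t _; rewrite lee_fin.
  - by rewrite lee_fin mulr_ge0 ?pi_ge0.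
  under eq_integral do rewrite EFinM.
  rewrite ge0_integralZl ?lee_fin ?invr_ge0//; last 2 first.
  - by apply/measurable_EFinP; exact: cmeas_sqr_normc.
  - by move=> t _; rewrite lee_fin sqr_ge0.
  by rewrite sqnE// -!EFinM; congr EFin; field.
pose A (p : R * R) := ((g p.1)%:E * (poisson d (p.1 - p.2))%:E)%E.
pose B (p : R * R) := ((g p.2)%:E * (poisson d (p.1 - p.2))%:E)%E.
have mA : measurable_fun setT A.
  by apply/measurable_EFinP; apply: measurable_funM => //; exact: mfst.
have mB : measurable_fun setT B.
  by apply/measurable_EFinP; apply: measurable_funM => //; exact: msnd.
have A0 p : (0 <= A p)%E by rewrite mule_ge0 ?lee_fin ?poisson_ge0.
have B0 p : (0 <= B p)%E by rewrite mule_ge0 ?lee_fin ?poisson_ge0.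
transitivity (\int[mu \x mu]_p (A p + B p))%E.
  apply: eq_integral => p _; rewrite /A /B /Y /g -!EFinM -EFinD; congr EFin.
  by ring.
rewrite ge0_integralD//.
rewrite fubini_tonelli1// fubini_tonelli2// /fubini_F /fubini_G.
have eA a : (\int[mu]_b A (a, b) = (g a)%:E * (2 * pi)%:E)%E.
  rewrite /A/= ge0_integralZl ?lee_fin//; last 2 first.
  - apply/measurable_EFinP; apply: (measurableT_comp (poisson_meas d)).
    exact: measurable_funB.
  - by move=> b _; rewrite lee_fin poisson_ge0.
  congr (_ * _)%E; rewrite -(poisson_shift a); apply: eq_integral => b _.
  by rewrite -poissonN opprB.
have eB b : (\int[mu]_a B (a, b) = (g b)%:E * (2 * pi)%:E)%E.
  rewrite /B/= ge0_integralZl ?lee_fin//; last 2 first.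
  - apply/measurable_EFinP; apply: (measurableT_comp (poisson_meas d)).
    exact: measurable_funB.
  - by move=> a _; rewrite lee_fin poisson_ge0.
  by congr (_ * _)%E; rewrite -(poisson_shift b).
under eq_integral do rewrite eA.
under [X in (_ + X)%E]eq_integral do rewrite eB.
by rewrite intg -EFinD; congr EFin; ring.
Qed.

Let intZ : (\int[mu \x mu]_p (Z p)%:E =
  \int[mu]_v (2^-1 * (poisson 1 v * sqn (shift_diff G (d * v))))%:E)%E.
Proof.
have md p : measurable_fun setT (fun p : R * R => d * p.2 + p.1).
  apply: measurable_funD; last exact: measurable_fst.
  by apply: measurable_funM => //; exact: measurable_snd.
rewrite fubini_tonelli2//; last exact/measurable_EFinP.
rewrite /fubini_G.
pose K (b v : R) : R := 2^-1 * normc (shift_diff G (d * v) b) ^+ 2 * poisson 1 v.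
have eZ b : (\int[mu]_a (Z (a, b))%:E = \int[mu]_v (K b v)%:E)%E.
  rewrite (subst_ge0 (subst_affine b d0)); last 2 first.
  - apply/measurable_EFinP.
    exact: (measurableT_comp mZ (measurable_pair2 b)).
  - by move=> a; rewrite lee_fin.
  apply: eq_integral => v _; rewrite -EFinM; congr EFin.
  rewrite /Z /K /shift_diff /= addrK [b + _]addrC -[LHS]mulrA; congr (_ * _).
  rewrite /poisson expr1n mulr1; field.
  by apply/andP; split; rewrite gt_eqF// ltr_wpDr ?sqr_ge0// exprn_gt0.
under eq_integral do rewrite eZ.
have mK : measurable_fun setT (fun p : R * R => K p.1 p.2).
  apply: measurable_funM; last exact: (msnd (poisson_meas 1)).
  apply: measurable_funM => //; apply: cmeas_sqr_normc; apply: cmeasB => //.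
  apply: (cmeas_comp mG); apply: measurable_funD; first exact: measurable_fst.
  by apply: measurable_funM => //; exact: measurable_snd.
rewrite (@fubini_tonelli _ _ _ _ _ mu mu (fun p => (K p.1 p.2)%:E)); last 2 first.
- exact/measurable_EFinP.
- by move=> p; rewrite lee_fin mulr_ge0 ?poisson_ge0// mulr_ge0 ?invr_ge0 ?sqr_ge0.
apply: eq_integral => v _ /=.
have S2 := sq_integrable_shift_diff (d * v) G2.
under eq_integral do rewrite /K mulrAC EFinM.
rewrite ge0_integralZl//; last 3 first.
- by apply/measurable_EFinP; apply: cmeas_sqr_normc; case: S2.
- by move=> b _; rewrite lee_fin sqr_ge0.
- by rewrite lee_fin mulr_ge0 ?invr_ge0 ?poisson_ge0.
by rewrite (sqnE S2) -EFinM; congr EFin; ring.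
Qed.

(** The defect of the Poisson mean of the Fourier transform measures how far [G]
   is from its translates. *)
Lemma poisson_mean_defect :
  (\int[mu]_v (2^-1 * (poisson 1 v * sqn (shift_diff G (d * v))))%:E =
   (2 * pi * sqn G - poisson_mean)%:E)%E.
Proof.
rewrite -intZ EFinB -intY -intX -integralB//.
- by apply: eq_integral => p _; rewrite -EFinB YE addrAC subrr add0r.
- apply/integrableP; split; first exact/measurable_EFinP.
  under eq_integral do rewrite gee0_abs ?lee_fin//.
  by rewrite intY ltry.
Qed.

(** The defect is an integral of squares. *)
Lemma poisson_mean_le : poisson_mean <= 2 * pi * sqn G.
Proof.
rewrite -subr_ge0 -lee_fin -poisson_mean_defect; apply: integral_ge0 => v _.
by rewrite lee_fin mulr_ge0 ?invr_ge0// mulr_ge0 ?poisson_ge0 ?sqn_ge0.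
Qed.

End poisson_mean.

End plancherel.

Section bessel.
Context {R : realType}.
Local Notation mu := (@lebesgue_measure R).
Implicit Types (F G : R -> R[i]).

Lemma rintegrable_poisson_mean G (d : R) : 0 < d -> cintegrable setT G ->
  rintegrable setT (fun y => normc (four G y) ^+ 2 * expR (- (d * `|y|))).
Proof.
move=> d0 cG; set M := \int[mu]_t normc (G t).
have M0 : 0 <= M by apply: Rintegral_ge0 => t _; exact: normc_ge0.
apply: (@rintegrable_le _ _ _ (fun y => M ^+ 2 * expR (- (d * `|y|)))) => //.
- apply: measurable_funM; first by apply: cmeas_sqr_normc; exact: cmeas_four.
  by apply: rintegrable_meas => //; exact: rintegrable_expR_abs.
- by apply: rintegrableZ => //; exact: rintegrable_expR_abs.
- move=> y _; rewrite ger0_norm ?mulr_ge0 ?normc_ge0 ?expR_ge0//.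
  rewrite ler_wpM2r ?expR_ge0//.
  by apply: lerXn2r; rewrite ?nnegrE ?normc_ge0// normc_four_le.
Qed.

Lemma poisson_meanE G (d : R) : 0 < d -> cintegrable setT G ->
  (\int[mu]_y (normc (four G y) ^+ 2 * expR (- (d * `|y|)))%:E =
  (poisson_mean G d)%:E)%E.
Proof.
move=> d0 cG; rewrite /poisson_mean /Rintegral fineK//.
apply: integrable_fin_num => //; exact: rintegrable_poisson_mean.
Qed.

(** The bound of the Poisson means passes to the limit by monotone convergence,
   as their weights increase to [1]. *)
Lemma bessel G : cintegrable setT G -> sq_integrable G ->
  sq_integrable (four G) /\ sqn (four G) <= 2 * pi * sqn G.
Proof.
move=> cG G2; have mF := cmeas_four cG.
pose f_ (n : nat) (y : R) := (normc (four G y) ^+ 2 * expR (- (n.+1%:R^-1 * `|y|)))%:E.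
have cf y : f_ n y @[n --> \oo] --> (normc (four G y) ^+ 2)%:E.
  apply: cvg_EFin; first exact: nearW.
  have h0 : - (n.+1%:R^-1 * `|y|) @[n --> \oo] --> (0 : R).
    rewrite -oppr0; apply: cvgN; rewrite -(mul0r `|y|).
    by apply: cvgM; [exact: cvg_harmonic|exact: cvg_cst].
  have h1 : expR (- (n.+1%:R^-1 * `|y|)) @[n --> \oo] --> (1 : R).
    by rewrite -[X in _ --> X]expR0; apply: continuous_cvg => //; exact: continuous_expR.
  by rewrite -[X in _ --> X]mulr1; apply: cvgM => //; exact: cvg_cst.
have le_int : (\int[mu]_y (normc (four G y) ^+ 2)%:E <= (2 * pi * sqn G)%:E)%E.
  have -> : (\int[mu]_y (normc (four G y) ^+ 2)%:E = limn (fun n => \int[mu]_y f_ n y))%E.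
    rewrite -monotone_convergence//.
    - by apply: eq_integral => y _; apply/esym/cvg_lim => //; exact: cf.
    - move=> n; apply/measurable_EFinP.
      by apply: rintegrable_meas => //; exact: rintegrable_poisson_mean.
    - by move=> n y _; rewrite lee_fin mulr_ge0 ?sqr_ge0 ?expR_ge0.
    - move=> y _ a b ab; rewrite lee_fin ler_wpM2l ?sqr_ge0// ler_expR lerN2.
      by rewrite ler_wpM2r// lef_pV2 ?posrE// ler_nat.
  apply: lime_le.
    apply: ereal_nondecreasing_is_cvgn => a b ab; apply: ge0_le_integral => //.
    - by move=> y _; rewrite lee_fin mulr_ge0 ?sqr_ge0 ?expR_ge0.
    - apply/measurable_EFinP.
      by apply: rintegrable_meas => //; exact: rintegrable_poisson_mean.
    - apply/measurable_EFinP.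
      by apply: rintegrable_meas => //; exact: rintegrable_poisson_mean.
    - move=> y _; rewrite lee_fin ler_wpM2l ?sqr_ge0// ler_expR lerN2.
      by rewrite ler_wpM2r// lef_pV2 ?posrE// ler_nat.
  apply: nearW => n; rewrite /f_ poisson_meanE// lee_fin.
  exact: poisson_mean_le.
have F2 : sq_integrable (four G).
  split=> //; apply/integrableP; split.
    by apply/measurable_EFinP; exact: cmeas_sqr_normc.
  under eq_integral do rewrite gee0_abs ?lee_fin ?sqr_ge0//.
  by rewrite (le_lt_trans le_int)// ltry.
by split=> //; rewrite -lee_fin -sqnE.
Qed.

End bessel.

(** Continuity of translation in the mean is checked on bounded functions of
   bounded support, which are close in the mean to continuous functions. *)
Section shift_continuity.
Context {R : realType}.
Local Notation mu := (@lebesgue_measure R).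
Implicit Types (F G : R -> R[i]).

Let I (N : R) : set R := `[- N, N]%classic.

Let mI N : measurable (I N). Proof. exact: measurable_itv. Qed.

Let II (N y : R) : (I N y) <-> (`|y| <= N).
Proof. by rewrite /I /= in_itv/= ler_norml; split. Qed.

Lemma rintegrable_bounded_itv (g : R -> R) (N M : R) : measurable_fun setT g ->
  (forall t, `|t| <= N -> `|g t| <= M) -> rintegrable (I N) g.
Proof.
move=> mg gM; apply: (@rintegrable_le _ _ _ (fun=> M)) => //.
- exact: measurable_funTS.
- apply: (@continuous_compact_integrable R (cst M)); first exact: segment_compact.
  by apply: continuous_subspaceT => x; exact: cvg_cst.
- by move=> t /II; exact: gM.
Qed.

(** Approximation of a bounded function by continuous ones of compact support,
   for which uniform continuity applies. *)
Lemma shift_L1_bounded (g : R -> R) (N : R) (u : nat -> R) : 0 <= N ->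
  measurable_fun setT g -> (forall t, `|g t| <= N) ->
  (forall t, N < `|t| -> g t = 0) -> u n @[n --> \oo] --> (0 : R) ->
  \int[mu]_b `|g (b + u n) - g b| @[n --> \oo] --> (0 : R).
Proof.
move=> N0 mg gN g0 u0.
have ig : rintegrable (I (N + 2)) g.
  by apply: (@rintegrable_bounded_itv _ _ N) => // t _.
have muI : (mu (I (N + 2)) < +oo)%E.
  by rewrite /I lebesgue_measure_itv/=; case: ifP => _; rewrite ?ltry// -EFinB ltry.
have [h_ [ch ih h0]] := approximation_continuous_integrable (mI (N + 2)) muI ig.
apply/cvgrPdist_le => /= e e0.
have e4 : 0 < e / 4 by rewrite divr_gt0.
have [k hk] : exists k, (\int[mu]_(z in I (N + 2)) `|(g z - h_ k z)%:E| <= (e / 4)%:E)%E.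
  move/fine_cvgP : h0 => [[n0 _ fin]] /cvgrPdist_le/(_ _ e4) [n1 _ h1].
  exists (maxn n0 n1).
  have := h1 (maxn n0 n1) (leq_maxr _ _).
  rewrite sub0r normrN /= => h2.
  rewrite -(fineK (fin (maxn n0 n1) (leq_maxl _ _))) lee_fin.
  exact: le_trans (ler_norm _) h2.
set h := h_ k in hk.
have mh : measurable_fun setT h by apply: continuous_measurable_fun; exact: ch.
have [M hM] : exists M : R, forall t, `|t| <= N + 2 -> `|h t| <= M.
  have cpt : compact (h @` I (N + 2)).
    apply: continuous_compact; last exact: segment_compact.
    by apply: continuous_subspaceT; exact: ch.
  have [M [_ HM]] := compact_bounded cpt.
  exists (M + 1) => t tN; apply: (HM (M + 1)); first by rewrite ltrDl.
  by exists t => //; exact/II.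
pose q (b : R) : R := \1_(I (N + 2)) b * `|g b - h b|.
have q0 b : 0 <= q b by rewrite mulr_ge0// indicE.
have igh : rintegrable (I (N + 2)) (fun b => `|g b - h b|).
  apply: integrable_norm; apply: rintegrableB => //.
  by apply: (@rintegrable_bounded_itv _ _ M) => // t tN; exact: hM.
have iq : rintegrable setT q by exact: (rintegrable_mkcond _ (mI _)).1.
have q_le : \int[mu]_b q b <= e / 4.
  rewrite /q -(rintegral_mkcond (I (N + 2)) (fun b => `|g b - h b|)) -lee_fin.
  by rewrite /Rintegral fineK//; exact: (@integrable_fin_num _ _ _ mu _ (mI (N + 2)) _ igh).
have iqs c : rintegrable setT (fun b => q (b + c)).
  have [+ _] := rintegrable_subst (subst_shift c) (rintegrable_meas measurableT iq).
  by move=> /(_ iq); under eq_fun do rewrite mul1r.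
have q_shift c : \int[mu]_b q (b + c) = \int[mu]_b q b.
  rewrite [RHS](rintegral_subst (subst_shift c)); last exact: rintegrable_meas measurableT iq.
  by apply: eq_Rintegral => b _; rewrite mul1r.
pose r n (b : R) : R := \1_(I (N + 1)) b * (((`|u n| <= 1)%R : bool)%:R * `|h (b + u n) - h b|).
have mr n : measurable_fun setT (r n).
  apply: measurable_funM; first exact: measurable_indic.
  apply: measurable_funM => //; apply: measurableT_comp => //.
  apply: measurable_funB => //; apply: (measurableT_comp mh).
  exact: measurable_funD.
have M0 : 0 <= M by apply: le_trans (normr_ge0 _) (hM 0 _); rewrite normr0 addr_ge0.
have r_le n b : `|r n b| <= \1_(I (N + 1)) b * (2 * M).
  rewrite /r ger0_norm; last by rewrite !mulr_ge0// indicE.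
  rewrite indicE; case: (boolP (b \in _)) => [|_]; last by rewrite !mul0r.
  rewrite inE => /II bN; rewrite !mul1r.
  have [un1|_] := leP `|u n| 1; last by rewrite mul0r mulr_ge0.
  rewrite mul1r (le_trans (ler_normB _ _))// mulr_natl mulr2n lerD//; apply: hM.
    rewrite (le_trans (ler_normD _ _))//; lra.
  lra.
have i1 : rintegrable setT (fun b => \1_(I (N + 1)) b * (2 * M)).
  apply: (rintegrable_mkcond (fun=> 2 * M) (mI _)).1.
  by apply: (@rintegrable_bounded_itv _ _ (2 * M)) => // t _; rewrite ger0_norm ?mulr_ge0.
have r0 b : r n b @[n --> \oo] --> (0 : R).
  rewrite -[X in _ --> X](mulr0 (\1_(I (N + 1)) b)); apply: cvgM; first exact: cvg_cst.
  have hb : `|h (b + u n) - h b| @[n --> \oo] --> (0 : R).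
    apply/norm_cvg0P/subr_cvg0; apply: continuous_cvg; first exact: ch.
    rewrite -[X in _ --> X]addr0; apply: cvgD => //; exact: cvg_cst.
  apply: (squeeze_cvgr _ (cvg_cst 0) hb); apply: nearW => n.
  rewrite mulr_ge0//=; case: (leP `|u n| 1) => _; first by rewrite mul1r.
  by rewrite mul0r.
have [_] := rintegral_dct measurableT mr i1 (fun n b _ => r_le n b) (fun b _ => r0 b).
rewrite Rintegral_cst// mul0r => ri0.
move/cvgrPdist_le : ri0 => /(_ _ e4) r_small.
move/cvgrPdist_le : (u0) => /(_ 1 ltr01) u_small.
near=> n.
have un1 : `|u n| <= 1.
  have : `|0 - u n| <= 1 by near: n; exact: u_small.
  by rewrite sub0r normrN.
have rn : \int[mu]_b r n b <= e / 4.
  have : `|0 - \int[mu]_b r n b| <= e / 4 by near: n; exact: r_small.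
  by rewrite sub0r normrN => /(le_trans (ler_norm _)).
rewrite sub0r normrN ger0_norm; last by apply: Rintegral_ge0.
have irn : rintegrable setT (r n).
  apply: (rintegrable_le measurableT (mr n) i1) => b _; exact: r_le.
have isum : rintegrable setT (fun b => q (b + u n) + q b + r n b).
  by apply: rintegrableD => //; exact: rintegrableD.
have pt b : `|g (b + u n) - g b| <= q (b + u n) + q b + r n b.
  have [bN|bN] := leP `|b| (N + 1).
    have bN' : `|b + u n| <= N + 2 by rewrite (le_trans (ler_normD _ _))//; lra.
    rewrite /q /r !indicE !mem_set ?mul1r; [|exact/II|apply/II; lra|exact/II].
    rewrite un1 mul1r.
    have -> : g (b + u n) - g b =
      (g (b + u n) - h (b + u n)) + (h b - g b) + (h (b + u n) - h b) by ring.
    rewrite (le_trans (ler_normD _ _))// lerD2r (le_trans (ler_normD _ _))//.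
    by rewrite [`|h b - g b|]distrC.
  rewrite !g0 ?subrr ?normr0 ?addr_ge0//.
  - by rewrite mulr_ge0// ?indicE// mulr_ge0.
  - lra.
  - have := lerB_normD b (u n); lra.
apply: (@le_trans _ _ (\int[mu]_b (q (b + u n) + q b + r n b))).
  apply: le_Rintegral => //.
  apply: (rintegrable_le measurableT _ isum) => [|b _]; last by rewrite normr_id.
  apply: measurableT_comp => //; apply: measurable_funB => //.
  apply: (measurableT_comp mg); exact: measurable_funD.
rewrite RintegralD//; last exact: rintegrableD.
rewrite RintegralD//; last exact: iqs.
rewrite [X in X + _ + _](q_shift (u n)) (le_trans (lerD (lerD q_le q_le) rn))//.
lra.
Unshelve. all: by end_near. Qed.

End shift_continuity.

Section plancherel_theorem.
Context {R : realType}.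
Local Notation mu := (@lebesgue_measure R).
Implicit Types (F G : R -> R[i]).

Let ok G (N : nat) (t : R) : bool := (`|t| <= N%:R) && (normc (G t) <= N%:R).

Definition cutoff G (N : nat) (t : R) : R[i] := (ok G N t)%:R%:C * G t.

Let cutoffE G N t : cutoff G N t = if ok G N t then G t else 0.
Proof. by rewrite /cutoff; case: ifP => _; rewrite ?mul1r ?mul0r. Qed.

Lemma cmeas_cutoff G N : cmeas setT G -> cmeas setT (cutoff G N).
Proof.
move=> mG; apply: cmeasM => //; apply: cmeas_real.
have -> : (fun t => (ok G N t)%:R : R) =
  (fun t => \1_[set t | `|t| <= N%:R /\ normc (G t) <= N%:R] t).
  apply/funext => t; rewrite indicE /ok; congr (nat_of_bool _)%:R.
  by apply/andP/idP; rewrite inE.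
apply: measurable_indic.
have m1 : measurable_fun setT (fun t : R => `|t|) by exact: normr_measurable.
have m2 := cmeas_normc mG.
have c : measurable (`]-oo, N%:R] : set R) by exact: measurable_itv.
have := measurableI _ _ (m1 measurableT _ c) (m2 measurableT _ c).
rewrite !setTI; congr measurable; apply/seteqP; split=> t /=; rewrite !in_itv//=.
Qed.

Lemma normc_cutoff_le G N t : normc (cutoff G N t) <= N%:R.
Proof.
rewrite cutoffE; case: ifP => [/andP[]//|_].
by rewrite ComplexField.Normc.normc0.
Qed.

Lemma cutoff_eq0 G N t : N%:R < `|t| -> cutoff G N t = 0.
Proof. by move=> h; rewrite cutoffE /ok leNgt h. Qed.

Lemma sq_integrable_cutoff G N : sq_integrable G -> sq_integrable (cutoff G N).
Proof.
move=> [mG iG]; have mc := cmeas_cutoff N mG; split=> //.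
apply: (rintegrable_le measurableT (cmeas_sqr_normc mc) iG) => t _.
rewrite ger0_norm ?sqr_ge0// cutoffE; case: ifP => _//.
by rewrite ComplexField.Normc.normc0 expr0n/= sqr_ge0.
Qed.

Lemma sqn_cutoff G : sq_integrable G ->
  sqn (fun t => G t - cutoff G n t) @[n --> \oo] --> (0 : R).
Proof.
move=> [mG iG].
have [|||_] := @rintegral_dct _ setT (fun n t => normc (G t - cutoff G n t) ^+ 2)
   (fun=> 0) (fun t => normc (G t) ^+ 2) measurableT _ iG.
- by move=> n; apply: cmeas_sqr_normc; apply: cmeasB => //; exact: cmeas_cutoff.
- move=> n t _; rewrite ger0_norm ?sqr_ge0// cutoffE; case: ifP => _.
    by rewrite subrr ComplexField.Normc.normc0 expr0n/= sqr_ge0.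
  by rewrite subr0.
- move=> t _; apply: cvg_near_cst; near=> n.
  rewrite cutoffE ifT ?subrr ?ComplexField.Normc.normc0 ?expr0n//.
  by apply/andP; split; near: n; exact: nbhs_infty_ger.
by rewrite Rintegral_cst// mul0r.
Unshelve. all: by end_near. Qed.

Lemma cintegrable_cutoff G N : cmeas setT G -> cintegrable setT (cutoff G N).
Proof.
move=> mG.
have mI : measurable (`[- N%:R, N%:R]%classic : set R) by exact: measurable_itv.
apply: (@cintegrable_le _ _ _
  (fun t => \1_(`[- N%:R, N%:R]%classic : set R) t * N%:R)) => //.
- exact: cmeas_cutoff.
- apply: (rintegrable_mkcond (fun=> N%:R) mI).1.
  by apply: (@rintegrable_bounded_itv _ _ _ N%:R) => // t _; rewrite ger0_norm.
- move=> t _; rewrite indicE; have [tN|tN] := leP `|t| N%:R.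
    rewrite mem_set ?mul1r ?normc_cutoff_le//= in_itv/= -ler_norml.
    exact: tN.
  by rewrite cutoff_eq0// ComplexField.Normc.normc0 mulr_ge0.
Qed.

Lemma cintegrable_shift F (c : R) : cintegrable setT F ->
  cintegrable setT (fun t => F (t + c)).
Proof.
move=> cF; have mF := cintegrable_meas measurableT cF.
have [+ _] := cintegrable_subst (subst_shift c) mF => /(_ cF).
by under eq_fun do rewrite mul1r.
Qed.

Lemma shift_cutoff G (N : nat) (u : nat -> R) : cmeas setT G ->
  u n @[n --> \oo] --> (0 : R) ->
  sqn (shift_diff (cutoff G N) (u n)) @[n --> \oo] --> (0 : R).
Proof.
move=> mG u0; have [m1 m2] := cmeas_cutoff N mG; set H := cutoff G N.
have cH : cintegrable setT H by exact: cintegrable_cutoff.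
have N0 : (0 : R) <= N%:R by [].
have c1 := shift_L1_bounded N0 m1
  (fun t => le_trans (normc_Re _) (normc_cutoff_le G N t))
  (fun t h => congr1 (@complex.Re R) (@cutoff_eq0 G N t h)) u0.
have c2 := shift_L1_bounded N0 m2
  (fun t => le_trans (normc_Im _) (normc_cutoff_le G N t))
  (fun t h => congr1 (@complex.Im R) (@cutoff_eq0 G N t h)) u0.
have c3 : 2 * N%:R * (\int[mu]_b `|Re (H (b + u n)) - Re (H b)| +
    \int[mu]_b `|Im (H (b + u n)) - Im (H b)|) @[n --> \oo] --> (0 : R).
  apply: cvgM0; rewrite -[X in _ --> X]addr0; exact: cvgD.
apply: (squeeze_cvgr _ (cvg_cst 0) c3); apply: nearW => n.
rewrite sqn_ge0/= -/H.
have [d1 d2] : cintegrable setT (shift_diff H (u n)).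
  by apply: cintegrableB => //; exact: cintegrable_shift.
have i1 := integrable_norm d1; have i2 := integrable_norm d2.
have e1 : \int[mu]_b `|Re (H (b + u n)) - Re (H b)| =
    \int[mu]_b `|Re (shift_diff H (u n) b)|.
  by apply: eq_Rintegral => b _; rewrite !reimE.
have e2 : \int[mu]_b `|Im (H (b + u n)) - Im (H b)| =
    \int[mu]_b `|Im (shift_diff H (u n) b)|.
  by apply: eq_Rintegral => b _; rewrite !reimE.
rewrite e1 e2 -RintegralD// -RintegralZl//; last exact: rintegrableD.
have bound b : normc (shift_diff H (u n) b) ^+ 2 <=
  2 * N%:R * (`|Re (shift_diff H (u n) b)| + `|Im (shift_diff H (u n) b)|).
  rewrite expr2 ler_pM ?normc_ge0 ?normc_ReIm//.
  rewrite (le_trans (le_normc_sub _ _))// mulr_natl mulr2n lerD//;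
  exact: normc_cutoff_le.
have ib : rintegrable setT (fun b => 2 * N%:R *
   (`|Re (shift_diff H (u n) b)| + `|Im (shift_diff H (u n) b)|)).
  by apply: rintegrableZ => //; exact: rintegrableD.
apply: le_Rintegral => //.
apply: (rintegrable_le measurableT _ ib) => [|b _].
  by apply: cmeas_sqr_normc; apply: cintegrable_meas.
by rewrite ger0_norm ?sqr_ge0.
Qed.

(** Translation is continuous in the mean square. *)
Lemma shift_diff_cvg0 G (u : nat -> R) : sq_integrable G ->
  u n @[n --> \oo] --> (0 : R) ->
  sqn (shift_diff G (u n)) @[n --> \oo] --> (0 : R).
Proof.
move=> G2 u0; have [mG _] := G2; apply/cvgrPdist_le => /= e e0.
have e1 : 0 < e / 16 by rewrite divr_gt0.
have e2 : 0 < e / 4 by rewrite divr_gt0.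
move/cvgrPdist_le : (sqn_cutoff G2) => /(_ _ e1) [N _ hN].
have := hN N (leqnn N); rewrite sub0r normrN ger0_norm ?sqn_ge0// => {}hN.
move/cvgrPdist_le : (@shift_cutoff G N u mG u0) => /(_ _ e2) hc.
have K2 := sq_integrable_cutoff N G2.
have D2 := sq_integrableB G2 K2.
near=> n; rewrite sub0r normrN ger0_norm ?sqn_ge0//.
have h1 : sqn (shift_diff (cutoff G N) (u n)) <= e / 4.
  rewrite -[leLHS]ger0_norm ?sqn_ge0// -normrN -sub0r; near: n; exact: hc.
have h2 := shift_diff_le (u n) D2.
have K2s := sq_integrable_shift_diff (u n) K2.
have D2s : sq_integrable (fun b => 0 - shift_diff (fun t => G t - cutoff G N t) (u n) b).
  apply: sq_integrableB; last exact: sq_integrable_shift_diff.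
  split; first exact: cmeas_cst.
  by under eq_fun do rewrite ComplexField.Normc.normc0 expr0n/=; exact: integrable0.
have e3 : sqn (shift_diff G (u n)) =
  sqn (fun b => shift_diff (cutoff G N) (u n) b -
      (0 - shift_diff (fun t => G t - cutoff G N t) (u n) b)).
  apply: eq_Rintegral => b _; congr (normc _ ^+ 2); rewrite /shift_diff; ring.
have e4 : sqn (fun b => 0 - shift_diff (fun t => G t - cutoff G N t) (u n) b) =
    sqn (shift_diff (fun t => G t - cutoff G N t) (u n)).
  by apply: eq_Rintegral => b _; rewrite sub0r normc_opp.
rewrite e3 (le_trans (sqnB_le K2s D2s))// e4.
lra.
Unshelve. all: by end_near. Qed.

Lemma sqn_shift_diff_meas G : sq_integrable G ->
  measurable_fun setT (fun u => sqn (shift_diff G u)).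
Proof.
move=> G2; have [mG _] := G2.
apply: (measurableT_comp (@fine_measurable R setT _)) => //.
apply: (measurable_fun_fubini_tonelli_F (m2 := mu)
  (fun p : R * R => (normc (shift_diff G p.1 p.2) ^+ 2)%:E)) => //.
- apply/measurable_EFinP; apply: cmeas_sqr_normc; apply: cmeasB.
    apply: (cmeas_comp mG); apply: measurable_funD.
      exact: measurable_snd.
    exact: measurable_fst.
  exact: (cmeas_comp mG measurable_snd).
- by move=> p; rewrite lee_fin sqr_ge0.
Qed.

(** As the parameter [d] of the Poisson mean tends to [0], the defect tends to [0]
   by dominated convergence and the continuity of translation. *)
Theorem plancherel G : cintegrable setT G -> sq_integrable G ->
  sqn (four G) = 2 * pi * sqn G.
Proof.
move=> cG G2; have [F2 Fle] := bessel cG G2; have [mF iF] := F2.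
apply/eqP; rewrite eq_le Fle/=.
pose d_ (n : nat) : R := n.+1%:R^-1.
have d0 n : 0 < d_ n by rewrite invr_gt0.
pose h_ n v := 2^-1 * (poisson 1 v * sqn (shift_diff G (d_ n * v))).
have mh n : measurable_fun setT (h_ n).
  apply: measurable_funM => //; apply: measurable_funM; first exact: poisson_meas.
  apply: (measurableT_comp (sqn_shift_diff_meas G2)).
  exact: measurable_funM.
have i1 : rintegrable setT (fun v => 2 * sqn G * poisson 1 v).
  by apply: rintegrableZ => //; exact: poisson_integrable.
have h_le n v : setT v -> `|h_ n v| <= 2 * sqn G * poisson 1 v.
  move=> _; rewrite /h_ ger0_norm; last first.
    by rewrite mulr_ge0 ?invr_ge0// mulr_ge0 ?sqn_ge0 ?poisson_ge0.
  rewrite mulrCA mulrC ler_wpM2r ?poisson_ge0//.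
  have := shift_diff_le (d_ n * v) G2; lra.
have h0 v : setT v -> h_ n v @[n --> \oo] --> (0 : R).
  move=> _; rewrite -[X in _ --> X](mulr0 (2^-1)); apply: cvgM; first exact: cvg_cst.
  rewrite -[X in _ --> X](mulr0 (poisson 1 v)); apply: cvgM; first exact: cvg_cst.
  apply: shift_diff_cvg0 => //.
  rewrite -[X in _ --> X](mul0r v).
  by apply: cvgM; [exact: cvg_harmonic|exact: cvg_cst].
have [_] := rintegral_dct measurableT mh i1 h_le h0.
rewrite Rintegral_cst// mul0r => ri0.
have defect n : \int[mu]_v h_ n v = 2 * pi * sqn G - poisson_mean G (d_ n).
  by rewrite /Rintegral poisson_mean_defect.
suff h : 2 * pi * sqn G - sqn (four G) <= 0 by rewrite -subr_le0.
rewrite -(cvg_lim _ ri0)//; apply: limr_ge; first exact: (cvgP _ ri0).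
apply: nearW => n; rewrite defect lerD2l lerN2.
apply: le_Rintegral => //; first exact: rintegrable_poisson_mean.
move=> y _; rewrite -[leRHS]mulr1 ler_wpM2l ?sqr_ge0//.
by rewrite expR_le1 oppr_le0 mulr_ge0// ltW.
Qed.

(** Inversion in the mean square: expanding the square, the cross term is
   computed by the multiplication formula and the square of the truncated inverse
   transform is estimated by Bessel's inequality. *)
Theorem four_inversion F (A : R) : cintegrable setT F -> sq_integrable F ->
  let phi y := ((2 * pi)^-1)%:C * four F (- y) in
  let phiA y := (\1_(`[- A, A]%classic : set R) y)%:C * phi y in
  sq_integrable (fun t => F t - four phiA t) /\
  sqn (fun t => F t - four phiA t) <=
  sqn F - 2 * pi * \int[mu]_(y in `[- A, A]) normc (phi y) ^+ 2.
Proof.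
move=> cF F2 phi phiA.
have p0 : 0 < 2 * pi :> R by rewrite mulr_gt0 ?pi_gt0.
have mI : measurable (`[- A, A]%classic : set R) by exact: measurable_itv.
have mphi : cmeas setT phi.
  apply: cmeasM; first exact: cmeas_cst.
  by apply: (cmeas_comp (cmeas_four cF)); exact: oppr_measurable.
have mphiA : cmeas setT phiA.
  by apply: cmeasM => //; apply: cmeas_real; exact: measurable_indic.
pose M := (2 * pi)^-1 * \int[mu]_t normc (F t).
have phiM y : normc (phi y) <= M.
  rewrite normcMl normcR ger0_norm ?invr_ge0 ?(ltW p0)// ler_wpM2l//.
    by rewrite invr_ge0 ltW.
  exact: normc_four_le.
have M0 : 0 <= M by exact: le_trans (normc_ge0 _) (phiM 0).
have i1 c : rintegrable setT (fun y => \1_(`[- A, A]%classic : set R) y * `|c|).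
  apply: (rintegrable_mkcond (fun=> `|c|) mI).1.
  by apply: (@rintegrable_bounded_itv _ _ _ `|c|) => // t _; rewrite normr_id.
have cphiA : cintegrable setT phiA.
  apply: (@cintegrable_le _ _ _ (fun y => \1_(`[- A, A]%classic : set R) y * `|M|)) => //.
  move=> y _; rewrite normcMl normcR ger0_norm ?indicE// ler_wpM2l//.
  by rewrite ger0_norm.
have phiAE y : normc (phiA y) ^+ 2 =
    \1_(`[- A, A]%classic : set R) y * normc (phi y) ^+ 2.
  rewrite normcMl normcR exprMn ger0_norm ?indicE//.
  by case: (_ \in _); rewrite ?expr1n// expr0n.
have phiA2 : sq_integrable phiA.
  split=> //.
  apply: (@rintegrable_le _ _ _
    (fun y => \1_(`[- A, A]%classic : set R) y * `|M ^+ 2|)) => //.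
    exact: cmeas_sqr_normc.
  move=> y _; rewrite ger0_norm ?sqr_ge0// phiAE ler_wpM2l ?indicE// ger0_norm ?sqr_ge0//.
  by apply: lerXn2r; rewrite ?nnegrE ?normc_ge0.
have sqn_phiA : sqn phiA = \int[mu]_(y in `[- A, A]) normc (phi y) ^+ 2.
  by rewrite rintegral_mkcond; apply: eq_Rintegral => y _; rewrite phiAE.
have [T2 Tle] := bessel cphiA phiA2.
have D2 := sq_integrableB F2 T2; split=> //.
have cphiAc := cintegrable_conj measurableT cphiA.
have cross : cintegral setT (fun t => F t * conjc (four phiA t)) =
    (2 * pi * sqn phiA)%:C.
  transitivity (cintegral setT (fun t => F t * four (fun y => conjc (phiA y)) (- 1 * t))).
    by apply: eq_cintegral => t _; rewrite mulN1r (four_conj t cphiA).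
  rewrite four_swap// -RintegralZl//; last by case: phiA2.
  rewrite -cintegral_real; apply: eq_cintegral => y _.
  rewrite mulN1r.
  have -> : (2 * pi * normc (phiA y) ^+ 2)%:C = (2 * pi)%:C * (normc (phiA y) ^+ 2)%:C.
    by rewrite rmorphM.
  rewrite normcX2.
  have -> : four F (- y) = (2 * pi)%:C * phi y.
    by rewrite /phi mulrA -rmorphM/= divff ?mul1r// gt_eqF.
  rewrite mulrCA; congr (_ * _); rewrite /phiA indicE.
  by case: (_ \in _); [rewrite !mul1r mulrC|rewrite !mul0r conjc0 mul0r].
have [mF iF] := F2; have [mT iT] := T2.
have icr : cintegrable setT (fun t => F t * conjc (four phiA t)).
  have := cintegrable_mul_four (-1) cF cphiAc; apply: eq_cintegrable => // t _.
  by rewrite mulN1r (four_conj t cphiA).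
have [icr1 _] := icr.
have -> : sqn (fun t => F t - four phiA t) =
    sqn F + sqn (four phiA) - 2 * (2 * pi * sqn phiA).
  rewrite /sqn -[2 * pi * _]/(Re (2 * pi * _)%:C) -cross [Re _]/=.
  rewrite -RintegralD// -RintegralZl// -RintegralB//; last 2 first.
  - exact: rintegrableD.
  - exact: rintegrableZ.
  by apply: eq_Rintegral => t _; rewrite normc_sub_sqr.
rewrite -sqn_phiA; lra.
Qed.

End plancherel_theorem.

(** * The symbols of the two kernels *)

Section exponential_estimates.
Context {R : realType}.
Local Notation mu := (@lebesgue_measure R).
Implicit Types (z w v s : R[i]).

Lemma normc_nat (n : nat) : normc (n%:R : R[i]) = n%:R.
Proof.
have -> : (n%:R : R[i]) = (n%:R)%:C by rewrite rmorph_nat.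
by rewrite normcR ger0_norm.
Qed.

Lemma normc_mean_value (F f : R -> R[i]) (M : R) :
  (forall x, cderiv F x (f x)) -> (forall x, cderivable f x) ->
  (forall x, 0 <= x <= 1 -> normc (f x) <= M) -> normc (F 1 - F 0) <= M.
Proof.
move=> dF df fM.
have m01 : measurable (`[0, 1]%classic : set R) by exact: measurable_itv.
rewrite -(@cFTC _ F f 0 1)//.
have -> : M = \int[mu]_(t in `[0, 1]) (fun=> M) t.
  rewrite Rintegral_cst//= lebesgue_measure_itv/= lte_fin ltr01 -EFinB/=.
  by rewrite subr0 mulr1.
have M0 : 0 <= M by apply: le_trans (normc_ge0 _) (fM 0 _); rewrite lexx ler01.
apply: le_normc_cintegral_dom => //.
- by apply: cmeasT; exact: cderivable_cmeas.
- apply: (@continuous_compact_integrable R (cst M)); first exact: segment_compact.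
  by apply: continuous_subspaceT => x; exact: cvg_cst.
Qed.

Lemma cderiv_cexp_line (v : R[i]) (x : R) :
  cderiv (fun t => cexp (t%:C * v)) x (v * cexp (x%:C * v)).
Proof.
apply: cderiv_cexp; apply: (cderiv_eq (cderivM (cderiv_id x) (cderiv_cst v x))).
by rewrite mul1r mulr0 addr0.
Qed.

Lemma normc_cexp_line (v : R[i]) (x : R) : 0 <= x <= 1 ->
  normc (cexp (x%:C * v)) <= expR (normc v).
Proof.
move=> /andP[x0 x1]; rewrite normc_cexp ler_expR mulrC Re_mulR.
rewrite (le_trans (ler_norm _))// normrM (ger0_norm x0).
by rewrite -[leRHS]mulr1 ler_pM// normc_Re.
Qed.

Lemma normc_line (v : R[i]) (x : R) : 0 <= x <= 1 -> normc (x%:C * v) <= normc v.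
Proof.
move=> /andP[x0 x1]; rewrite normcMl normcR ger0_norm//.
by rewrite -[leRHS]mul1r ler_wpM2r ?normc_ge0.
Qed.

(** Along the segment from [0] to [v], the derivative of a Taylor remainder is [v]
   times the preceding one, so that the mean value inequality applies. *)
Lemma cexp_taylor0 v : normc (cexp v - 1) <= normc v * expR (normc v).
Proof.
have := @normc_mean_value (fun t => cexp (t%:C * v)) (fun t => v * cexp (t%:C * v))
  (normc v * expR (normc v)) (cderiv_cexp_line v).
rewrite mul1r mul0r cexp0; apply.
- by move=> x; eexists; apply: cderivZ; exact: cderiv_cexp_line.
- by move=> x x01; rewrite normcMl ler_wpM2l ?normc_ge0// normc_cexp_line.
Qed.

Lemma cexp_taylor1 v : normc (cexp v - 1 - v) <= normc v ^+ 2 * expR (normc v).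
Proof.
have dF x : cderiv (fun t => cexp (t%:C * v) - 1 - t%:C * v) x
    (v * (cexp (x%:C * v) - 1)).
  apply: cderiv_eq.
    apply: cderivD; first apply: cderivD; first exact: cderiv_cexp_line.
      exact: cderivN (cderiv_cst 1 x).
    apply: cderivN; exact: (cderivM (cderiv_id x) (cderiv_cst v x)).
  by cbv beta; ring.
have := @normc_mean_value _ _ (normc v ^+ 2 * expR (normc v)) dF.
rewrite mul1r mul0r cexp0 !subrr !subr0; apply.
- move=> x; eexists; apply: cderivZ; apply: cderivD; first exact: cderiv_cexp_line.
  exact: cderivN (cderiv_cst 1 x).
- move=> x x01; rewrite normcMl expr2 -mulrA ler_wpM2l ?normc_ge0//.
  rewrite (le_trans (cexp_taylor0 _))// ler_pM ?normc_ge0 ?expR_ge0 ?normc_line//.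
  by rewrite ler_expR normc_line.
Qed.

Lemma cexp_taylor2 v :
  normc (cexp v - 1 - v - 2^-1 * v ^+ 2) <= normc v ^+ 3 * expR (normc v).
Proof.
have dF x : cderiv (fun t => cexp (t%:C * v) - 1 - t%:C * v -
    2^-1 * (t%:C * v * (t%:C * v))) x (v * (cexp (x%:C * v) - 1 - x%:C * v)).
  have dl := cderivM (cderiv_id x) (cderiv_cst v x).
  apply: cderiv_eq.
    apply: cderivD; last by apply: cderivN; apply: cderivZ; exact: (cderivM dl dl).
    apply: cderivD; last exact: cderivN dl.
    apply: cderivD; first exact: cderiv_cexp_line.
    exact: cderivN (cderiv_cst 1 x).
  by cbv beta; field.
have := @normc_mean_value _ _ (normc v ^+ 3 * expR (normc v)) dF.
rewrite !mul1r !mul0r cexp0 !(subrr, subr0, mulr0) -expr2; apply.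
- move=> x; eexists; apply: cderivZ; apply: cderivD; last first.
    by apply: cderivN; exact: (cderivM (cderiv_id x) (cderiv_cst v x)).
  apply: cderivD; first exact: cderiv_cexp_line.
  exact: cderivN (cderiv_cst 1 x).
- move=> x x01; rewrite normcMl exprS -mulrA ler_wpM2l ?normc_ge0//.
  rewrite (le_trans (cexp_taylor1 _))// ler_pM ?sqr_ge0 ?expR_ge0//.
    by apply: lerXn2r; rewrite ?nnegrE ?normc_ge0// normc_line.
  by rewrite ler_expR normc_line.
Qed.

Lemma csinh_taylor v : normc v <= 1 ->
  normc (cexp v - cexp (- v) - 2 * v) <= 2 * expR 1 * normc v ^+ 3.
Proof.
move=> v1; have h1 := cexp_taylor2 v; have h2 := cexp_taylor2 (- v).
rewrite normc_opp in h2.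
have -> : cexp v - cexp (- v) - 2 * v =
  (cexp v - 1 - v - 2^-1 * v ^+ 2) - (cexp (- v) - 1 - (- v) - 2^-1 * (- v) ^+ 2).
  by ring.
rewrite (le_trans (le_normc_sub _ _))// (le_trans (lerD h1 h2))//.
have h3 : normc v ^+ 3 * expR (normc v) <= normc v ^+ 3 * expR 1.
  by rewrite ler_wpM2l ?exprn_ge0 ?normc_ge0// ler_expR.
lra.
Qed.

(** A weak form of Jordan's inequality. *)
Lemma sin_ge_quarter (q : R) : 0 <= q <= pi / 2 -> q / 4 <= sin q.
Proof.
move=> /andP[q0 q1].
have [->|qn0] := eqVneq q 0; first by rewrite mul0r sin0.
have qp : 0 < q by rewrite lt_neqAle eq_sym qn0.
have p0 := @pi_gt0 R.
have q2 : 0 < q / 2 by rewrite divr_gt0.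
have [xi] := @MVT R sin cos 0 (q / 2) q2 (fun x _ => is_derive_sin x)
  (continuous_subspaceT (@continuous_sin R)).
rewrite in_itv/= sin0 !subr0 => /andP[xi0 xi1] e.
have c4 : 2^-1 <= cos (pi / 4) :> R.
  have c0 : 0 <= cos (pi / 4) :> R by apply: cos_ge0_pihalf; lra.
  have c2 := cos_mulr2n (pi / 4 : R).
  rewrite (_ : (pi / 4) *+ 2 = pi / 2 :> R) ?cos_pihalf in c2; last by rewrite mulr2n; lra.
  rewrite -(ler_pXn2r (ltn0Sn 1)) ?nnegrE ?invr_ge0//; lra.
have cxi : 2^-1 <= cos xi.
  apply: (le_trans c4); rewrite leNgt ltr_cos ?in_itv/= -?leNgt; lra.
apply: (@le_trans _ _ (sin (q / 2))); first by rewrite e; nra.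
by rewrite leNgt ltr_sin ?in_itv/= -?leNgt; lra.
Qed.

Lemma normc_csinh_sqr (p q : R) :
  normc (cexp (p +i* q) - cexp (- (p +i* q))) ^+ 2 =
  (expR p - expR (- p)) ^+ 2 + 4 * sin q ^+ 2.
Proof.
rewrite sqr_normc2 !reimE !(Re_cexp, Im_cexp)/= cosN sinN.
have e : expR p * expR (- p) = 1 by rewrite -expRD subrr expR0.
have c := cos2Dsin2 q; rewrite [cos q ^+ 2]expr2 [sin q ^+ 2]expr2 in c.
rewrite !expr2; nra.
Qed.

Lemma csinh_ge (v : R[i]) : 0 <= Im v <= pi / 2 ->
  normc v / 2 <= normc (cexp v - cexp (- v)).
Proof.
case: v => p q; rewrite -[Im _]/q => q01.
rewrite -(ler_pXn2r (ltn0Sn 1)) ?nnegrE ?divr_ge0 ?normc_ge0//.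
rewrite normc_csinh_sqr exprMn sqr_normc2 -[Re _]/p -[Im _]/q.
have h1 := sin_ge_quarter q01; have /andP[q0 _] := q01.
have h2 : p ^+ 2 <= (expR p - expR (- p)) ^+ 2.
  have [p0|p0] := leP 0 p.
    apply: lerXn2r; rewrite ?nnegrE//.
      by rewrite subr_ge0 ler_expR; lra.
    have := expR_ge1Dx p; have : expR (- p) <= 1 by rewrite expR_le1; lra.
    lra.
  rewrite -[p ^+ 2]sqrrN -[X in _ <= X]sqrrN; apply: lerXn2r; rewrite ?nnegrE ?oppr_ge0//.
  - exact: ltW.
  - by rewrite subr_le0 ler_expR; lra.
  - have := expR_ge1Dx (- p); have : expR p <= 1 by rewrite expR_le1; lra.
    lra.
have h3 : (q / 4) ^+ 2 <= sin q ^+ 2.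
  by apply: lerXn2r; rewrite ?nnegrE ?divr_ge0// (le_trans _ h1)// divr_ge0.
have := sqr_ge0 p; rewrite !expr2 in h2 h3 *; lra.
Qed.

(** Removing the double pole of [1 / sinh^2] at the origin leaves a bounded
   function. *)
Lemma csinh_pole (v : R[i]) : v != 0 -> 0 <= Im v <= pi / 2 ->
  normc ((cexp v - cexp (- v)) ^- 2 - (2 * v) ^- 2) <=
  5 + 2 * expR 1 * (2 * expR 1 + 4).
Proof.
move=> v0 v01; have lb := csinh_ge v01.
set S := cexp v - cexp (- v) in lb *.
have nv : 0 < normc v by rewrite lt_neqAle eq_sym normc_eq0 v0 normc_ge0.
have nS : 0 < normc S by apply: lt_le_trans lb; rewrite divr_gt0.
have S0 : S != 0 by rewrite -normc_eq0 gt_eqF.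
have n2 : normc (2 : R[i]) = 2 by exact: normc_nat.
have e1 : 0 < expR 1 :> R by exact: expR_gt0.
have [v1|v1] := leP 1 (normc v).
  rewrite (le_trans (le_normc_sub _ _))// !(normc_inv, expr2, normcMl) n2.
  have a1 : (normc S * normc S)^-1 <= 4.
    rewrite -[leRHS]invrK lef_pV2 ?posrE ?invr_gt0 ?mulr_gt0//; nra.
  have a2 : (2 * normc v * (2 * normc v))^-1 <= 1.
    rewrite invf_le1 ?mulr_gt0//; nra.
  nra.
have tay := csinh_taylor (ltW v1); rewrite -/S in tay.
have -> : S ^- 2 - (2 * v) ^- 2 =
    - ((S - 2 * v) * ((S - 2 * v) + 4 * v) / (S ^+ 2 * (2 * v) ^+ 2)).
  by field; apply/andP.
rewrite normc_opp !(normcMl, normc_inv, expr2) n2.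
have n4 : normc (4 : R[i]) = 4 by exact: normc_nat.
have b2 := le_normc_add (S - 2 * v) (4 * v); rewrite normcMl n4 in b2.
set r := normc (S - 2 * v) in tay b2 *.
set N := normc v in nv lb v1 tay b2 *; set T := normc S in nS lb *.
have r0 : 0 <= r by exact: normc_ge0.
have e0 : 0 < expR 1 :> R by [].
rewrite ler_pdivrMr; last by rewrite !mulr_gt0.
have N3 : N ^+ 3 <= N by rewrite exprS -[leRHS]mulr1 ler_wpM2l ?(ltW nv)// expr_le1 ?ltW.
have b3 : normc (S - 2 * v + 4 * v) <= (2 * expR 1 + 4) * N.
  rewrite (le_trans b2)//; nra.
have b4 : r * normc (S - 2 * v + 4 * v) <= 2 * expR 1 * (2 * expR 1 + 4) * N ^+ 4.
  rewrite (le_trans (ler_pM r0 (normc_ge0 _) tay b3))//.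
  by rewrite le_eqVlt; apply/orP; left; apply/eqP; ring.
have b5 : N ^+ 4 <= T * T * (2 * N * (2 * N)).
  have Nn := ltW nv; have Tn := ltW nS.
  have : (N / 2) ^+ 2 <= T ^+ 2 by apply: lerXn2r; rewrite ?nnegrE ?divr_ge0.
  rewrite (_ : N ^+ 4 = (N / 2) ^+ 2 * (4 * N ^+ 2)); last by field.
  rewrite (_ : T * T * _ = T ^+ 2 * (4 * N ^+ 2)); last by ring.
  by move=> h; rewrite ler_wpM2r// mulr_ge0 ?sqr_ge0.
have b6 : 0 <= N ^+ 4 by rewrite exprn_ge0 ?ltW.
apply: (le_trans b4).
rewrite mulrDl; set X := T * T * _ in b5 *.
have c0 : 0 <= 2 * expR 1 * (2 * expR 1 + 4) :> R by nra.
have := ler_wpM2l c0 b5; lra.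
Qed.

End exponential_estimates.

Section log_kernel.
Context {R : realType}.
Local Notation mu := (@lebesgue_measure R).
Implicit Types (s : R[i]) (y c : R).

(** The kernel [log u / (u - 1)] in the logarithmic variable. *)
Definition kb (y : R) : R := y / (expR y - 1).

Lemma kb0 : kb 0 = 0. Proof. by rewrite /kb mul0r. Qed.

Lemma expRB1_neq0 (y : R) : y != 0 -> expR y - 1 != 0.
Proof. by move=> y0; rewrite subr_eq0 -expR0 (inj_eq (@expR_inj R)). Qed.

Lemma kb_ge0 y : 0 <= kb y.
Proof.
have [->|y0] := eqVneq y 0; first by rewrite kb0.
have [yp|yn] := leP 0 y.
  by rewrite divr_ge0// subr_ge0 -expR0 ler_expR.
by rewrite /kb -mulrNN -invrN mulr_ge0 ?oppr_ge0 ?ltW// invr_gt0 opprB subr_gt0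
  -expR0 ltr_expR.
Qed.

Lemma kb_le y : 0 <= y -> kb y <= 2 * expR (- (2^-1 * y)).
Proof.
move=> y0; have [->|yn0] := eqVneq y 0.
  by rewrite kb0 mulr_ge0 ?expR_ge0.
have yp : 0 < y by rewrite lt_neqAle eq_sym yn0.
rewrite /kb ler_pdivrMr ?subr_gt0 -?expR0 ?ltr_expR// expR0.
have -> : 2 * expR (- (2^-1 * y)) * (expR y - 1) =
    2 * (expR (2^-1 * y) - expR (- (2^-1 * y))).
  rewrite -mulrA; congr (_ * _); rewrite mulrBr mulr1 -expRD; congr (expR _ - _).
  by field.
have := expR_ge1Dx (2^-1 * y).
have : expR (- (2^-1 * y)) <= 1 by rewrite expR_le1; lra.
lra.
Qed.

Lemma kb_le2 y : 0 <= y -> kb y <= 2.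
Proof.
move=> y0; rewrite (le_trans (kb_le y0))// -[leRHS]mulr1 ler_wpM2l//.
by rewrite expR_le1; lra.
Qed.

Lemma kbN y : y != 0 -> kb (- y) = y + kb y.
Proof.
move=> y0; have e0 := expRB1_neq0 y0; have E0 := expR_gt0 y.
rewrite /kb expRN; field; rewrite e0 (gt_eqF E0)/= mulN1r.
by move: e0; rewrite -oppr_eq0 opprB.
Qed.

(** Splits off the leading exponential of [kb], which carries the double pole of
   the transform. *)
Lemma kb_split y : kb y = y * expR (- y) + expR (- y) * kb y.
Proof.
have [->|y0] := eqVneq y 0; first by rewrite kb0 mul0r mulr0 addr0.
have e0 := expRB1_neq0 y0; have E0 := expR_gt0 y.
by rewrite /kb expRN; field; rewrite e0 (gt_eqF E0).
Qed.

(** The factorization [e^(2y) - 1 = (e^y - 1) (e^y + 1)], from which the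
   duplication formula of the transform comes. *)
Lemma kb_double y : kb (2 * y) * (1 + expR y) = 2 * kb y.
Proof.
have [->|y0] := eqVneq y 0; first by rewrite mulr0 kb0 mul0r mulr0.
have e0 := expRB1_neq0 y0; have E0 := expR_gt0 y.
rewrite /kb mulr_natl mulr2n expRD.
have -> : expR y * expR y - 1 = (expR y - 1) * (expR y + 1) by ring.
by field; rewrite e0 gt_eqF// ltr_wpDl// ltW.
Qed.

Lemma kb_meas : measurable_fun setT kb.
Proof.
apply: measurable_funM => //; apply: measurable_funV.
by apply: measurable_funB => //; exact: measurable_expR.
Qed.

Lemma measurable_expRM c : measurable_fun setT (fun y : R => expR (c * y)).
Proof. by apply: measurableT_comp => //; exact: measurable_funM. Qed.

Lemma rintegrable_kb c : 0 < c < 1 -> rintegrable setT (fun y => kb y * expR (c * y)).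
Proof.
move=> /andP[c0 c1]; have c10 : 0 < 1 - c by rewrite subr_gt0.
have mk : measurable_fun setT (fun y => kb y * expR (c * y)).
  by apply: measurable_funM; [exact: kb_meas|exact: measurable_expRM].
apply: rintegrable_fold => //.
  apply: (@rintegrable_le _ _ _ (fun y => y * expR (- ((1 - c) * y)) +
    2 * expR (- ((1 - c) * y)))) => //.
  - exact: measurable_funTS.
  - apply: rintegrableD => //; first exact: rintegrable_mul_expRN.
    by apply: rintegrableZ => //; exact: rintegrable_expRN.
  - move=> y /itv0yP y0; rewrite ger0_norm ?(mulr_ge0 (kb_ge0 _) (expR_ge0 _))//.
    have -> : expR (- ((1 - c) * y)) = expR (- y) * expR (c * y).
      by rewrite -expRD; congr expR; ring.
    rewrite kb_split.
    have -> : (y * expR (- y) + expR (- y) * kb y) * expR (c * y) =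
      y * (expR (- y) * expR (c * y)) + kb y * (expR (- y) * expR (c * y)) by ring.
    by rewrite lerD2l ler_wpM2r ?mulr_ge0 ?expR_ge0// kb_le2.
apply: (@rintegrable_le _ _ _ (fun y => y * expR (- (c * y)) +
    2 * expR (- (c * y)))) => //.
- apply: measurable_funTS; apply: (measurableT_comp mk); exact: oppr_measurable.
- apply: rintegrableD => //; first exact: rintegrable_mul_expRN.
  by apply: rintegrableZ => //; exact: rintegrable_expRN.
- move=> y /itv0yP y0; rewrite ger0_norm ?(mulr_ge0 (kb_ge0 _) (expR_ge0 _))//.
  have [->|yn0] := eqVneq y 0.
    by rewrite oppr0 kb0 !mul0r add0r mulr_ge0 ?expR_ge0.
  by rewrite kbN// mulrN -mulrDl ler_wpM2r ?expR_ge0// lerD2l kb_le2.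
Qed.

Definition logint s : R[i] := cintegral setT (fun y => (kb y)%:C * cexp (s * y%:C)).

Lemma normc_kb_cexp s y :
  normc ((kb y)%:C * cexp (s * y%:C)) = kb y * expR (Re s * y).
Proof. by rewrite normcMl normcR ger0_norm ?kb_ge0// normc_cexp Re_mulR. Qed.

Lemma cmeas_cexpM s : cmeas setT (fun y : R => cexp (s * y%:C)).
Proof.
by apply: cmeas_cexp; apply: cmeasM; [exact: cmeas_cst|exact: cmeas_real].
Qed.

Lemma cintegrable_kb s : 0 < Re s < 1 ->
  cintegrable setT (fun y => (kb y)%:C * cexp (s * y%:C)).
Proof.
move=> s01; apply: (@cintegrable_le _ _ _ (fun y => kb y * expR (Re s * y))) => //.
- apply: cmeasM; first exact: cmeas_real kb_meas.
  exact: cmeas_cexpM.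
- exact: rintegrable_kb.
- by move=> y _; rewrite normc_kb_cexp.
Qed.

(** Duplication: the two terms differ by the factor [e^(y/2)], and their sum is
   rewritten by [kb_double] after the dilation [y -> 2 y]. *)
Lemma logint_double s : 0 < Re s < 1 -> logint (s / 2) + logint ((s + 1) / 2) = 4 * logint s.
Proof.
move=> s01; have /andP[s0 s1] := s01.
have r2 (z : R[i]) : Re (z / 2) = Re z / 2.
  rewrite (_ : z / 2 = z * (2^-1)%:C) ?Re_mulR//.
  by congr (_ * _); rewrite fmorphV rmorph_nat.
have i1 : cintegrable setT (fun y => (kb y)%:C * cexp (s / 2 * y%:C)).
  by apply: cintegrable_kb; rewrite r2; apply/andP; split; lra.
have i2 : cintegrable setT (fun y => (kb y)%:C * cexp ((s + 1) / 2 * y%:C)).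
  by apply: cintegrable_kb; rewrite r2 reimE/=; apply/andP; split; lra.
rewrite /logint -cintegralD// (cintegral_subst (subst_affine 0 (ltr0Sn R 1))); last first.
  by apply: cintegrable_meas => //; exact: cintegrableD.
rewrite -cintegralZ//; last exact: cintegrable_kb.
apply: eq_cintegral => y _; rewrite addr0.
have e1 : s / 2 * (2 * y)%:C = s * y%:C.
  by rewrite rmorphM/= (rmorph_nat (real_complex R)); field.
have e2 : (s + 1) / 2 * (2 * y)%:C = s * y%:C + y%:C.
  by rewrite rmorphM/= (rmorph_nat (real_complex R)); field.
rewrite e1 e2 cexpD cexpR.
transitivity ((2 * (kb (2 * y) * (1 + expR y)))%:C * cexp (s * y%:C)).
  by rewrite !(rmorphM, rmorphD)/= rmorph1; ring.
have -> : (2 * (kb (2 * y) * (1 + expR y)))%:C = 4 * (kb y)%:C.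
  by rewrite kb_double !rmorphM !(rmorph_nat (real_complex R)); ring.
by rewrite mulrA.
Qed.

(** The leading exponentials of [kb] at both ends of the line produce the two
   double poles; what remains is integrable uniformly in the strip. *)
Lemma logint_poles : exists K : R, forall s, 0 < Re s < 1 ->
  normc (logint s - (s ^- 2 + (1 - s) ^- 2)) <= K.
Proof.
have ie : rintegrable `[0, +oo[ (fun y : R => 4 * expR (- (2^-1 * y))).
  by apply: rintegrableZ => //; apply: rintegrable_expRN; rewrite invr_gt0.
exists (\int[mu]_(y in `[0, +oo[) (4 * expR (- (2^-1 * y)))) => s s01.
have /andP[s0 s1] := s01.
have t0 : 0 < Re (1 - s) by rewrite !reimE/=; lra.
have [i1 e1] := half_line_mul_cexp s0; have [i2 e2] := half_line_mul_cexp t0.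
pose rem y := (kb y)%:C * (cexp (- ((1 - s) * y%:C)) + cexp (- (s * y%:C))).
have rem_le y : 0 <= y -> normc (rem y) <= 4 * expR (- (2^-1 * y)).
  move=> y0; rewrite /rem normcMl normcR ger0_norm ?kb_ge0//.
  have -> : 4 * expR (- (2^-1 * y)) = 2 * expR (- (2^-1 * y)) * 2 by ring.
  rewrite ler_pM ?kb_ge0 ?normc_ge0 ?kb_le// (le_trans (le_normc_add _ _))//.
  rewrite !normc_cexpM (_ : 2 = 1 + 1)// lerD// expR_le1 oppr_le0 mulr_ge0//; exact: ltW.
have mrem : cmeas (`[0, +oo[%classic : set R) rem.
  apply: cmeasT; apply: cmeasM; first exact: cmeas_real kb_meas.
  by apply: cmeasD; under eq_fun do rewrite -mulNr; exact: cmeas_cexpM.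
have irem : cintegrable `[0, +oo[ rem.
  by apply: (cintegrable_le _ mrem ie) => // y /itv0yP; exact: rem_le.
have -> : logint s = (s ^- 2 + (1 - s) ^- 2) + cintegral `[0, +oo[ rem.
  rewrite /logint cintegral_fold; last exact: cintegrable_kb.
  rewrite -!exprVn -e1 -e2 -cintegralD// -cintegralD//; last exact: cintegrableD.
  apply: eq_cintegral => y /itv0yP y0.
  have [->|yn0] := eqVneq y 0.
    by rewrite oppr0 /rem kb0 !mul0r !addr0.
  have e3 : cexp (- ((1 - s) * y%:C)) = (expR (- y))%:C * cexp (s * y%:C).
    rewrite -cexpR -cexpD; congr cexp.
    have -> : (- y)%:C = - y%:C by rewrite rmorphN.
    by ring.
  have e4 : cexp (s * (- y)%:C) = cexp (- (s * y%:C)) by rewrite rmorphN mulrN.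
  have k1 : (kb y)%:C = y%:C * (expR (- y))%:C + (expR (- y))%:C * (kb y)%:C.
    by rewrite {1}kb_split rmorphD !rmorphM.
  have k2 : (y + kb y)%:C = y%:C + (kb y)%:C by rewrite rmorphD.
  rewrite kbN// [X in X * cexp (s * y%:C)]k1 k2 /rem e3 e4; ring.
rewrite addrAC subrr add0r; apply: le_normc_cintegral_dom => // y /itv0yP.
exact: rem_le.
Qed.

End log_kernel.

Section log_symbol.
Context {R : realType}.
Local Notation mu := (@lebesgue_measure R).
Implicit Types (s : R[i]).

(** [pi i s], half the exponent of [e^(2 pi i s)]. *)
Definition ipi s : R[i] := (pi *i) * s.

Definition Eexp s : R[i] := cexp (2 * ipi s).

(** This is [pi^2 / sin^2 (pi s)]. *)
Definition logval s : R[i] := - (4 * pi ^+ 2)%:C * (Eexp s / (Eexp s - 1) ^+ 2).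

Lemma Im_ipi s : Im (ipi s) = pi * Re s.
Proof. by rewrite /ipi reimE/= mul0r add0r. Qed.

Lemma ipi_sqr s : ipi s ^+ 2 = - (pi ^+ 2)%:C * s ^+ 2.
Proof.
rewrite /ipi exprMn; congr (_ * _).
by apply: complex_eq; rewrite expr2 !reimE/=; ring.
Qed.

Lemma cexp_ipi : cexp (pi *i) = -1 :> R[i].
Proof.
by apply: complex_eq; rewrite ?Re_cexp ?Im_cexp/= expR0 ?cospi ?sinpi ?mulr0 ?mul1r ?oppr0.
Qed.

Lemma Eexp_half s : Eexp (s / 2) = cexp (ipi s).
Proof. by rewrite /Eexp; congr cexp; rewrite /ipi; field. Qed.

Lemma Eexp_half1 s : Eexp ((s + 1) / 2) = - cexp (ipi s).
Proof.
have -> : Eexp ((s + 1) / 2) = cexp (ipi s + (pi *i)).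
  by rewrite /Eexp; congr cexp; rewrite /ipi; field.
by rewrite cexpD cexp_ipi mulrN1.
Qed.

Lemma Eexp_sqr s : Eexp s = cexp (ipi s) ^+ 2.
Proof. by rewrite /Eexp expr2 -cexpD; congr cexp; ring. Qed.

Lemma Eexp_neq0 s : Eexp s != 0. Proof. exact: cexp_neq0. Qed.

Lemma Eexp_compl s : Eexp (1 - s) = (Eexp s)^-1.
Proof.
rewrite /Eexp -cexpN.
have -> : 2 * ipi (1 - s) = - (2 * ipi s) + ((pi *i) + (pi *i)).
  by rewrite /ipi; ring.
by rewrite cexpD [X in _ * X]cexpD cexp_ipi mulrNN !mulr1.
Qed.

Lemma logval_compl s : logval (1 - s) = logval s.
Proof.
rewrite /logval Eexp_compl; congr (_ * _); have E0 := Eexp_neq0 s.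
have [->|E1] := eqVneq (Eexp s) 1; first by rewrite invr1.
have E2 : Eexp s - 1 != 0 by rewrite subr_eq0.
by field; rewrite E0 E2 mulN1r -oppr_eq0 opprB E2.
Qed.

Lemma Eexp_sub1 s : Eexp s - 1 = cexp (ipi s) * (cexp (ipi s) - cexp (- ipi s)).
Proof.
by rewrite mulrBr cexpN divff ?cexp_neq0// Eexp_sqr expr2.
Qed.

Let half_strip s : 0 < Re s <= 2^-1 -> ipi s != 0 /\ 0 <= Im (ipi s) <= pi / 2.
Proof.
move=> /andP[s0 s1]; have p0 := @pi_gt0 R.
split; last by rewrite Im_ipi mulr_ge0 ?(ltW s0) ?(ltW p0)//= ler_pM2l.
apply: contraTneq (mulr_gt0 p0 s0) => h.
by rewrite -Im_ipi h ltxx.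
Qed.

Let Eexp_neq1_half s : 0 < Re s <= 2^-1 -> Eexp s != 1.
Proof.
move=> /half_strip[v0 vI]; rewrite -subr_eq0 Eexp_sub1 mulf_neq0 ?cexp_neq0//.
rewrite -normc_eq0 gt_eqF// (lt_le_trans _ (csinh_ge vI))// divr_gt0//.
by rewrite lt_neqAle eq_sym normc_eq0 v0 normc_ge0.
Qed.

Lemma Eexp_neq1 s : 0 < Re s < 1 -> Eexp s != 1.
Proof.
move=> /andP[s0 s1]; have [h|h] := leP (Re s) 2^-1.
  by apply: Eexp_neq1_half; rewrite s0.
have := @Eexp_neq1_half (1 - s).
rewrite Eexp_compl invr_eq1; apply.
by rewrite !reimE/=; apply/andP; split; lra.
Qed.

Let logval_pole s : 0 < Re s <= 2^-1 ->
  normc (logval s - s ^- 2) <= 4 * pi ^+ 2 * (5 + 2 * expR 1 * (2 * expR 1 + 4)).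
Proof.
move=> s01; have [v0 vI] := half_strip s01.
have s0 : s != 0 by apply: contraTneq s01 => ->; rewrite ltxx.
have p0 : (pi : R) != 0 by rewrite gt_eqF// pi_gt0.
have p0c : (pi ^+ 2)%:C != 0 :> R[i] by rewrite -normc_eq0 normcR normr_eq0 expf_neq0.
have e0 := cexp_neq0 (ipi s).
have S0 : cexp (ipi s) - cexp (- ipi s) != 0.
  have := Eexp_neq1_half s01; rewrite -subr_eq0 Eexp_sub1 mulf_eq0 negb_or.
  by move=> /andP[].
have -> : logval s - s ^- 2 = - (4 * pi ^+ 2)%:C *
   ((cexp (ipi s) - cexp (- ipi s)) ^- 2 - (2 * ipi s) ^- 2).
  rewrite /logval Eexp_sub1 [RHS]mulrBr; congr (_ - _).
    congr (_ * _); rewrite Eexp_sqr exprMn; field.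
    by rewrite e0 S0.
  have -> : (4 * pi ^+ 2)%:C = 4 * (pi ^+ 2)%:C :> R[i].
    by rewrite rmorphM (rmorph_nat (real_complex R)).
  rewrite exprMn ipi_sqr; move: (pi ^+ 2)%:C p0c => P P0; field.
  by rewrite s0 P0.
have c0 : 0 <= 4 * pi ^+ 2 :> R by rewrite mulr_ge0 ?sqr_ge0.
by rewrite normcMl normc_opp normcR (ger0_norm c0); apply: ler_wpM2l => //; exact: csinh_pole.
Qed.

Let inv_le s : 2^-1 <= Re s -> normc (s ^- 2) <= 4.
Proof.
move=> h; rewrite normc_inv expr2 normcMl.
have n : 2^-1 <= normc s by rewrite (le_trans h)// (le_trans (ler_norm _))// normc_Re.
rewrite -[leRHS]invrK lef_pV2 ?posrE ?invr_gt0//; first nra.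
by rewrite mulr_gt0//; lra.
Qed.

Lemma logval_poles : exists K : R, forall s, 0 < Re s < 1 ->
  normc (logval s - (s ^- 2 + (1 - s) ^- 2)) <= K.
Proof.
exists (4 * pi ^+ 2 * (5 + 2 * expR 1 * (2 * expR 1 + 4)) + 4) => s /andP[s0 s1].
have [h|h] := leP (Re s) 2^-1.
  rewrite opprD addrA (le_trans (le_normc_sub _ _))// lerD//.
    by apply: logval_pole; rewrite s0.
  by apply: inv_le; rewrite !reimE/=; lra.
rewrite [s ^- 2 + _]addrC opprD addrA (le_trans (le_normc_sub _ _))// lerD//.
  by rewrite -logval_compl; apply: logval_pole; rewrite !reimE/=; apply/andP; split; lra.
by apply: inv_le; exact: ltW.
Qed.

Lemma logval_double s : 0 < Re s < 1 -> logval (s / 2) + logval ((s + 1) / 2) = 4 * logval s.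
Proof.
move=> s01; rewrite /logval Eexp_half Eexp_half1 Eexp_sqr -mulrDr [RHS]mulrCA; congr (_ * _).
have := Eexp_neq1 s01; rewrite Eexp_sqr -subr_eq0.
set w := cexp _.
have -> : w ^+ 2 - 1 = (w - 1) * (w + 1) by ring.
rewrite mulf_eq0 negb_or => /andP[w1 w2].
have w3 : - w - 1 != 0 by rewrite -opprD oppr_eq0.
by field; rewrite w1 w2 w3.
Qed.

(** Both sides have the same double poles at the edges of the strip and obey the
   same duplication formula; their difference is bounded, hence null, because
   each use of the duplication formula halves the bound. *)
Theorem logintE s : 0 < Re s < 1 -> logint s = logval s.
Proof.
have [K1 h1] := @logint_poles R; have [K2 h2] := logval_poles.
(* The difference at [s] is a quarter of the sum of those at [s / 2] and
   [(s + 1) / 2], which are again in the strip. *)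
have bound n : forall s, 0 < Re s < 1 -> normc (logint s - logval s) <= (K1 + K2) / 2 ^+ n.
  elim: n => [|n IHn] {}s s01.
    rewrite expr0 divr1.
    have -> : logint s - logval s = (logint s - (s ^- 2 + (1 - s) ^- 2)) -
      (logval s - (s ^- 2 + (1 - s) ^- 2)) by ring.
    by rewrite (le_trans (le_normc_sub _ _))// lerD ?h1 ?h2.
  have /andP[s0 s1] := s01.
  have r2 (z : R[i]) : Re (z / 2) = Re z / 2.
    rewrite (_ : z / 2 = z * (2^-1)%:C) ?Re_mulR//.
    by congr (_ * _); rewrite fmorphV rmorph_nat.
  have i1 : normc (logint (s / 2) - logval (s / 2)) <= (K1 + K2) / 2 ^+ n.
    by apply: IHn; rewrite r2; apply/andP; split; lra.
  have i2 : normc (logint ((s + 1) / 2) - logval ((s + 1) / 2)) <= (K1 + K2) / 2 ^+ n.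
    by apply: IHn; rewrite r2 reimE/=; apply/andP; split; lra.
  have -> : logint s - logval s =
      4^-1 * ((logint (s / 2) - logval (s / 2)) + (logint ((s + 1) / 2) - logval ((s + 1) / 2))).
    have e : 4^-1 * (4 * (logint s - logval s)) = logint s - logval s by rewrite mulKf.
    by rewrite -{1}e mulrBr -logint_double// -logval_double//; congr (_ * _); ring.
  rewrite normcMl normc_inv normc_nat.
  have := le_trans (le_normc_add _ _) (lerD i1 i2).
  have -> : (K1 + K2) / 2 ^+ n.+1 = ((K1 + K2) / 2 ^+ n) / 2.
    by rewrite exprS invfM [X in _ * X]mulrC mulrA.
  lra.
move=> s01; apply/eqP; rewrite -subr_eq0 -normc_eq0 eq_le normc_ge0 andbT.
have c0 : (K1 + K2) / 2 ^+ n @[n --> \oo] --> (0 : R).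
  apply: cvgM0; under eq_fun do rewrite -exprVn; apply: cvg_expr.
  by rewrite ger0_norm ?invr_ge0// invf_lt1// ltr1n.
rewrite -(cvg_lim _ c0)//; apply: limr_ge; first exact: (cvgP _ c0).
by apply: nearW => n; exact: bound.
Qed.

End log_symbol.

Section cauchy_symbol.
Context {R : realType}.
Local Notation mu := (@lebesgue_measure R).
Implicit Types (s : R[i]).

(** The Cauchy kernel [1 / (1 - u)] in the logarithmic variable. *)
Definition hb (y : R) : R := (1 - expR y)^-1.

Lemma hb0 : hb 0 = 0. Proof. by rewrite /hb expR0 subrr invr0. Qed.

Lemma hb_mulr y : hb y * y = - kb y.
Proof.
by rewrite /hb /kb -mulrN -invrN opprB mulrC.
Qed.

Lemma hb_meas : measurable_fun setT hb.
Proof.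
by apply: measurable_funV; apply: measurable_funB => //; exact: measurable_expR.
Qed.

(** The principal value integral [pv int_0^oo u^(-s) / (u - 1) du], made
   absolutely convergent by subtracting the same integral at [s = 1/2], which
   vanishes by symmetry. *)
Definition cau_integrand s (y : R) : R[i] :=
  (hb y)%:C * (cexp (s * y%:C) - cexp (2^-1 * y%:C)).

Definition cauint s : R[i] := cintegral setT (cau_integrand s).

(** This is [pi cot (pi s)]. *)
Definition cauval s : R[i] := (pi *i) * ((Eexp s + 1) / (Eexp s - 1)).

Definition seg s (theta : R) : R[i] := 2^-1 + theta%:C * (s - 2^-1).

Lemma Re_half : Re (2^-1 : R[i]) = 2^-1.
Proof. by rewrite (_ : 2^-1 = (2^-1)%:C)// fmorphV rmorph_nat. Qed.

Lemma Re_seg s (th : R) : Re (seg s th) = 2^-1 + th * (Re s - 2^-1).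
Proof. by rewrite /seg cReD [_%:C * _]mulrC Re_mulR cReD cReN Re_half mulrC. Qed.

Lemma seg_strip s (th : R) : 0 < Re s < 1 -> 0 <= th <= 1 -> 0 < Re (seg s th) < 1.
Proof. by move=> /andP[s0 s1] /andP[t0 t1]; rewrite Re_seg; apply/andP; split; nra. Qed.

Lemma cderiv_seg s (th : R) : cderiv (seg s) th (s - 2^-1).
Proof.
apply: cderiv_eq.
  exact: (cderivD (cderiv_cst 2^-1 th) (cderivM (cderiv_id th) (cderiv_cst (s - 2^-1) th))).
by cbv beta; ring.
Qed.

Lemma cderiv_cexp_seg s (y th : R) :
  cderiv (fun t => cexp (seg s t * y%:C)) th
    ((s - 2^-1) * y%:C * cexp (seg s th * y%:C)).
Proof.
apply: cderiv_cexp; apply: cderiv_eq.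
  exact: (cderivM (cderiv_seg s th) (cderiv_cst y%:C th)).
by cbv beta; ring.
Qed.

Let I01 : set R := `[0, 1]%classic.

Let mI01 : measurable I01. Proof. exact: measurable_itv. Qed.

Lemma integral_cexp_seg s (y : R) :
  cintegral I01 (fun th => (s - 2^-1) * y%:C * cexp (seg s th * y%:C)) =
  cexp (s * y%:C) - cexp (2^-1 * y%:C).
Proof.
rewrite (@cFTC _ (fun t => cexp (seg s t * y%:C)))//.
- rewrite /seg mul1r mul0r addr0; congr (cexp (_ * _) - _); ring.
- by move=> x _; exact: cderiv_cexp_seg.
- by move=> x _; eexists; apply: cderivZ; exact: cderiv_cexp_seg.
Qed.

Section fubini_segment.
Variables (s : R[i]) (s01 : 0 < Re s < 1).

Let K (y th : R) : R[i] := (kb y)%:C * ((\1_I01 th)%:C * cexp (seg s th * y%:C)).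

Let mK : cmeas setT (fun p : R * R => K p.1 p.2).
Proof.
apply: cmeasM.
  by apply: cmeas_real; exact: (measurableT_comp kb_meas measurable_fst).
apply: cmeasM.
  apply: cmeas_real; apply: (measurableT_comp _ measurable_snd).
  exact: measurable_indic.
apply: cmeas_cexp; apply: cmeasM; last exact: cmeas_real measurable_fst.
apply: cmeasD; first exact: cmeas_cst.
by apply: cmeasM; [exact: cmeas_real measurable_snd|exact: cmeas_cst].
Qed.

Let k (y : R) : R := kb y * expR (Re s * y) + kb y * expR (2^-1 * y).

Let ik : rintegrable setT k.
Proof.
apply: rintegrableD => //; apply: rintegrable_kb => //.
by apply/andP; split; lra.
Qed.

Let i1 : rintegrable setT (fun th => \1_I01 th * 1).
Proof.
apply: (rintegrable_mkcond (fun=> 1) mI01).1.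
apply: (@continuous_compact_integrable R (cst 1)); first exact: segment_compact.
by apply: continuous_subspaceT => x; exact: cvg_cst.
Qed.

Let K_le y th : normc (K y th) <= k y * (\1_I01 th * 1).
Proof.
rewrite /K /k normcMl normcR (ger0_norm (kb_ge0 _)) -mulrDr -mulrA.
apply: ler_wpM2l; first exact: kb_ge0.
rewrite normcMl normcR mulr1 indicE; case: (boolP (th \in I01)) => [|_]; last first.
  by rewrite normr0 mul0r mulr0.
rewrite inE /I01 /= in_itv/= => /andP[t0 t1].
rewrite normr1 mul1r mulr1 normc_cexp Re_mulR Re_seg.
have [h|h] := leP ((Re s - 2^-1) * y) 0.
  rewrite ler_wpDl ?expR_ge0// ler_expR; nra.
by rewrite ler_wpDr ?expR_ge0// ler_expR; nra.
Qed.

Let KE y : cau_integrand s y = - (s - 2^-1) * cintegral setT (K y).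
Proof.
have [->|y0] := eqVneq y 0.
  rewrite /cau_integrand hb0 mul0r (_ : cintegral _ _ = 0) ?mulr0//.
  rewrite (@eq_cintegral _ _ _ (fun=> 0)) => [|th _]; last by rewrite /K kb0 mul0r.
  by apply: complex_eq; rewrite /= /Rintegral integral0.
have Y0 : y%:C != 0 :> R[i] by rewrite -normc_eq0 normcR normr_eq0.
have cI : cintegrable setT (fun th => (\1_I01 th)%:C * cexp (seg s th * y%:C)).
  apply: (cintegrable_mkcond _ mI01).1.
  apply: (@cintegrable_le _ _ _
     (fun th => expR (Re s * y) + expR (2^-1 * y))) => //.
  - apply: cmeasT; apply: cderivable_cmeas => x; eexists; exact: (cderiv_cexp_seg s y x).
  - apply: (@continuous_compact_integrable R (cst _)); first exact: segment_compact.
    by apply: continuous_subspaceT => x; exact: cvg_cst.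
  - move=> th; rewrite /I01 /= in_itv/= => /andP[t0 t1].
    rewrite normc_cexp Re_mulR Re_seg; have [h|h] := leP ((Re s - 2^-1) * y) 0.
      rewrite ler_wpDl ?expR_ge0// ler_expR; nra.
    by rewrite ler_wpDr ?expR_ge0// ler_expR; nra.
rewrite /K cintegralZ// -cintegral_mkcond /cau_integrand -integral_cexp_seg.
rewrite cintegralZ//; last exact: (cintegrable_mkcond _ mI01).2.
have hk : (hb y)%:C * y%:C = - (kb y)%:C :> R[i].
  by rewrite -rmorphM/= hb_mulr rmorphN.
rewrite mulrA [(hb y)%:C * _]mulrCA hk; ring.
Qed.

Lemma cintegrable_cau : cintegrable setT (cau_integrand s).
Proof.
have h := cfubini_integrable mK ik i1 K_le.
have := cintegrableZ (- (s - 2^-1)) measurableT h.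
by apply: eq_cintegrable => // y _; rewrite KE.
Qed.

Let cauint_logval :
  cauint s = cintegral I01 (fun th => - (s - 2^-1) * logval (seg s th)).
Proof.
transitivity (- (s - 2^-1) * cintegral setT (fun y => cintegral setT (K y))).
  rewrite -cintegralZ//; last exact: cfubini_integrable mK ik i1 K_le.
  by apply: eq_cintegral => y _; rewrite KE.
rewrite (cfubini mK ik i1 K_le).
have KthE th : cintegral setT (fun y => K y th) = (\1_I01 th)%:C * logval (seg s th).
  rewrite indicE; case: (boolP (th \in I01)) => [|nth]; last first.
    rewrite mul0r (@eq_cintegral _ _ _ (fun=> 0)) => [|y _].
      by apply: complex_eq; rewrite /= /Rintegral integral0.
    by rewrite /K indicE (negbTE nth) mul0r mulr0.
  rewrite inE => th01; have seg01 := seg_strip s01 th01.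
  rewrite mul1r -logintE//; apply: eq_cintegral => y _.
  by rewrite /K indicE mem_set// mul1r.
have cI : cintegrable setT (fun th => (\1_I01 th)%:C * logval (seg s th)).
  apply: (@eq_cintegrable _ _ (fun th => cintegral setT (fun y => K y th))) => //.
  apply: (@cfubini_integrable R (fun th y => K y th) (fun th => \1_I01 th * 1) k) => //.
    exact: (cmeas_comp mK (@measurable_swap _ _ R R)).
  by move=> th y; rewrite mulrC.
rewrite (eq_cintegral (fun th _ => KthE th)) -cintegral_mkcond -cintegralZ//.
exact: (cintegrable_mkcond _ mI01).2.
Qed.

(** The symbol of the Cauchy kernel is minus a primitive of that of the logarithmic
   one, by Fubini's theorem along the segment from [1/2] to [s]. *)
Theorem cauintE : cauint s = cauval s.
Proof.
have p0 : (pi *i) != 0 :> R[i].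
  by rewrite -normc_eq0 normcE2/= expr0n/= add0r sqrtr_sqr normr_eq0 gt_eqF ?pi_gt0.
have p2 : (4 * pi ^+ 2)%:C = - (2 * (pi *i)) ^+ 2 :> R[i].
  by apply: complex_eq; rewrite expr2 !reimE/=; ring.
have dE (th : R) : cderiv (fun t => Eexp (seg s t)) th
    (2 * (pi *i) * (s - 2^-1) * Eexp (seg s th)).
  apply: cderiv_cexp; apply: cderiv_eq.
    exact: (cderivZ 2 (cderivZ (pi *i) (cderiv_seg s th))).
  by rewrite mulrA.
have E1 (th : R) : 0 <= th <= 1 -> Eexp (seg s th) - 1 != 0.
  by move=> t01; rewrite subr_eq0 Eexp_neq1// seg_strip.
have dE1 (th : R) : cderiv (fun t => Eexp (seg s t) - 1) th
    (2 * (pi *i) * (s - 2^-1) * Eexp (seg s th)).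
  apply: cderiv_eq; first exact: (cderivD (dE th) (cderivN (cderiv_cst 1 th))).
  by rewrite oppr0 addr0.
have dE2 (th : R) : cderiv (fun t => Eexp (seg s t) + 1) th
    (2 * (pi *i) * (s - 2^-1) * Eexp (seg s th)).
  apply: cderiv_eq; first exact: (cderivD (dE th) (cderiv_cst 1 th)).
  by rewrite addr0.
have dV (th : R) t01 := cderivV (E1 th t01) (dE1 th).
rewrite cauint_logval (@cFTC _ (fun th => cauval (seg s th)))//.
- have -> : seg s 1 = s by rewrite /seg mul1r; ring.
  have -> : seg s 0 = 2^-1 by rewrite /seg mul0r addr0.
  rewrite /cauval (_ : Eexp 2^-1 = -1) ?addNr ?mul0r ?mulr0 ?subr0//.
  rewrite /Eexp -cexp_ipi; congr cexp; rewrite /ipi; by field.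
- move=> th t01; apply: cderiv_eq.
    exact: (cderivZ (pi *i) (cderivM (dE2 th) (dV th t01))).
  have E1' := E1 th t01; cbv beta; rewrite /logval p2.
  move: (Eexp _) E1' (pi *i) => E e q; by field.
- move=> th t01; have E1' := E1 th t01.
  have E2 : (Eexp (seg s th) - 1) ^+ 2 != 0 by rewrite expf_neq0.
  eexists; apply: cderivZ; rewrite /logval.
  apply: cderivZ; apply: cderivM; first exact: dE.
  apply: (@cderivV _ (fun t => (Eexp (seg s t) - 1) ^+ 2)) => //.
  by under eq_fun do rewrite expr2; exact: (cderivM (dE1 th) (dE1 th)).
Qed.

End fubini_segment.

End cauchy_symbol.

(** * Truncated Cauchy integrals *)

Section quarter_powers.
Context {R : realType}.
Local Notation mu := (@lebesgue_measure R).

Lemma mRpos : measurable (@Rpos R).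
Proof. exact: subst_dom subst_exp. Qed.

Lemma indic_Rpos (y : R) : \1_(@Rpos R) y = (nat_of_bool (0 < y)%R)%:R :> R.
Proof. by rewrite indicE; case: ltP => y0; [rewrite mem_set|rewrite memNset//=; apply/negP; rewrite -leNgt]. Qed.

(** A function of [|y|] is integrable as soon as it decays exponentially in the
   variable [ln |y|]. *)
Lemma rintegrable_abs_exp (h : R -> R) (C a : R) : 0 < a -> measurable_fun setT h ->
  h 0 = 0 -> (forall z, expR z * `|h (expR z)| <= C * expR (- (a * `|z|))) ->
  rintegrable setT (fun y => h `|y|).
Proof.
move=> a0 mh h0 hz.
have ipos : rintegrable (@Rpos R) h.
  apply/(rintegrable_subst subst_exp); first exact: measurable_funTS.
  apply: (@rintegrable_le _ _ _ (fun z => C * expR (- (a * `|z|)))) => //.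
  - apply: measurable_funM; first exact: measurable_expR.
    by apply: measurableT_comp => //; exact: measurable_expR.
  - by apply: rintegrableZ => //; exact: rintegrable_expR_abs.
  - by move=> z _; rewrite normrM ger0_norm ?expR_ge0.
have i1 := (rintegrable_mkcond h mRpos).1 ipos.
have i2 : rintegrable setT (fun y => \1_(@Rpos R) (- y) * h (- y)).
  have [+ _] := rintegrable_subst subst_opp (rintegrable_meas measurableT i1).
  by move=> /(_ i1); under eq_fun do rewrite mul1r.
have := rintegrableD measurableT i1 i2; apply: eq_integrable => // y _.
congr EFin; rewrite !indic_Rpos oppr_gt0; have [y0|y0|->] := ltrgt0P y.
- by rewrite mul1r mul0r addr0.
- by rewrite mul1r mul0r add0r.
- by rewrite oppr0 h0 !mulr0 addr0.
Qed.

(** Half-way between the exponent [0], for which the pole of the Cauchy kernel is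
   not integrable, and the exponent [1/2], at which the integrability in [tau]
   against the functions of the class is lost. *)
Definition w4 (x : R) : R := `|x| `^ 4^-1.

Lemma w4_ge0 x : 0 <= w4 x. Proof. exact: powR_ge0. Qed.

Lemma w4M x y : w4 (x * y) = w4 x * w4 y.
Proof. by rewrite /w4 normrM powRM. Qed.

Lemma w4_meas : measurable_fun setT w4.
Proof.
apply: (@measurableT_comp _ _ _ _ _ _ (@powR R ^~ 4^-1)) => //.
Qed.

Lemma normc_ceB1_le (x : R) : normc (ce x - 1) <= `|x|.
Proof.
have := @normc_mean_value R (fun t => cexp (t%:C * (x *i)))
  (fun t => (x *i) * cexp (t%:C * (x *i))) `|x| (cderiv_cexp_line (x *i)).
rewrite mul1r mul0r cexp0; apply.
  by move=> t; eexists; apply: cderivZ; exact: cderiv_cexp_line.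
move=> t _; rewrite normcMl normc_cexp.
have -> : Re (t%:C * (x *i)) = 0 by rewrite reimE/=; ring.
by rewrite expR0 mulr1 normcE2/= expr0n/= add0r sqrtr_sqr.
Qed.

Lemma normc_ceB1_w4 (x : R) : normc (ce x - 1) <= 2 * w4 x.
Proof.
have [x1|x1] := leP `|x| 1.
  have [->|x0] := eqVneq x 0.
    by rewrite ce0 subrr ComplexField.Normc.normc0 mulr_ge0 ?w4_ge0.
  rewrite (le_trans (normc_ceB1_le x))//.
  have : `|x| <= w4 x.
    by apply: ger1_powR; [rewrite normr_gt0 x0|lra].
  have := w4_ge0 x; lra.
rewrite (le_trans (le_normc_sub _ _))// normc_ce ComplexField.Normc.normc1.
have : 1 <= w4 x.
  by rewrite -[leLHS](powRr0 `|x|); apply: ler_powR; [exact: ltW|rewrite invr_ge0].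
lra.
Qed.

Lemma w4_expR (z : R) : w4 (expR z) = expR (4^-1 * z).
Proof. by rewrite /w4 ger0_norm ?expR_ge0// mulrC expRM. Qed.

(** A square integrable function with one more power of decay absorbs [w4]. *)
Lemma rintegrable_w4_decay :
  rintegrable setT (fun t : R => w4 t ^+ 2 * (1 + t ^+ 2)^-1).
Proof.
pose h (x : R) := w4 x ^+ 2 * (1 + x ^+ 2)^-1.
have mh : measurable_fun setT h.
  apply: measurable_funM; first by apply: measurable_funX; exact: w4_meas.
  by apply: measurable_funV; apply: measurable_funD => //; exact: measurable_funX.
have h0 : h 0 = 0 by rewrite /h /w4 normr0 powR0 ?expr0n ?mul0r// invr_neq0.
have hz z : expR z * `|h (expR z)| <= 1 * expR (- (2^-1 * `|z|)).
  rewrite mul1r ger0_norm; last first.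
    by rewrite mulr_ge0 ?sqr_ge0// invr_ge0 addr_ge0 ?sqr_ge0.
  rewrite /h w4_expR mulrA ler_pdivrMr; last by rewrite ltr_wpDr ?sqr_ge0.
  have -> : expR z * expR (4^-1 * z) ^+ 2 = expR (z + z / 2).
    by rewrite expr2 -!expRD; congr expR; field.
  rewrite mulrDr mulr1 expr2 -!expRD.
  have [z0|z0] := leP 0 z.
    rewrite (ger0_norm z0) ler_wpDl ?expR_ge0// ler_expR; lra.
  rewrite (ltr0_norm z0) ler_wpDr ?expR_ge0// ler_expR; lra.
have := rintegrable_abs_exp (_ : 0 < 2^-1) mh h0 hz.
have p : 0 < 2^-1 :> R by rewrite invr_gt0.
move=> /(_ p); apply: eq_integrable => // t _; congr EFin.
by rewrite /h /w4 normr_id real_normK// num_real.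
Qed.

Lemma rintegrable_w4_mul (F : R -> R[i]) (K1 K2 : R) : 0 <= K1 -> 0 <= K2 ->
  cmeas setT F ->
  rintegrable setT (fun t => normc (F t) ^+ 2 * (1 + t ^+ 2)) ->
  rintegrable setT (fun t => normc (F t) * (K1 + K2 * w4 t)).
Proof.
move=> K10 K20 mF iF.
have ip : rintegrable setT (poisson (1 : R)) by exact: poisson_integrable.
apply: (@rintegrable_le _ _ _ (fun t => (K1 + K2) * (normc (F t) ^+ 2 * (1 + t ^+ 2)) +
   (K1 * poisson 1 t + K2 * (w4 t ^+ 2 * (1 + t ^+ 2)^-1)))) => //.
- apply: measurable_funM; first exact: cmeas_normc.
  by apply: measurable_funD => //; apply: measurable_funM => //; exact: w4_meas.
- apply: rintegrableD => //; first exact: rintegrableZ.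
  by apply: rintegrableD => //; apply: rintegrableZ => //; exact: rintegrable_w4_decay.
move=> t _; rewrite ger0_norm; last first.
  by rewrite mulr_ge0 ?normc_ge0// addr_ge0// mulr_ge0 ?w4_ge0.
have d0 : 0 < 1 + t ^+ 2 by rewrite ltr_wpDr ?sqr_ge0.
(* The weight [1 + t^2] is shared between the two factors of the product. *)
have amgm (a b : R) : 0 <= a -> 0 <= b ->
    a * b <= a ^+ 2 * (1 + t ^+ 2) + b ^+ 2 * (1 + t ^+ 2)^-1.
  move=> a0 b0; set d := 1 + t ^+ 2 in d0 *.
  rewrite -(ler_pM2r d0) mulrDl -[_ / d * d]mulrA mulVf ?gt_eqF// mulr1.
  have := sqr_ge0 (a * d - b); rewrite !expr2 => h.
  have h2 : 0 <= a * d * b by rewrite !mulr_ge0// ltW.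
  nra.
have n0 := normc_ge0 (F t).
have e1 := amgm _ 1 n0 ler01; have e2 := amgm _ _ n0 (w4_ge0 t).
have -> : poisson 1 t = 2 * (1 + t ^+ 2)^-1 by rewrite /poisson expr1n mulr1.
have i0 : 0 <= (1 + t ^+ 2)^-1 by rewrite invr_ge0 ltW.
rewrite mulr1 expr1n mul1r in e1.
set X := normc (F t) ^+ 2 * _ in e1 e2 *; set Y := _^-1 in e1 e2 i0 *.
rewrite mulrDr [_ * (K2 * _)]mulrCA [_ * K1]mulrC.
have f1 := ler_wpM2l K10 e1; have f2 := ler_wpM2l K20 e2.
have f3 : 0 <= K1 * Y by rewrite mulr_ge0.
rewrite mulrDr in f1; rewrite mulrDr in f2.
lra.
Qed.

End quarter_powers.

Section truncation.
Context {R : realType}.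
Local Notation mu := (@lebesgue_measure R).
Implicit Types (s : R[i]) (e y tau : R).

(** The image of [e < |t - 1|] under [t = exp (- y)]. *)
Definition far e : set R := [set y | e < `|expR (- y) - 1|].

Lemma far_meas e : measurable (far e).
Proof.
have m : measurable_fun setT (fun y : R => `|expR (- y) - 1|).
  apply: measurableT_comp => //; apply: measurable_funB => //.
  by apply: measurableT_comp => //; exact: measurable_expR.
have := m measurableT _ (measurable_itv `]e, +oo[); rewrite setTI.
by congr measurable; apply/seteqP; split=> y /=; rewrite in_itv/= andbT.
Qed.

Lemma indic_far e y : \1_(far e) y = (nat_of_bool (e < `|expR (- y) - 1|)%R)%:R :> R.
Proof. by rewrite indicE mem_setE. Qed.

Lemma expRB1_abs y : `|expR (- y) - 1| <= expR `|y| - 1.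
Proof.
have [y0|y0] := leP 0 y.
  have E0 := expR_gt0 y; rewrite (ger0_norm y0) expRN ler0_norm; last first.
    by rewrite subr_le0 -expRN expR_le1 oppr_le0.
  have E1 : expR y * (expR y)^-1 = 1 by rewrite mulfV ?gt_eqF.
  have := sqr_ge0 (1 - expR y); rewrite expr2.
  have i0 : 0 < (expR y)^-1 by rewrite invr_gt0.
  nra.
rewrite (ltr0_norm y0) ger0_norm// subr_ge0 -expR0 ler_expR; lra.
Qed.

Lemma far_abs e y : 0 < e -> far e y -> ln (1 + e) < `|y|.
Proof.
move=> e0 fy; have := lt_le_trans fy (expRB1_abs y).
rewrite ltrBrDl => h; rewrite -(expRK `|y|) ltr_ln ?posrE ?expR_gt0//; lra.
Qed.

Lemma hb_abs y : `|hb y| * `|y| = kb y.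
Proof. by rewrite -normrM hb_mulr normrN ger0_norm ?kb_ge0. Qed.

Lemma ln1D_gt0 e : 0 < e -> 0 < ln (1 + e).
Proof. by move=> e0; rewrite ln_gt0// ltrDl. Qed.

Lemma far_hb e y : 0 < e -> `|\1_(far e) y * hb y| <= (ln (1 + e))^-1 * kb y.
Proof.
move=> e0; have q0 := ln1D_gt0 e0; rewrite indic_far.
have [fy|] := boolP (e < _); last first.
  by rewrite mul0r normr0 mulr_ge0 ?kb_ge0// invr_ge0 ltW.
have qy := far_abs e0 fy; rewrite mul1r -hb_abs ler_pdivlMl// mulrC.
by rewrite ler_wpM2l// ltW.
Qed.

Lemma far_hb_meas e : measurable_fun setT (fun y => \1_(far e) y * hb y).
Proof. by apply: measurable_funM; [apply: measurable_indic; exact: far_meas|exact: hb_meas]. Qed.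

Lemma cintegrable_far s e : 0 < Re s < 1 -> 0 < e ->
  cintegrable setT (fun y => (\1_(far e) y * hb y)%:C * cexp (s * y%:C)).
Proof.
move=> s01 e0; apply: (@cintegrable_le _ _ _
  (fun y => (ln (1 + e))^-1 * (kb y * expR (Re s * y)))) => //.
- by apply: cmeasM; [apply: cmeas_real; exact: far_hb_meas|exact: cmeas_cexpM].
- by apply: rintegrableZ => //; exact: rintegrable_kb.
move=> y _; rewrite normcMl normcR normc_cexp Re_mulR mulrA.
by rewrite ler_wpM2r ?expR_ge0// far_hb.
Qed.

(** The transform of the Cauchy kernel truncated around its pole. *)
Definition farint e s : R[i] :=
  cintegral setT (fun y => (\1_(far e) y * hb y)%:C * cexp (s * y%:C)).

(** Oddness at the centre [1/2] of the strip is what cancels the principal value. *)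
Lemma hb_oddE y : hb (- y) * expR (2^-1 * - y) = - (hb y * expR (2^-1 * y)).
Proof.
have [->|y0] := eqVneq y 0; first by rewrite oppr0 hb0 !mul0r oppr0.
have h (z : R) : z != 0 -> hb z * expR (2^-1 * z) = (expR (- (2^-1 * z)) - expR (2^-1 * z))^-1.
  move=> z0; have E : expR z = expR (2^-1 * z) * expR (2^-1 * z).
    by rewrite -expRD; congr expR; field.
  have := expRB1_neq0 z0; rewrite /hb E expRN; have := expR_gt0 (2^-1 * z).
  move: (expR _) => u u0 u1; have u2 : 1 - u * u != 0 by rewrite -oppr_eq0 opprB.
  have -> : u^-1 - u = u^-1 * (1 - u * u) by field; rewrite gt_eqF.
  by rewrite invfM invrK mulrC.
by rewrite h ?oppr_eq0// h// mulrN opprK -invrN opprB.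
Qed.

(** The part of the truncation that is not symmetric in [y]: since [far e]
   excludes slightly different lengths on both sides of [0], it consists of the
   integral over [- ln (1 + e), - ln (1 - e)], and is of the order of [e]. *)
Lemma farint_half e : 0 < e <= 2^-1 -> normc (farint e 2^-1) <= 8 * e.
Proof.
move=> /andP[e0 e2]; have h01 : 0 < Re (2^-1 : R[i]) < 1 by rewrite Re_half; apply/andP; split; lra.
have ci := cintegrable_far h01 e0; rewrite /farint (cintegral_fold ci).
set q := ln (1 + e); set p := - ln (1 - e).
have q0 : 0 < q := ln1D_gt0 e0.
have e1 : 0 < 1 - e by lra.
have e1' : 0 < 1 + e by lra.
have lp : p <= e / (1 - e).
  have -> : p = ln (1 + e / (1 - e)).
    by rewrite /p -lnV ?posrE//; congr ln; field; rewrite gt_eqF.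
  by apply: le_ln1Dx; rewrite (lt_le_trans _ (divr_ge0 (ltW e0) (ltW e1)))// ltrN10.
have lq : e / (1 + e) <= q.
  have := @le_ln1Dx R (- (e / (1 + e))).
  have -> : 1 - e / (1 + e) = (1 + e)^-1 by field; rewrite gt_eqF.
  have u1 : e / (1 + e) < 1 by rewrite ltr_pdivrMr//; lra.
  by rewrite lnV ?posrE// lerN2; apply; rewrite ltrN2.
have pq : p - q <= 4 * e * q.
  have h1 : e / (1 - e) - e / (1 + e) <= 4 * e * (e / (1 + e)).
    set u := e / (1 + e); have u0 : 0 <= u by rewrite divr_ge0// ltW.
    have eE : e / (1 - e) = u * (1 + e) / (1 - e) by rewrite /u; field; rewrite !gt_eqF.
    rewrite eE; move: u u0 {eE} => u u0.
    have e4 : 0 <= 1 - 2 * e by lra.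
    have ue : 0 <= u * e * (1 - 2 * e) by rewrite mulr_ge0// mulr_ge0// ltW.
    rewrite lerBlDr ler_pdivrMr//; lra.
  have h2 : 4 * e * (e / (1 + e)) <= 4 * e * q by rewrite ler_wpM2l// mulr_ge0// ltW.
  lra.
have qp : q <= p.
  rewrite /q /p lerNr -lnV ?posrE//; rewrite ler_ln ?posrE ?invr_gt0//.
  rewrite -[leRHS]div1r ler_pdivlMr//; nra.
(* Folded onto [0, +oo[, the integrand is supported by [q, p], where the kernel is
   at most [2 / y]. *)
pose k (y : R) : R := \1_(`[q, p]%classic : set R) y * (2 / q).
have ik : rintegrable setT k.
  apply: (rintegrable_mkcond (fun=> 2 / q) (measurable_itv `[q, p])).1.
  apply: (@continuous_compact_integrable R (cst (2 / q))); first exact: segment_compact.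
  by apply: continuous_subspaceT => x; exact: cvg_cst.
have k_ge0 y : 0 <= k y by rewrite mulr_ge0// divr_ge0// ltW.
have ik0 : rintegrable (`[0, +oo[%classic : set R) k by exact: rintegrableS ik.
have mf : cmeas setT (fun y => (\1_(far e) y * hb y)%:C * cexp (2^-1 * y%:C)).
  exact: cintegrable_meas ci.
have E (y : R) : cexp (2^-1 * y%:C) = (expR (2^-1 * y))%:C.
  rewrite (_ : 2^-1 * y%:C = (2^-1 * y)%:C) ?cexpR//.
  by rewrite rmorphM fmorphV rmorph_nat.
apply: (le_trans (le_normc_cintegral_dom _ _ ik0 _)) => //.
- apply: cmeasT; apply: cmeasD => //.
  by apply: (cmeas_comp mf); exact: oppr_measurable.
- move=> y /itv0yP y0.
  have [->|yn0] := eqVneq y 0.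
    rewrite oppr0 hb0 mulr0 mul0r addr0 ComplexField.Normc.normc0; exact: k_ge0.
  have yp : 0 < y by rewrite lt_neqAle eq_sym yn0.
  rewrite !E; have Cr (a b c d : R) : a%:C * b%:C + c%:C * d%:C = (a * b + c * d)%:C :> R[i].
    by rewrite rmorphD !rmorphM.
  rewrite Cr normcR -!mulrA hb_oddE mulrN -mulrBl normrM.
  have o2 : `|hb y * expR (2^-1 * y)| <= 2 / y.
    rewrite normrM [`|expR _|]ger0_norm ?expR_ge0// ler_pdivlMr// mulrAC.
    have := hb_abs y; rewrite (ger0_norm y0) => ->.
    apply: (le_trans (ler_wpM2r (expR_ge0 _) (kb_le y0))).
    by rewrite -mulrA -expRD addNr expR0 mulr1.
  have E1 : expR y * expR (- y) = 1 by rewrite -expRD subrr expR0.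
  have e10 : 0 <= 1 - expR (- y) by rewrite subr_ge0 expR_le1 oppr_le0.
  have e20 : 0 <= expR y - 1 by rewrite subr_ge0 -expR0 ler_expR.
  rewrite !indic_far opprK [`|expR (- y) - 1|]distrC (ger0_norm e10) (ger0_norm e20).
  have [f1|f1] := ltP e (1 - expR (- y)).
    have -> : e < expR y - 1.
      apply: (lt_le_trans f1); have := sqr_ge0 (expR y - 1); rewrite expr2.
      have := expR_gt0 (- y); nra.
    by rewrite subrr normr0 mul0r k_ge0.
  have [f2|f2] := ltP e (expR y - 1); last by rewrite subrr normr0 mul0r k_ge0.
  have qy : q <= y by rewrite -[y]expRK ler_ln ?posrE ?expR_gt0//; lra.
  rewrite sub0r normrN normr1 mul1r (le_trans o2)// /k indicE mem_set; last first.
    rewrite /= in_itv/= qy/= /p lerNr -[- y]expRK ler_ln ?posrE ?expR_gt0//; lra.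
  by rewrite mul1r ler_wpM2l// lef_pV2 ?posrE.
have -> : \int[mu]_(t in `[0, +oo[) k t = (p - q) * (2 / q).
  rewrite rintegral_mkcond.
  under eq_Rintegral => y _.
    rewrite (_ : _ * k y = k y); last first.
      rewrite /k !indicE; have [|_] := boolP (y \in `[q, p]%classic); last by rewrite mul0r mulr0.
      rewrite inE/= in_itv/= => /andP[qy _]; rewrite mem_set ?mul1r//= in_itv/= andbT; lra.
    over.
  rewrite /k -rintegral_mkcond Rintegral_cst//= lebesgue_measure_itv/= lte_fin.
  have [//|pq'] := ltP q p; first by rewrite -EFinB/= mulrC.
  by have -> : p = q by [lra]; rewrite subrr mul0r mulr0.
rewrite mulrA ler_pdivrMr//; nra.
Qed.

(** The majorant of the increment of [cau_integrand] in [tau], divided by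
   [w4 tau]: the factor [w4 y] tames the simple pole of [hb] at the origin. *)
Definition kq (c y : R) : R := `|hb y| * w4 y * expR (c * y).

Lemma kq_ge0 c y : 0 <= kq c y.
Proof. by rewrite !mulr_ge0 ?w4_ge0 ?expR_ge0. Qed.

Lemma kq_meas c : measurable_fun setT (kq c).
Proof.
apply: measurable_funM; last exact: measurable_expRM.
apply: measurable_funM; last exact: w4_meas.
by apply: measurableT_comp => //; exact: hb_meas.
Qed.

Lemma rintegrable_kq c : 0 < c < 1 -> rintegrable setT (kq c).
Proof.
move=> c01; have /andP[c0 c1] := c01.
pose h (x : R) : R := \1_(`]-oo, 1[%classic : set R) x * (w4 x / x).
have hE x : h x = (nat_of_bool (x < 1)%R)%:R * (w4 x / x).
  by rewrite /h indicE mem_setE in_itv.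
have mh : measurable_fun setT h.
  apply: measurable_funM; first exact: measurable_indic.
  by apply: measurable_funM; [exact: w4_meas|exact: measurable_funV].
have h0 : h 0 = 0 by rewrite hE invr0 !mulr0.
have hz z : expR z * `|h (expR z)| <= 1 * expR (- (4^-1 * `|z|)).
  rewrite hE w4_expR -[X in (_ < X)%R]expR0 ltr_expR mul1r.
  have [z0|z0] := ltP z 0; last by rewrite mul0r normr0 mulr0 expR_ge0.
  rewrite mul1r ger0_norm ?divr_ge0 ?expR_ge0// mulrCA mulfV ?gt_eqF ?expR_gt0//.
  by rewrite mulr1 ler_expR ltr0_norm// mulrN opprK.
have p4 : 0 < 4^-1 :> R by rewrite invr_gt0.
have ih := rintegrable_abs_exp p4 mh h0 hz.
apply: (@rintegrable_le _ _ _ (fun y => kb y * expR (c * y) + 3 * expR 1 * h `|y|)) => //.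
- exact: kq_meas.
- by apply: rintegrableD => //; [exact: rintegrable_kb|exact: rintegrableZ].
move=> y _; rewrite ger0_norm ?kq_ge0// /kq hE.
have [->|y0] := eqVneq y 0; first by rewrite hb0 normr0 !mul0r kb0 mul0r invr0 !mulr0 addr0.
have yp : 0 < `|y| by rewrite normr_gt0.
have hbE : `|hb y| = kb y / `|y| by rewrite -hb_abs mulfK ?gt_eqF.
have w4E : w4 `|y| = w4 y by rewrite /w4 normr_id.
rewrite hbE w4E; have [y1|y1] := ltP `|y| 1; last first.
  rewrite mul0r mulr0 addr0 ler_wpM2r ?expR_ge0// -mulrA ler_piMr ?kb_ge0//.
  rewrite mulrC ler_pdivrMr// mul1r.
  by apply: ler1_powR => //; lra.
have kb3 : kb y <= 3.
  have [yp'|yn] := leP 0 y; first by rewrite (le_trans (kb_le2 yp'))//; lra.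
  have ny : 0 <= - y by rewrite oppr_ge0 ltW.
  have := kbN (_ : - y != 0); rewrite oppr_eq0 opprK => ->//.
  have := kb_le2 ny; move: y1; rewrite ltr0_norm//; lra.
have ee : expR (c * y) <= expR 1.
  rewrite ler_expR; have := ler_norm y; nra.
rewrite mul1r; apply: ler_wpDl; first exact: (mulr_ge0 (kb_ge0 _) (expR_ge0 _)).
have -> : kb y / `|y| * w4 y * expR (c * y) = kb y * expR (c * y) * (w4 y / `|y|) by ring.
rewrite ler_wpM2r ?divr_ge0 ?w4_ge0//.
by rewrite ler_pM ?kb_ge0 ?expR_ge0.
Qed.

Lemma cexp_line (c tau y : R) :
  cexp ((c +i* tau) * y%:C) = (expR (c * y))%:C * ce (tau * y).
Proof.
rewrite -cexpR -cexpD; congr cexp; apply: complex_eq; rewrite !reimE/=; ring.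
Qed.

Lemma normc_cau_line (c tau y : R) :
  normc (cau_integrand (c +i* tau) y) <=
    normc (cau_integrand c%:C y) + 2 * w4 tau * kq c y.
Proof.
have -> : cau_integrand (c +i* tau) y = cau_integrand c%:C y +
    (hb y)%:C * (expR (c * y))%:C * (ce (tau * y) - 1).
  have -> : c%:C = c +i* 0 :> R[i] by [].
  rewrite /cau_integrand !cexp_line mul0r ce0 mulr1; ring.
rewrite (le_trans (le_normc_add _ _))// lerD2l !normcMl !normcR.
rewrite [`|expR _|]ger0_norm ?expR_ge0//.
apply: (le_trans (ler_wpM2l _ (normc_ceB1_w4 _))); first by rewrite mulr_ge0 ?expR_ge0.
rewrite w4M /kq le_eqVlt; apply/orP; left; apply/eqP; ring.
Qed.

Lemma farint_split s e : 0 < Re s < 1 -> 0 < e ->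
  cintegrable setT (fun y => (\1_(far e) y)%:C * cau_integrand s y) /\
  farint e s = cintegral setT (fun y => (\1_(far e) y)%:C * cau_integrand s y) +
    farint e 2^-1.
Proof.
move=> s01 e0; have h01 : 0 < Re (2^-1 : R[i]) < 1 by rewrite Re_half; apply/andP; split; lra.
have i1 := cintegrable_far s01 e0; have i2 := cintegrable_far h01 e0.
have E y : (\1_(far e) y * hb y)%:C * cexp (s * y%:C) -
    (\1_(far e) y * hb y)%:C * cexp (2^-1 * y%:C) = (\1_(far e) y)%:C * cau_integrand s y.
  have -> : (\1_(far e) y * hb y)%:C = (\1_(far e) y)%:C * (hb y)%:C :> R[i] by rewrite rmorphM.
  rewrite /cau_integrand; ring.
split; first by apply: eq_cintegrable (cintegrableB measurableT i1 i2) => // y _.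
by rewrite /farint -(eq_cintegral (fun y _ => E y)) cintegralB// subrK.
Qed.

Lemma normc_indicM D y (z : R[i]) : normc ((\1_D y)%:C * z) <= normc z.
Proof.
rewrite normcMl normcR ger0_norm ?indicE ?ler0n//.
by case: (_ \in _); rewrite ?mul1r ?mul0r ?normc_ge0.
Qed.

(** The subtraction at [s = 1/2] makes the integrand absolutely integrable, with a
   majorant that does not depend on the truncation. *)
Lemma farint_bound (c : R) : 0 < c < 1 -> exists K1 K2 : R, [/\ 0 <= K1, 0 <= K2 &
  forall e tau, 0 < e <= 2^-1 -> normc (farint e (c +i* tau)) <= K1 + K2 * w4 tau].
Proof.
move=> c01.
have ic : cintegrable setT (cau_integrand c%:C) by exact: cintegrable_cau.
have inc := cintegrable_normc measurableT ic.
have iq := rintegrable_kq c01.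
exists (\int[mu]_y normc (cau_integrand c%:C y) + 4), (2 * \int[mu]_y kq c y); split.
- by rewrite addr_ge0//; apply: Rintegral_ge0 => y _; exact: normc_ge0.
- by rewrite mulr_ge0//; apply: Rintegral_ge0 => y _; exact: kq_ge0.
move=> e tau e02; have /andP[e0 e2] := e02.
have s01 : 0 < Re (c +i* tau) < 1 by [].
have [ci ->] := farint_split s01 e0.
have ik : rintegrable setT (fun y => normc (cau_integrand c%:C y) + 2 * w4 tau * kq c y).
  by apply: rintegrableD => //; exact: rintegrableZ.
have hI := le_normc_cintegral_dom measurableT (cintegrable_meas measurableT ci) ik
  (fun y _ => le_trans (normc_indicM _ _ _) (normc_cau_line c tau y)).
rewrite (le_trans (le_normc_add _ _))//.
have h2 := farint_half e02.
rewrite RintegralD// ?RintegralZl// in hI; last exact: rintegrableZ.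
apply: (le_trans (lerD hI h2)).
have -> : 2 * w4 tau * \int[mu]_y kq c y = 2 * \int[mu]_y kq c y * w4 tau by ring.
lra.
Qed.

(** After subtraction of the value at [1/2], which tends to [0], dominated
   convergence applies. *)
Lemma farint_cvg s (e_ : nat -> R) : 0 < Re s < 1 -> (forall n, 0 < e_ n <= 2^-1) ->
  e_ n @[n --> \oo] --> 0 ->
  normc (farint (e_ n) s - cauval s) @[n --> \oo] --> (0 : R).
Proof.
move=> s01 e02 e_cvg; rewrite -(cauintE s01).
have ic := cintegrable_cau s01.
have e0 n : 0 < e_ n by case/andP: (e02 n).
have ptw y : setT y ->
    normc ((\1_(far (e_ n)) y)%:C * cau_integrand s y - cau_integrand s y)
      @[n --> \oo] --> (0 : R).
  move=> _; apply/cvgrPdist_lt => d d0.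
  have [y0|y0] := eqVneq y 0.
    near=> n; rewrite y0 /cau_integrand hb0 mul0r mulr0 subrr.
    by rewrite ComplexField.Normc.normc0 subrr normr0.
  have Y : 0 < `|expR (- y) - 1|.
    by rewrite normr_gt0; apply: expRB1_neq0; rewrite oppr_eq0.
  have /cvgrPdist_lt/(_ _ Y) := e_cvg; apply: filterS => n; rewrite sub0r normrN => h.
  have E := le_lt_trans (ler_norm _) h.
  by rewrite indic_far E mul1r subrr ComplexField.Normc.normc0 subrr normr0.
have [_ h] := cintegral_dct measurableT
  (fun n => cintegrable_meas measurableT (farint_split s01 (e0 n)).1)
  (cintegrable_normc measurableT ic) (fun n y _ => normc_indicM _ _ _) ptw.
apply/cvgrPdist_lt => d d0.
have /cvgrPdist_lt/(_ (d / 2))h1 := h.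
have /cvgrPdist_lt/(_ (d / 16))h2 := e_cvg.
near=> n.
have n1 : normc (cintegral setT (fun y => (\1_(far (e_ n)) y)%:C * cau_integrand s y) -
   cintegral setT (cau_integrand s)) < d / 2.
  have : `|0 - normc (cintegral setT (fun y => (\1_(far (e_ n)) y)%:C * cau_integrand s y) -
   cintegral setT (cau_integrand s))| < d / 2 by near: n; apply: h1; rewrite divr_gt0.
  by rewrite sub0r normrN ger0_norm ?normc_ge0.
have n2 : e_ n < d / 16.
  have : `|0 - e_ n| < d / 16 by near: n; apply: h2; rewrite divr_gt0.
  by rewrite sub0r normrN; apply: le_lt_trans; exact: ler_norm.
have [_ ->] := farint_split s01 (e0 n).
rewrite sub0r normrN ger0_norm ?normc_ge0// addrAC.
rewrite (le_lt_trans (le_normc_add _ _))//.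
have := farint_half (e02 n); lra.
Unshelve. all: by end_near.
Qed.

End truncation.

(** * Multipliers of the Mellin transform *)

Section composition.
Context {R : realType}.
Local Notation mu := (@lebesgue_measure R).

Lemma subst_comp (D : set R) phi w psi v :
  subst_rule D phi w -> subst_rule setT psi v ->
  subst_rule D (fun y => phi (psi y)) (fun y => v y * w (psi y)).
Proof.
move=> S T; split.
- exact: subst_dom S.
- exact: (measurableT_comp (subst_meas S) (subst_meas T)).
- apply: measurable_funM; first exact: subst_wmeas T.
  exact: (measurableT_comp (subst_wmeas S) (subst_meas T)).
- by move=> y; rewrite mulr_ge0// ?(subst_w0 S)// (subst_w0 T).
- by move=> y; exact: subst_in S _.
move=> f mf f0; rewrite (subst_ge0 S)// (subst_ge0 T).
- by apply: eq_integral => y _; rewrite EFinM -muleA [((v y)%:E * _)%E]muleC.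
- apply: emeasurable_funM; first exact: (measurableT_comp mf (subst_meas S)).
  by apply/measurable_EFinP; exact: subst_wmeas S.
- by move=> t; rewrite mule_ge0// lee_fin (subst_w0 S).
Qed.

(** [t = x exp (- y)] turns the quotient [x / t] into [exp y]. *)
Lemma subst_quotient (x : R) : 0 < x ->
  subst_rule (@Rpos R) (fun y => x * expR (- y)) (fun y => x * expR (- y)).
Proof.
move=> x0.
have := subst_comp subst_exp (subst_comp (subst_affine (ln x) ltr01) subst_opp).
have E y : expR (1 * - y + ln x) = x * expR (- y).
  by rewrite mul1r expRD lnK ?posrE// mulrC.
under [X in subst_rule _ X _]eq_fun do rewrite E.
by under [X in subst_rule _ _ X]eq_fun do rewrite E !mul1r.
Qed.

End composition.

Section mellin_inversion.
Context {R : realType}.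
Local Notation mu := (@lebesgue_measure R).
Implicit Types (F G : R -> R[i]) (x y : R).

(** The inversion integral as a Fourier transform in the variable [ln x]. *)
Definition minv G x : R[i] :=
  ((2 * pi)^-1)%:C * (x `^ (- 2^-1))%:C * four G (- ln x).

Lemma cpow_half x tau : cpow x (- sigma tau) = (x `^ (- 2^-1))%:C * ce (tau * - ln x).
Proof.
by rewrite /cpow /sigma ceE /= mulrN mulNr.
Qed.

Lemma mellin_invE (F : R[i] -> R[i]) x : cintegrable setT (fun tau => F (sigma tau)) ->
  mellin_inv F x = minv (fun tau => F (sigma tau)) x.
Proof.
move=> cF; rewrite /mellin_inv /minv /four.
have i0 : 'i%C != 0 :> R[i] by rewrite neq0Ci.
have p0 : (2 * pi)%:C != 0 :> R[i].
  by rewrite -normc_eq0 normcR normr_eq0 mulf_neq0// gt_eqF// pi_gt0.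
rewrite (@eq_cintegral _ _ _
  (fun tau => 'i%C * (x `^ (- 2^-1))%:C * (F (sigma tau) * ce (tau * - ln x)))) => [|tau _].
  rewrite cintegralZ//; last exact: (cintegrable_mulce _ cF).
  rewrite fmorphV/=; move: (cintegral _ _) => I.
  rewrite invfM -!mulrA [_^-1 * ('i%C * _)]mulrA mulVf// mul1r.
  by [].
by rewrite cpow_half; ring.
Qed.

Lemma cmeas_minv G : cintegrable setT G -> cmeas (@Rpos R) (minv G).
Proof.
move=> cG; apply: cmeasM.
  apply: cmeasM; first exact: cmeas_cst.
  by apply: cmeas_real; apply: measurable_funTS; exact: measurable_powR.
have mG := cmeas_four cG.
apply: cmeasT; apply: (cmeas_comp mG).
by apply: measurableT_comp => //; exact: measurable_ln.
Qed.

Lemma minv_shift G x y : 0 < x ->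
  minv G (x * expR (- y)) = ((2 * pi)^-1)%:C * (x `^ (- 2^-1))%:C *
    ((expR (2^-1 * y))%:C * four (fun tau => G tau * ce (tau * - ln x)) y).
Proof.
move=> x0; rewrite /minv powRM ?expR_ge0// ?(ltW x0)//.
have -> : expR (- y) `^ (- 2^-1) = expR (2^-1 * y) :> R.
  by rewrite -expRM; congr expR; ring.
have -> : four G (- ln (x * expR (- y))) = four (fun tau => G tau * ce (tau * - ln x)) y.
  rewrite lnM ?posrE ?expR_gt0// expRK; apply: eq_cintegral => tau _.
  by rewrite -mulrA -ceD; congr (_ * ce _); ring.
have -> : (x `^ (- 2^-1) * expR (2^-1 * y))%:C =
  (x `^ (- 2^-1))%:C * (expR (2^-1 * y))%:C :> R[i] by rewrite rmorphM.
ring.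
Qed.

(** An integral operator whose kernel, in the variable [y] with [t = x exp (- y)],
   does not depend on [x] multiplies the Mellin transform by the transform of
   the kernel: this is the multiplication formula of the Fourier transform. *)
Lemma minv_kernel (kappa k : R -> R) G x : 0 < x ->
  measurable_fun (@Rpos R) kappa -> rintegrable setT k -> cintegrable setT G ->
  (forall y, x * expR (- y) * kappa (x * expR (- y)) * expR (2^-1 * y) = k y) ->
  cintegrable (@Rpos R) (fun t => (kappa t)%:C * minv G t) /\
  cintegral (@Rpos R) (fun t => (kappa t)%:C * minv G t) =
    minv (fun tau => G tau * four (fun y => (k y)%:C) tau) x.
Proof.
move=> x0 mkappa ik cG kE; have S := subst_quotient x0.
have ck := cintegrable_real ik.
have mf : cmeas (@Rpos R) (fun t => (kappa t)%:C * minv G t).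
  by apply: cmeasM; [exact: cmeas_real|exact: cmeas_minv].
pose Gx tau := G tau * ce (tau * - ln x).
have cGx : cintegrable setT Gx by exact: cintegrable_mulce.
pose K := ((2 * pi)^-1)%:C * (x `^ (- 2^-1))%:C : R[i].
have E y : (x * expR (- y))%:C * ((kappa (x * expR (- y)))%:C * minv G (x * expR (- y))) =
    K * ((k y)%:C * four Gx (1 * y)).
  rewrite minv_shift// mul1r -/K -/Gx -kE.
  have Cr (a b c : R) : (a * b * c)%:C = a%:C * b%:C * c%:C :> R[i] by rewrite !rmorphM.
  rewrite Cr; move: (x * expR (- y)) (kappa _) => a b; ring.
have ci := cintegrable_mul_four 1 ck cGx.
split.
  apply: (cintegrable_subst S mf).2.
  by apply: eq_cintegrable (cintegrableZ K measurableT ci) => // y _; rewrite E.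
rewrite (cintegral_subst S mf) (eq_cintegral (fun y _ => E y)) cintegralZ//.
rewrite (four_swap 1 ck cGx) /minv -/K; congr (_ * _).
by apply: eq_cintegral => tau _; rewrite /Gx mul1r; ring.
Qed.

End mellin_inversion.

Section mellin_kernels.
Context {R : realType}.
Local Notation mu := (@lebesgue_measure R).
Implicit Types (G : R -> R[i]) (b c e x y tau : R).

Lemma four_line (k : R -> R) c tau :
  four (fun y => (k y * expR (c * y))%:C) tau =
  cintegral setT (fun y => (k y)%:C * cexp ((c +i* tau) * y%:C)).
Proof.
apply: eq_cintegral => y _; rewrite cexp_line mulrA [y * tau]mulrC.
by congr (_ * _); rewrite rmorphM.
Qed.

Lemma eq_minv G H x : (forall tau, G tau = H tau) -> minv G x = minv H x.
Proof. by move=> GH; congr minv; apply/funext. Qed.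

Lemma powR_quotient b x y : 0 < x -> (x / (x * expR (- y))) `^ b = expR (b * y).
Proof.
move=> x0; have -> : x / (x * expR (- y)) = expR y.
  by rewrite expRN; field; rewrite !gt_eqF ?expR_gt0.
by rewrite mulrC expRM.
Qed.

Lemma powR_quotient_meas b x : measurable_fun (@Rpos R) (fun t => (x / t) `^ b).
Proof.
apply: measurable_funTS; apply: (@measurableT_comp _ _ _ _ _ _ (@powR R ^~ b)) => //.
by apply: measurable_funM => //; exact: measurable_funV.
Qed.

Lemma logker_eval G b x : 0 < 2^-1 + b < 1 -> 0 < x -> cintegrable setT G ->
  cintegrable (@Rpos R)
    (fun t => (logker x t)%:C * ((x / t) `^ b)%:C * minv G t) /\
  cintegral (@Rpos R) (fun t => (logker x t)%:C * ((x / t) `^ b)%:C * minv G t) =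
    minv (fun tau => G tau * logval ((2^-1 + b) +i* tau)) x.
Proof.
move=> c01 x0 cG; set c := 2^-1 + b in c01 *.
pose kappa t := logker x t * (x / t) `^ b.
have mkappa : measurable_fun (@Rpos R) kappa.
  apply: measurable_funM; last exact: powR_quotient_meas.
  apply: measurable_funTS; apply: measurable_funM.
    by apply: measurable_funB => //; exact: measurable_ln.
  by apply: measurable_funV; exact: measurable_funB.
have kE y : x * expR (- y) * kappa (x * expR (- y)) * expR (2^-1 * y) = kb y * expR (c * y).
  rewrite /kappa powR_quotient// /c [in RHS]mulrDl expRD.
  have -> : x * expR (- y) * (logker x (x * expR (- y)) * expR (b * y)) =
    x * expR (- y) * logker x (x * expR (- y)) * expR (b * y) by ring.
  have -> : x * expR (- y) * logker x (x * expR (- y)) = kb y; last by ring.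
  have E0 := expR_gt0 y.
  rewrite /logker lnM ?posrE ?expR_gt0// expRK.
  have [->|y0] := eqVneq y 0; first by rewrite kb0 oppr0 addr0 subrr mul0r mulr0.
  have e1 := expRB1_neq0 y0; rewrite /kb expRN.
  have e2 : 1 - (expR y)^-1 != 0.
    by rewrite subr_eq0 eq_sym invr_eq1 -subr_eq0.
  have -> : x - x / expR y = x * (1 - (expR y)^-1) by ring.
  have -> : ln x - (ln x - y) = y by ring.
  rewrite invfM.
  have -> : (1 - (expR y)^-1)^-1 = expR y / (expR y - 1).
    by apply: (mulfI e2); rewrite mulfV//; field; rewrite e1 gt_eqF.
  by field; rewrite e1 !gt_eqF.
have [h1 h2] := minv_kernel x0 mkappa (rintegrable_kb c01) cG kE.
have E t : (kappa t)%:C * minv G t = (logker x t)%:C * ((x / t) `^ b)%:C * minv G t.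
  by congr (_ * _); rewrite rmorphM.
split; first by apply: eq_cintegrable h1 => //; exact: mRpos.
rewrite -(eq_cintegral (fun t _ => E t)) h2; apply: eq_minv => tau.
by rewrite four_line -logintE.
Qed.

Let mdist x : measurable_fun setT (fun t : R => `|t - x|).
Proof. by apply: measurableT_comp => //; exact: measurable_funB. Qed.

Let mgap x e : measurable [set t : R | e < `|t - x|].
Proof.
have := mdist x measurableT (measurable_itv `]e, +oo[); rewrite setTI.
by congr measurable; apply/seteqP; split=> y /=; rewrite in_itv/= andbT.
Qed.

Let indic_gap x e (t : R) :
  \1_[set t : R | e < `|t - x|] t = (nat_of_bool (e < `|t - x|)%R)%:R :> R.
Proof. by rewrite indicE mem_setE. Qed.

(** The truncated Cauchy kernel is still of convolution type, since the truncation
   at distance [e] from [x] is [e / x] relative to [x]. *)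
Lemma cauchy_eval G b x e : 0 < 2^-1 + b < 1 -> 0 < x -> cintegrable setT G -> 0 < e ->
  let D := [set t | 0 < t /\ e < `|t - x|] in
  let g t := ((x / t) `^ b)%:C * (minv G t / (t - x)%:C) in
  cintegrable D g /\
  cintegral D g = minv (fun tau => G tau * farint (e / x) ((2^-1 + b) +i* tau)) x.
Proof.
move=> c01 x0 cG e0; set c := 2^-1 + b in c01 * => D g.
have ex0 : 0 < e / x by rewrite divr_gt0.
pose kappa t := \1_[set t | e < `|t - x|] t * (t - x)^-1 * (x / t) `^ b.
have mkappa : measurable_fun (@Rpos R) kappa.
  apply: measurable_funM; last exact: powR_quotient_meas.
  apply: measurable_funTS; apply: measurable_funM; first exact: measurable_indic.
  by apply: measurable_funV; exact: measurable_funB.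
have kE y : x * expR (- y) * kappa (x * expR (- y)) * expR (2^-1 * y) =
    \1_(far (e / x)) y * hb y * expR (c * y).
  rewrite /kappa powR_quotient// /c [in RHS]mulrDl expRD.
  have -> : \1_[set t | e < `|t - x|] (x * expR (- y)) = \1_(far (e / x)) y :> R.
    rewrite indic_gap indic_far; congr (nat_of_bool _)%:R.
    have -> : x * expR (- y) - x = x * (expR (- y) - 1) by ring.
    by rewrite normrM (gtr0_norm x0) ltr_pdivrMr// mulrC.
  set I := \1_ _ _.
  suff -> : hb y = x * expR (- y) / (x * expR (- y) - x) by ring.
  have E0 := expR_gt0 y; rewrite /hb expRN.
  have [->|y0] := eqVneq y 0; first by rewrite expR0 subrr invr1 mulr1 subrr invr0 mulr0.
  have e1 := expRB1_neq0 y0.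
  have e2 : 1 - expR y != 0 by rewrite -oppr_eq0 opprB.
  have -> : x / expR y - x = x * (1 - expR y) / expR y by field; rewrite gt_eqF.
  by field; rewrite e2 !gt_eqF.
have ik : rintegrable setT (fun y => \1_(far (e / x)) y * hb y * expR (c * y)).
  have s01 : 0 < Re (c%:C) < 1 by [].
  have [+ _] := cintegrable_far s01 ex0; apply: eq_integrable => // y _; congr EFin.
  have -> : c%:C * y%:C = (c * y)%:C :> R[i] by rewrite rmorphM.
  rewrite cexpR; by rewrite cReM/= mulr0 subr0.
have [h1 h2] := minv_kernel x0 mkappa ik cG kE.
have DE : D = @Rpos R `&` [set t : R | e < `|t - x|] by apply/seteqP; split.
have mD : measurable D by rewrite DE; apply: measurableI; [exact: mRpos|exact: mgap].
have E t : (\1_(@Rpos R) t)%:C * ((kappa t)%:C * minv G t) = (\1_D t)%:C * g t.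
  have -> : \1_D t = \1_(@Rpos R) t * \1_[set t | e < `|t - x|] t :> R by rewrite DE indicI.
  rewrite /kappa /g; move: (\1_Rpos t) (\1_[set t : R | e < `|t - x|] t) (_ `^ b) (minv G t) (t - x) => p q r m d.
  have -> : (q * d^-1 * r)%:C = q%:C * d%:C^-1 * r%:C :> R[i].
    by rewrite rmorphM rmorphM fmorphV.
  have -> : (p * q)%:C = p%:C * q%:C :> R[i] by rewrite rmorphM.
  by move: p%:C q%:C r%:C d%:C^-1 => {}p {}q {}r {}d; ring.
split.
  apply: (cintegrable_mkcond _ mD).2.
  apply: (eq_cintegrable measurableT (fun t _ => E t)).
  exact: (cintegrable_mkcond _ mRpos).1 h1.
transitivity (cintegral (@Rpos R) (fun t => (kappa t)%:C * minv G t)).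
  rewrite [LHS]cintegral_mkcond [RHS]cintegral_mkcond.
  by apply: eq_cintegral => t _; exact/esym/E.
by rewrite h2; apply: eq_minv => tau; rewrite four_line.
Qed.

Lemma cmeas_farint c e : 0 < c < 1 -> 0 < e -> cmeas setT (fun tau => farint e (c +i* tau)).
Proof.
move=> c01 e0.
have s01 : 0 < Re (c%:C) < 1 by [].
have ck := cintegrable_far s01 e0.
have := cmeas_four ck; congr (cmeas _ _); apply/funext => tau.
rewrite /four /farint; apply: eq_cintegral => y _.
have -> : c%:C = c +i* 0 :> R[i] by [].
by rewrite !cexp_line mul0r ce0 mulr1 mulrA [y * tau]mulrC.
Qed.

(** The dominated convergence behind the principal value: the truncated symbols
   grow at most like the power 1/4 of [tau], which the decay of [G] compensates. *)
Lemma pv_eval G b x : 0 < 2^-1 + b < 1 -> 0 < x -> cintegrable setT G ->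
  rintegrable setT (fun t => normc (G t) ^+ 2 * (1 + t ^+ 2)) ->
  is_pv x (fun t => ((x / t) `^ b)%:C * (minv G t / (t - x)%:C))
    (minv (fun tau => G tau * cauval ((2^-1 + b) +i* tau)) x).
Proof.
move=> c01 x0 cG iG; have mG := cintegrable_meas measurableT cG.
split=> [e e0|]; first exact: (cauchy_eval c01 x0 cG e0).1.
set g := fun t : R => _; set c := 2^-1 + b in c01 *.
have [K1 [K2 [K10 K20 Kb]]] := farint_bound c01.
have ik := rintegrable_w4_mul K10 K20 mG iG.
apply/cvg_at_rightP => u [u0 ucvg].
(* [farint_bound] requires relative distances at most 1/2, which [u n / x] satisfies
   from some rank on. *)
pose v n := Num.min (u n / x) 2^-1.
have v0 n : 0 < v n <= 2^-1 by rewrite /v lt_min (divr_gt0 (u0 n) x0) invr_gt0 ltr0n ge_min lexx orbT.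
have v0' n : 0 < v n by case/andP: (v0 n).
have uv : \forall n \near \oo, u n / x = v n.
  have h : 0 < x / 2 by rewrite divr_gt0.
  have /cvgrPdist_lt/(_ _ h) := ucvg; apply: filterS => n; rewrite sub0r normrN gtr0_norm//.
  move=> un; rewrite /v min_l// ler_pdivrMr//; lra.
have vcvg : v n @[n --> \oo] --> 0.
  have : u n / x @[n --> \oo] --> 0 / x by apply: cvgMl.
  rewrite mul0r; apply: cvg_trans; apply: near_eq_cvg.
  by apply: filterS uv => n ->.
pose K := ((2 * pi)^-1)%:C * (x `^ (- 2^-1))%:C : R[i].
have s01 tau : 0 < Re (c +i* tau) < 1 by [].
pose F_ n tau := G tau * farint (v n) (c +i* tau) * ce (tau * - ln x).
pose F0 tau := G tau * cauval (c +i* tau) * ce (tau * - ln x).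
have F_meas n : cmeas setT (F_ n).
  apply: cmeas_mulce; apply: cmeasM => //; exact: cmeas_farint.
have F_le n t : setT t -> normc (F_ n t) <= normc (G t) * (K1 + K2 * w4 t).
  by move=> _; rewrite !normcMl normc_ce mulr1 ler_wpM2l ?normc_ge0// Kb.
have F_cvg t : setT t -> normc (F_ n t - F0 t) @[n --> \oo] --> (0 : R).
  move=> _; under eq_fun do rewrite -mulrBl -mulrBr !normcMl normc_ce mulr1.
  by apply: cvgM0; exact: farint_cvg.
have [_ h] := cintegral_dct measurableT F_meas ik F_le F_cvg.
have {}h := cvgM0 (normc K) h.
apply: cvg_trans h; apply: near_eq_cvg; apply: filterS uv => n uvn.
have [_ ->] := cauchy_eval c01 x0 cG (u0 n).
by rewrite uvn /minv -/K -mulrBr [RHS]normcMl.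
Qed.

End mellin_kernels.

(** * The two symbols *)

Section symbols.
Context {R : realType}.
Local Notation mu := (@lebesgue_measure R).
Implicit Types (c p q r tau : R).

Definition symbol c p q r tau : R[i] :=
  p%:C * logval (c +i* tau) + q%:C * cauval (c +i* tau) + r%:C.

Lemma Eexp_line c tau :
  Eexp (c +i* tau) = ce (2 * pi * c) * (expR (- (2 * pi * tau)))%:C.
Proof.
rewrite /Eexp /ipi /ce -cexpR -cexpD; congr cexp.
by apply: complex_eq; rewrite mulr_natl mulr2n !reimE/=; ring.
Qed.

Lemma cmeas_Eexp c : cmeas setT (fun tau => Eexp (c +i* tau)).
Proof.
apply: cmeas_cexp; apply: cmeasM; first exact: cmeas_cst.
apply: cmeasM; first exact: cmeas_cst.
by split=> /=; [exact: measurable_cst|exact: measurable_id].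
Qed.

Lemma cmeas_logval c : cmeas setT (fun tau => logval (c +i* tau)).
Proof.
have mE := cmeas_Eexp c; apply: cmeasM; first exact: cmeas_cst.
apply: cmeasM => //; apply: cmeasV.
have mE1 := cmeasB mE (cmeas_cst setT 1).
by under eq_fun do rewrite expr2; exact: cmeasM.
Qed.

Lemma cmeas_cauval c : cmeas setT (fun tau => cauval (c +i* tau)).
Proof.
have mE := cmeas_Eexp c; apply: cmeasM; first exact: cmeas_cst.
apply: cmeasM; first by apply: cmeasD => //; exact: cmeas_cst.
by apply: cmeasV; apply: cmeasB => //; exact: cmeas_cst.
Qed.

Lemma cmeas_symbol c p q r : cmeas setT (symbol c p q r).
Proof.
apply: cmeasD; last exact: cmeas_cst.
apply: cmeasD; apply: cmeasM; do ?exact: cmeas_cst.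
  exact: cmeas_logval.
exact: cmeas_cauval.
Qed.

Lemma normc_logval_line c tau : 0 < c < 1 ->
  normc (logval (c +i* tau)) <= \int[mu]_y (kb y * expR (c * y)).
Proof.
move=> c01; have s01 : 0 < Re (c +i* tau) < 1 by [].
rewrite -logintE//; apply: le_normc_cintegral_dom => //.
- exact: cintegrable_meas (cintegrable_kb s01).
- exact: rintegrable_kb.
- by move=> y _; rewrite normc_kb_cexp.
Qed.

Lemma normc_cauval_line c tau : 0 < c < 1 ->
  normc (cauval (c +i* tau)) <=
    \int[mu]_y normc (cau_integrand c%:C y) + 2 * (\int[mu]_y kq c y) * w4 tau.
Proof.
move=> c01; have s01 : 0 < Re (c +i* tau) < 1 by [].
have inc : rintegrable setT (fun y => normc (cau_integrand c%:C y)).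
  by apply: cintegrable_normc => //; exact: cintegrable_cau.
have iq := rintegrable_kq c01.
rewrite -cauintE//.
have ik : rintegrable setT (fun y => normc (cau_integrand c%:C y) + 2 * w4 tau * kq c y).
  by apply: rintegrableD => //; exact: rintegrableZ.
have := le_normc_cintegral_dom measurableT
  (cintegrable_meas measurableT (cintegrable_cau s01)) ik
  (fun y _ => normc_cau_line c tau y).
rewrite RintegralD// ?RintegralZl//; last exact: rintegrableZ.
by rewrite [2 * w4 tau * _]mulrAC.
Qed.

(** Writing [w] for [exp (i a)] and [u] for [exp (- 2 pi tau)], the transform [Eexp]
   is [- u] on the line [Re s = 1/2] and [w^2 u] on the line [Re s = a / pi]. *)
Lemma symbol_factor (a c q tau : R) (e : R[i]) (w := ce a) (E := Eexp (c +i* tau)) :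
  e * e = 1 -> q%:C = e * (sin (2 * a) / pi)%:C -> E != 1 ->
  symbol c (cos a ^+ 2 / pi ^+ 2) q (- cos (2 * a)) tau =
  - ((w + w^-1) ^+ 2 * (E / (E - 1) ^+ 2))
  + e * ((w ^+ 2 - w ^- 2) / 2 * ((E + 1) / (E - 1))) - (w ^+ 2 + w ^- 2) / 2.
Proof.
move=> ee qE E1; have pi0 : pi != 0 :> R by rewrite gt_eqF ?pi_gt0.
have two0 : 2 != 0 :> R[i] by rewrite pnatr_eq0.
have wV (x : R) : (ce x)^-1 = ce (- x).
  by rewrite /ce -cexpN; congr cexp; apply: complex_eq; rewrite /= ?oppr0.
have w2 : w ^+ 2 = ce (2 * a) by rewrite expr2 /w -ceD; congr ce; ring.
have C2 : (w ^+ 2 + w ^- 2) / 2 = (cos (2 * a))%:C.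
  rewrite w2 wV; apply: (mulIf two0); rewrite mulfVK// !ceE cosN sinN mulr_natr mulr2n.
  by apply: complex_eq; rewrite !reimE/=; ring.
have S2 : (w ^+ 2 - w ^- 2) / 2 = (sin (2 * a))%:C * 'i%C.
  rewrite w2 wV; apply: (mulIf two0); rewrite mulfVK// !ceE cosN sinN mulr_natr mulr2n.
  by apply: complex_eq; rewrite !reimE/=; ring.
have C1 : (w + w^-1) ^+ 2 = (4 * cos a ^+ 2)%:C.
  rewrite /w wV !ceE cosN sinN expr2.
  by apply: complex_eq; rewrite !reimE/=; ring.
rewrite C2 S2 C1 /symbol qE /logval /cauval -/E.
have -> : (pi *i) = pi%:C * 'i%C :> R[i] by apply: complex_eq; rewrite !reimE/=; ring.
have -> : (4 * cos a ^+ 2)%:C = (cos a ^+ 2 / pi ^+ 2)%:C * (4 * pi ^+ 2)%:C :> R[i].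
  have {1}-> : 4 * cos a ^+ 2 = cos a ^+ 2 / pi ^+ 2 * (4 * pi ^+ 2).
    by rewrite [RHS]mulrCA divfK// expf_neq0.
  by rewrite rmorphM.
have -> : (sin (2 * a))%:C = (sin (2 * a) / pi)%:C * pi%:C :> R[i].
  have {1}-> : sin (2 * a) = sin (2 * a) / pi * pi by rewrite divfK.
  by rewrite rmorphM.
have -> : (- cos (2 * a))%:C = - (cos (2 * a))%:C :> R[i] by rewrite rmorphN.
move: (E / _) ((E + 1) / _) => X Y.
move: (_ / pi ^+ 2)%:C (4 * _)%:C (sin _ / pi)%:C pi%:C (cos _)%:C 'i%C => p1 p2 p3 p4 p5 p6.
ring.
Qed.

Variables (alpha : R) (alpha01 : 0 < alpha < 1).
Let a := pi * alpha.
Let w : R[i] := ce a.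
Let u tau : R := expR (- (2 * pi * tau)).

Definition symbolA := symbol 2^-1 (cos a ^+ 2 / pi ^+ 2) (- (sin (2 * a) / pi)) (- cos (2 * a)).
Definition symbolB := symbol alpha (cos a ^+ 2 / pi ^+ 2) (sin (2 * a) / pi) (- cos (2 * a)).

Let u0 tau : 0 < u tau. Proof. exact: expR_gt0. Qed.

Let w0 : w != 0. Proof. exact: cexp_neq0. Qed.

Let u1 tau : 1 + (u tau)%:C != 0 :> R[i].
Proof.
have -> : 1 + (u tau)%:C = (1 + u tau)%:C :> R[i] by rewrite rmorphD.
by rewrite -normc_eq0 normcR normr_eq0 gt_eqF// addr_gt0.
Qed.

Let Ehalf tau : Eexp (2^-1 +i* tau) = - (u tau)%:C.
Proof.
rewrite Eexp_line (_ : 2 * pi * 2^-1 = pi); last by rewrite mulrAC mulfV ?mul1r// pnatr_eq0.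
by rewrite /ce cexp_ipi mulN1r.
Qed.

Let Ealpha tau : Eexp (alpha +i* tau) = w ^+ 2 * (u tau)%:C.
Proof. by rewrite Eexp_line expr2 /w -ceD; congr (ce _ * _); rewrite /a; ring. Qed.

Let Ealpha1 tau : w ^+ 2 * (u tau)%:C - 1 != 0.
Proof. by rewrite subr_eq0 -Ealpha Eexp_neq1. Qed.

(** Reduced to a common denominator, the sum has, up to sign, a perfect square as
   numerator. *)
Lemma symbolAE tau :
  symbolA tau = - (w ^+ 2 * (u tau)%:C - 1) ^+ 2 / (w ^+ 2 * (1 + (u tau)%:C) ^+ 2).
Proof.
have [h0 h1] := (w0, u1 tau).
rewrite /symbolA (@symbol_factor a _ _ _ (-1)) ?mulN1r ?opprK//; last 2 first.
- by rewrite rmorphN.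
- rewrite Ehalf -subr_eq0 -opprD oppr_eq0 addrC; exact: u1.
rewrite -/w Ehalf; move: (u tau)%:C w h0 h1 => U W h0 h1.
have h2 : - U - 1 != 0 by rewrite -opprD oppr_eq0 addrC.
by field; rewrite h0 h1 h2.
Qed.

Lemma symbolBE tau :
  symbolB tau = - (w ^+ 2 * (1 + (u tau)%:C) ^+ 2) / (w ^+ 2 * (u tau)%:C - 1) ^+ 2.
Proof.
have [h0 h1] := (w0, Ealpha1 tau).
rewrite /symbolB (@symbol_factor a _ _ _ 1) ?mul1r//; last by rewrite Eexp_neq1.
rewrite -/w Ealpha; move: (u tau)%:C w h0 h1 => U W h0 h1.
by field; rewrite h0 h1.
Qed.

Lemma symbolAB tau : symbolA tau * symbolB tau = 1.
Proof.
have [h0 h1 h2] := And3 w0 (Ealpha1 tau) (u1 tau).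
rewrite symbolAE symbolBE; move: (u tau)%:C w h0 h1 h2 => U W h0 h1 h2.
by field; rewrite h0 h1 h2.
Qed.

(** The triangle inequality [|w^2 u - 1| <= 1 + u]. *)
Lemma normc_symbolA tau : normc (symbolA tau) <= 1.
Proof.
have nw : normc w = 1 by exact: normc_ce.
have nu : normc (1 + (u tau)%:C) = 1 + u tau.
  have -> : 1 + (u tau)%:C = (1 + u tau)%:C :> R[i] by rewrite rmorphD.
  by rewrite normcR gtr0_norm// addr_gt0.
have n1 : normc (w ^+ 2 * (u tau)%:C - 1) <= 1 + u tau.
  rewrite (le_trans (le_normc_sub _ _))// expr2 !normcMl nw !mul1r normcR gtr0_norm//.
  by rewrite ComplexField.Normc.normc1 addrC.
rewrite symbolAE normcMl normc_opp normc_inv.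
move: n1; set X := _ - 1; rewrite [X ^+ 2]expr2 [w ^+ 2]expr2 [(1 + _) ^+ 2]expr2 !normcMl nw nu.
move=> n1; have d0 : 0 < 1 + u tau by rewrite addr_gt0.
rewrite !mul1r ler_pdivrMr ?mulr_gt0// mul1r.
by apply: ler_pM => //; exact: normc_ge0.
Qed.

Let sin_a : 0 < sin a.
Proof.
have /andP[a0 a1] := alpha01; apply: sin_gt0_pi.
by rewrite /a mulr_gt0 ?pi_gt0//= gtr_pMr// pi_gt0.
Qed.

(** The zero of [w^2 u - 1] is on the line [u > 0] only for an integer [alpha]. *)
Lemma normc_symbolB tau : normc (symbolB tau) <= (sin a ^+ 2)^-1.
Proof.
have nw : normc w = 1 by exact: normc_ce.
have d0 : 0 < 1 + u tau by rewrite addr_gt0.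
have nu : normc (1 + (u tau)%:C) = 1 + u tau.
  have -> : 1 + (u tau)%:C = (1 + u tau)%:C :> R[i] by rewrite rmorphD.
  by rewrite normcR gtr0_norm.
(* [|w^2 u - 1|^2 = (1 - u)^2 + 4 u sin^2 a] and [4 u = (1 + u)^2 - (1 - u)^2]. *)
have low : sin a ^+ 2 * (1 + u tau) ^+ 2 <= normc (w ^+ 2 * (u tau)%:C - 1) ^+ 2.
  have -> : w ^+ 2 * (u tau)%:C - 1 =
      ((cos a ^+ 2 - sin a ^+ 2) * u tau - 1) +i* (2 * (sin a * cos a) * u tau).
    by rewrite /w ceE; apply: complex_eq; rewrite expr2 !reimE/=; ring.
  rewrite sqr_normc2/=; have := cos2Dsin2 a; have := u0 tau; have := sqr_ge0 (1 - u tau).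
  move: (sin a) (cos a) (u tau) => s c v v1 v0 cs.
  have c2 : c ^+ 2 = 1 - s ^+ 2 by rewrite -cs addrK.
  have -> : ((c ^+ 2 - s ^+ 2) * v - 1) ^+ 2 + (2 * (s * c) * v) ^+ 2 =
    (1 - v) ^+ 2 + 4 * s ^+ 2 * v.
    have -> : (2 * (s * c) * v) ^+ 2 = 4 * s ^+ 2 * c ^+ 2 * v ^+ 2 by ring.
    by rewrite c2; ring.
  have c0 : 0 <= 1 - s ^+ 2 by rewrite -c2 sqr_ge0.
  have := mulr_ge0 c0 v1; nra.
have X0 : 0 < normc (w ^+ 2 * (u tau)%:C - 1) ^+ 2.
  by apply: lt_le_trans low; rewrite mulr_gt0// exprn_gt0.
rewrite symbolBE normcMl normc_opp normc_inv.
have -> : normc ((w ^+ 2 * (u tau)%:C - 1) ^+ 2) = normc (w ^+ 2 * (u tau)%:C - 1) ^+ 2.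
  by rewrite expr2 normcMl.
have -> : normc (w ^+ 2 * (1 + (u tau)%:C) ^+ 2) = (1 + u tau) ^+ 2.
  by rewrite !expr2 !normcMl nw nu !mul1r.
rewrite ler_pdivrMr// ler_pdivlMl ?exprn_gt0//.
Qed.

End symbols.

(** * The equations in terms of the symbols *)

Section equations.
Context {R : realType}.
Local Notation mu := (@lebesgue_measure R).
Implicit Types (G H : R -> R[i]) (f h : R -> R[i]) (b x : R).

(** The condition [s G] in [L_2], since [|s|^2 = 1/4 + tau^2] is comparable with
   [1 + tau^2]. *)
Definition decaying G : Prop :=
  cmeas setT G /\ rintegrable setT (fun t => normc (G t) ^+ 2 * (1 + t ^+ 2)).

Lemma decaying_sq G : decaying G -> sq_integrable G.
Proof.
move=> [mG iG]; split=> //; apply: (rintegrable_le measurableT _ iG); first exact: cmeas_sqr_normc.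
move=> t _; rewrite ger0_norm ?sqr_ge0// ler_peMr ?sqr_ge0// lerDl sqr_ge0//.
Qed.

Lemma decaying_w4 G (K1 K2 : R) : decaying G -> 0 <= K1 -> 0 <= K2 ->
  rintegrable setT (fun t => normc (G t) * (K1 + K2 * w4 t)).
Proof. by move=> [mG iG] K10 K20; exact: rintegrable_w4_mul. Qed.

Lemma decaying_integrable G : decaying G -> cintegrable setT G.
Proof.
move=> dG; have := decaying_w4 dG ler01 (lexx 0).
move=> i; apply: (cintegrable_le measurableT _ i); first by case: dG.
by move=> t _; rewrite mul0r addr0 mulr1.
Qed.

(** Bounded multipliers preserve the class. *)
Lemma decayingM G H (K : R) : decaying G -> cmeas setT H ->
  (forall t, normc (H t) <= K) -> decaying (fun t => G t * H t).
Proof.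
move=> [mG iG] mH HK; split; first exact: cmeasM.
have K0 : 0 <= K by rewrite (le_trans (normc_ge0 (H 0))).
apply: (@rintegrable_le _ _ _ (fun t => K ^+ 2 * (normc (G t) ^+ 2 * (1 + t ^+ 2)))) => //.
- apply: measurable_funM; first by apply: cmeas_sqr_normc; exact: cmeasM.
  by apply: measurable_funD => //; exact: measurable_funX.
- exact: rintegrableZ.
move=> t _; have d0 : 0 <= 1 + t ^+ 2 by rewrite addr_ge0 ?sqr_ge0.
rewrite ger0_norm; last by rewrite mulr_ge0 ?sqr_ge0.
rewrite mulrA ler_wpM2r// normcMl exprMn mulrC ler_wpM2r ?sqr_ge0//.
by rewrite ler_pXn2r ?nnegrE ?normc_ge0.
Qed.

Lemma decayingB G H : decaying G -> decaying H -> decaying (fun t => G t - H t).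
Proof.
move=> [mG iG] [mH iH]; split; first exact: cmeasB.
apply: (@rintegrable_le _ _ _ (fun t => 2 * (normc (G t) ^+ 2 * (1 + t ^+ 2)) +
    2 * (normc (H t) ^+ 2 * (1 + t ^+ 2)))) => //.
- apply: measurable_funM; first by apply: cmeas_sqr_normc; exact: cmeasB.
  by apply: measurable_funD => //; exact: measurable_funX.
- by apply: rintegrableD => //; exact: rintegrableZ.
move=> t _; have d0 : 0 <= 1 + t ^+ 2 by rewrite addr_ge0 ?sqr_ge0.
rewrite ger0_norm; last by rewrite mulr_ge0 ?sqr_ge0.
have := ler_wpM2r d0 (normc_sub_sqr_le (G t) (H t)); rewrite [X in _ <= X]mulrDl.
by rewrite -![2 * _ ^+ 2 * _]mulrA.
Qed.

Lemma minvZ G x (z : R[i]) : cintegrable setT G ->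
  minv (fun t => G t * z) x = z * minv G x.
Proof.
move=> cG; rewrite /minv mulrCA; congr (_ * _); rewrite /four -cintegralZ//.
  by apply: eq_cintegral => t _; ring.
exact: cintegrable_mulce.
Qed.

Lemma minvD G H x : cintegrable setT G -> cintegrable setT H ->
  minv (fun t => G t + H t) x = minv G x + minv H x.
Proof.
move=> cG cH; rewrite /minv -mulrDr; congr (_ * _); rewrite /four -cintegralD//.
- by apply: eq_cintegral => t _; rewrite mulrDl.
- exact: cintegrable_mulce.
- exact: cintegrable_mulce.
Qed.

Lemma minvB G H x : cintegrable setT G -> cintegrable setT H ->
  minv (fun t => G t - H t) x = minv G x - minv H x.
Proof.
move=> cG cH; rewrite (eq_minv _ (H := fun t => G t + H t * -1)); last first.
  by move=> t; rewrite mulrN1.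
rewrite minvD//; first by rewrite minvZ// mulN1r.
have := cintegrableN measurableT cH; apply: eq_cintegrable => // t _.
by rewrite mulrN1.
Qed.

Lemma is_pv_unique x g (v v' : R[i]) : is_pv x g v -> is_pv x g v' -> v = v'.
Proof. by move=> [_ h] [_ h']; exact: normc_cvg_unique h h'. Qed.

Lemma eq_is_pv x g g' (v : R[i]) : (forall t, 0 < t -> g t = g' t) ->
  is_pv x g v -> is_pv x g' v.
Proof.
move=> gg' [ig cg]; have mD e : measurable [set t : R | 0 < t /\ e < `|t - x|].
  apply: measurableI; first exact: mRpos.
  have m : measurable_fun setT (fun t : R => `|t - x|).
    by apply: measurableT_comp => //; exact: measurable_funB.
  have := m measurableT _ (measurable_itv `]e, +oo[); rewrite setTI.
  by congr measurable; apply/seteqP; split=> y /=; rewrite in_itv/= andbT.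
have E e t : [set t : R | 0 < t /\ e < `|t - x|] t -> g t = g' t by move=> [/gg'].
split=> [e e0|].
  by apply: eq_cintegrable (E e) _ => //; exact: ig.
by under eq_fun => e do rewrite -(eq_cintegral (E e)).
Qed.

Lemma cintegrable_logval G b : 0 < 2^-1 + b < 1 -> decaying G ->
  cintegrable setT (fun tau => G tau * logval ((2^-1 + b) +i* tau)).
Proof.
move=> c01 dG; apply: decaying_integrable; apply: decayingM => //.
  exact: cmeas_logval.
by move=> t; exact: normc_logval_line.
Qed.

Lemma cintegrable_cauval G b : 0 < 2^-1 + b < 1 -> decaying G ->
  cintegrable setT (fun tau => G tau * cauval ((2^-1 + b) +i* tau)).
Proof.
move=> c01 dG; set c := _ + b in c01 *.
have K10 : 0 <= \int[mu]_y normc (cau_integrand c%:C y).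
  by apply: Rintegral_ge0 => y _; exact: normc_ge0.
have K20 : 0 <= 2 * (\int[mu]_y kq c y).
  by rewrite mulr_ge0//; apply: Rintegral_ge0 => y _; exact: kq_ge0.
apply: (cintegrable_le measurableT _ (decaying_w4 dG K10 K20)).
  by apply: cmeasM; [case: dG|exact: cmeas_cauval].
by move=> t _; rewrite normcMl ler_wpM2l ?normc_ge0// normc_cauval_line.
Qed.

(** In the Mellin transform, the operator of either equation is multiplication
   by its symbol. *)
Lemma operator_eval b x (p q r : R) f G (v : R[i]) : 0 < 2^-1 + b < 1 -> 0 < x ->
  decaying G -> (forall t, 0 < t -> f t = minv G t) ->
  (exists I J : R[i],
    [/\ is_cintegral (@Rpos R) (fun t => (logker x t)%:C * ((x / t) `^ b)%:C * f t) I,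
        is_pv x (fun t => ((x / t) `^ b)%:C * (f t / (t - x)%:C)) J &
        p%:C * I + q%:C * J + r%:C * f x = v]) <->
  v = minv (fun tau => G tau * symbol (2^-1 + b) p q r tau) x.
Proof.
move=> c01 x0 dG fE; have cG := decaying_integrable dG.
pose I0 := minv (fun tau => G tau * logval ((2^-1 + b) +i* tau)) x.
pose J0 := minv (fun tau => G tau * cauval ((2^-1 + b) +i* tau)) x.
have [l1 l2] := logker_eval c01 x0 cG.
have hI : is_cintegral (@Rpos R) (fun t => (logker x t)%:C * ((x / t) `^ b)%:C * f t) I0.
  have E t : @Rpos R t -> (logker x t)%:C * ((x / t) `^ b)%:C * minv G t =
    (logker x t)%:C * ((x / t) `^ b)%:C * f t by move=> t0; rewrite fE.
  split; first by apply: eq_cintegrable E l1; exact: mRpos.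
  by rewrite -(eq_cintegral E).
have hJ : is_pv x (fun t => ((x / t) `^ b)%:C * (f t / (t - x)%:C)) J0.
  have := pv_eval c01 x0 cG dG.2; apply: eq_is_pv => t t0.
  by rewrite fE.
have value : p%:C * I0 + q%:C * J0 + r%:C * f x =
    minv (fun tau => G tau * symbol (2^-1 + b) p q r tau) x.
  have i1 := cintegrable_logval c01 dG; have i2 := cintegrable_cauval c01 dG.
  have iZ (H : R -> R[i]) (z : R[i]) : cintegrable setT H ->
      cintegrable setT (fun t => H t * z).
    move=> cH; have := cintegrableZ z measurableT cH.
    by apply: eq_cintegrable => // t _; rewrite mulrC.
  rewrite fE// /I0 /J0 -!minvZ// -!minvD//; do ?exact: iZ.
    by apply: eq_minv => t; rewrite /symbol; ring.
  by apply: cintegrableD => //; exact: iZ.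
split=> [[I [J [[_ <-] hJ' <-]]]|->]; last by exists I0, J0.
by rewrite -value (is_pv_unique hJ' hJ) hI.2.
Qed.

(** The case [b = 0]. *)
Lemma equationA_symbol (alpha : R) f h G : decaying G ->
  (forall t, 0 < t -> f t = minv G t) ->
  equationA alpha f h <->
  (forall x, 0 < x -> h x = minv (fun tau => G tau * symbolA alpha tau) x).
Proof.
move=> dG fE.
have c01 : 0 < 2^-1 + (0 : R) < 1 by apply/andP; split; lra.
have key x (x0 : 0 < x) := @operator_eval 0 x (cos (pi * alpha) ^+ 2 / pi ^+ 2)
  (- (sin (2 * (pi * alpha)) / pi)) (- cos (2 * (pi * alpha))) f G (h x) c01 x0 dG fE.
have NC (z : R) : (- z)%:C = - z%:C :> R[i] by rewrite rmorphN.
have P1 x : (fun t => (logker x t)%:C * ((x / t) `^ 0)%:C * f t) =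
    (fun t => (logker x t)%:C * f t).
  by apply/funext => t; rewrite powRr0 mulr1.
have P2 x : (fun t => ((x / t) `^ 0)%:C * (f t / (t - x)%:C)) =
    (fun t => f t / (t - x)%:C).
  by apply/funext => t; rewrite powRr0 mul1r.
split=> eqA x x0.
  have := (key x x0).1; rewrite addr0; apply; have [I [J [hI hJ hh]]] := eqA x x0.
  exists I, J; rewrite P1 P2; split=> //.
  by rewrite !NC !mulNr mulrA.
have := (key x x0).2; rewrite addr0 => /(_ (eqA x x0)) [I [J []]].
rewrite P1 P2 !NC !mulNr mulrA => hI hJ hh.
by exists I, J.
Qed.

(** The case [b = alpha - 1/2], for which [1/2 + b = alpha]. *)
Lemma equationB_symbol (alpha : R) f h G : 0 < alpha < 1 -> decaying G ->
  (forall t, 0 < t -> h t = minv G t) ->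
  equationB alpha f h <->
  (forall x, 0 < x -> f x = minv (fun tau => G tau * symbolB alpha tau) x).
Proof.
move=> a01 dG hE.
have cE : 2^-1 + (alpha - 2^-1) = alpha by ring.
have c01 : 0 < 2^-1 + (alpha - 2^-1) < 1 by rewrite cE.
have key x (x0 : 0 < x) := @operator_eval (alpha - 2^-1) x (cos (pi * alpha) ^+ 2 / pi ^+ 2)
  (sin (2 * (pi * alpha)) / pi) (- cos (2 * (pi * alpha))) h G (f x) c01 x0 dG hE.
have NC (z : R) : (- z)%:C = - z%:C :> R[i] by rewrite rmorphN.
split=> eqB x x0.
  have := (key x x0).1; rewrite cE; apply; have [I [J [hI hJ hh]]] := eqB x x0.
  exists I, J; split=> //.
  by rewrite hh NC !mulNr [2 * (pi * alpha)]mulrA.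
have := (key x x0).2; rewrite cE => /(_ (eqB x x0)) [I [J []]].
rewrite !NC !mulNr [2 * (pi * alpha)]mulrA => hI hJ hh.
by exists I, J.
Qed.

End equations.

(** * The class of functions *)

Section mellin_class.
Context {R : realType}.
Local Notation mu := (@lebesgue_measure R).
Implicit Types (G H : R -> R[i]) (f h : R -> R[i]) (x y tau : R).

Lemma in_L2T f : in_L2 setT f <-> sq_integrable f.
Proof.
split=> [[m1 m2 L2]|[[m1 m2] i]].
  have mf : cmeas setT f by [].
  split=> //; apply/integrableP; split; first exact/measurable_EFinP/cmeas_sqr_normc.
  under eq_integral do rewrite gee0_abs ?lee_fin ?sqr_ge0//.
  exact: L2.
by split=> //; exact: (@integrable_lty _ _ _ mu setT measurableT _ i).
Qed.

Lemma normc_sigmaM tau (z : R[i]) :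
  normc (sigma tau * z) ^+ 2 = (4^-1 + tau ^+ 2) * normc z ^+ 2.
Proof.
rewrite normcMl exprMn (sqr_normc2 (sigma tau)) /sigma /=.
by rewrite [2^-1 ^+ 2]expr2 -invfM -natrM.
Qed.

(** The equations see a function of the class only through the restriction of its
   transform to the line, on which the inversion integral converges absolutely. *)
Lemma mellin_class_decaying f : mellin_class f ->
  exists G, decaying G /\ forall x, 0 < x -> f x = minv G x.
Proof.
move=> [_ [F [[F2 _] sF2 fE]]].
have dG : decaying (fun tau => F (sigma tau)).
  have /in_L2T[mF iF] := F2; have /in_L2T[_ isF] := sF2.
  split=> //; apply: (rintegrable_le measurableT _ (rintegrableZ 4 measurableT isF)).
    apply: measurable_funM; first exact: cmeas_sqr_normc.
    by apply: measurable_funD => //; exact: measurable_funX.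
  move=> t _; rewrite ger0_norm; last by rewrite mulr_ge0 ?sqr_ge0// addr_ge0 ?sqr_ge0.
  rewrite normc_sigmaM mulrA mulrC ler_wpM2r ?sqr_ge0//.
  by have := sqr_ge0 t; lra.
exists (fun tau => F (sigma tau)); split=> // x x0.
by rewrite fE// mellin_invE//; exact: decaying_integrable.
Qed.

Lemma sqn_opp G : sq_integrable G ->
  sq_integrable (fun t => G (- t)) /\ sqn (fun t => G (- t)) = sqn G.
Proof.
move=> [mG iG]; have mn := cmeas_sqr_normc mG; split; first split.
- by apply: (cmeas_comp mG); exact: oppr_measurable.
- have := (rintegrable_subst (subst_opp (R := R)) mn).1 iG.
  by under eq_fun do rewrite mul1r.
- rewrite /sqn [RHS](rintegral_subst (subst_opp (R := R)))//.
  by apply: eq_Rintegral => t _; rewrite mul1r.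
Qed.

Variables (G : R -> R[i]) (dG : decaying G).

Let cG := decaying_integrable dG.
Let G2 := decaying_sq dG.

(** The inverse Mellin transform in the variable [ln t], normalized so as to be
   square integrable with respect to [dy]. *)
Let phi y : R[i] := ((2 * pi)^-1)%:C * four G (- y).

Let minv_exp y : minv G (expR y) = (expR (- (2^-1 * y)))%:C * phi y.
Proof.
rewrite /minv /phi expRK -expRM mulrN [y * _]mulrC; ring.
Qed.

Let phi2 : sq_integrable phi /\ 2 * pi * sqn phi = sqn G.
Proof.
have p0 : 2 * pi != 0 :> R by rewrite mulf_neq0// gt_eqF// pi_gt0.
have [F2 _] := bessel cG G2; have [N2 Ne] := sqn_opp F2.
have E y : normc (phi y) ^+ 2 = (2 * pi)^-1 ^+ 2 * normc (four G (- y)) ^+ 2.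
  by rewrite normcMl normcR exprMn; congr (_ * _); exact: (real_normK (num_real _)).
have iN : rintegrable setT (fun y => normc (four G (- y)) ^+ 2) by case: N2.
split.
  split; first by apply: cmeasM; [exact: cmeas_cst|case: N2].
  by under eq_fun do rewrite E; exact: rintegrableZ.
rewrite /sqn; under eq_Rintegral do rewrite E.
rewrite RintegralZl; [|by []|exact: iN].
rewrite -[\int[_]_t _]/(sqn (fun y => four G (- y))) -[RHS]/(sqn G) Ne (plancherel cG G2).
by move: (2 * pi) (sqn G) p0 => p q p0; field.
Qed.

Let in_L2_minv : in_L2 (@Rpos R) (minv G).
Proof.
have mf := cmeas_minv cG; case: (mf) => m1 m2; split=> //.
apply: (@integrable_lty _ _ _ mu _ mRpos).
apply/(rintegrable_subst subst_exp); first exact: cmeas_sqr_normc.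
have [[_ i] _] := phi2; apply: eq_integrable i => // y _; congr EFin.
rewrite minv_exp normcMl normcR ger0_norm ?expR_ge0// exprMn mulrA.
have -> : expR y * expR (- (2^-1 * y)) ^+ 2 = 1 :> R; last by rewrite mul1r.
by rewrite expr2 -!expRD -[RHS]expR0; congr expR; field.
Qed.

Let phiA (A y : R) : R[i] := (\1_(`[- A, A]%classic : set R) y)%:C * phi y.

Let mellin_trunc_four (a tau : R) : 0 < a ->
  mellin_trunc (minv G) a (sigma tau) = four (phiA (ln a)) tau.
Proof.
move=> a0; rewrite /mellin_trunc.
have cpowE t : cpow t (sigma tau - 1) = (t `^ (2^-1 - 1))%:C * ce (tau * ln t).
  by rewrite /cpow ceE /= subr0.
pose I : set R := `[a^-1, a]%classic.
pose g t := minv G t * cpow t (sigma tau - 1).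
have mg : cmeas (@Rpos R) g.
  apply: cmeasM; first exact: cmeas_minv.
  rewrite (_ : cpow^~ _ = fun t => (t `^ (2^-1 - 1))%:C * ce (tau * ln t)).
    apply: cmeasM.
      by apply: cmeas_real; apply: measurable_funTS; exact: measurable_powR.
    apply: cmeas_ce; apply: measurable_funM => //.
    by apply: measurable_funTS; exact: measurable_ln.
  by apply/funext => t; exact: cpowE.
have mI : cmeas (@Rpos R) (fun t => (\1_I t)%:C * g t).
  apply: cmeasM => //; apply: cmeas_real; apply: measurable_indic.
  exact: measurable_itv.
transitivity (cintegral (@Rpos R) (fun t => (\1_I t)%:C * g t)).
  rewrite [LHS]cintegral_mkcond [RHS]cintegral_mkcond; apply: eq_cintegral => t _.
  rewrite indic_Rpos; have [t0|t0] := ltP 0 t; first by rewrite mul1r.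
  rewrite indicE memNset ?mul0r//= in_itv/=; apply/negP; rewrite negb_and -ltNge.
  by rewrite (le_lt_trans t0)// invr_gt0.
rewrite (cintegral_subst subst_exp mI); apply: eq_cintegral => y _.
have -> : \1_I (expR y) = \1_(`[- ln a, ln a]%classic : set R) y :> R.
  rewrite !indicE !mem_setE !in_itv/= -[X in (X <= expR y)%R]lnK ?posrE ?invr_gt0//.
  by rewrite -[X in (expR y <= X)%R]lnK ?posrE// !ler_expR lnV ?posrE.
rewrite /g cpowE minv_exp expRK -expRM /phiA.
have e1 : expR y * expR (- (2^-1 * y)) * expR (y * (2^-1 - 1)) = 1 :> R.
  by rewrite -!expRD -[RHS]expR0; congr expR; field.
have E1 : (expR y)%:C * (expR (- (2^-1 * y)))%:C * (expR (y * (2^-1 - 1)))%:C = 1 :> R[i].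
  transitivity ((expR y * expR (- (2^-1 * y)) * expR (y * (2^-1 - 1)))%:C : R[i]).
    by rewrite !rmorphM.
  by rewrite e1.
rewrite [y * tau]mulrC; move: (\1_(`[- ln a, ln a]%classic : set R) y)%:C E1 => p1.
move: (expR y)%:C (expR (- _))%:C (expR _)%:C (phi y) (ce _) => p2 p3 p4 p5 p6 E1.
by rewrite -[RHS]mul1r -E1; ring.
Qed.

Let phi_tail (u : nat -> R) : u n @[n --> \oo] --> +oo ->
  sqn G - 2 * pi * \int[mu]_(y in `[- ln (u n), ln (u n)]) normc (phi y) ^+ 2
    @[n --> \oo] --> (0 : R).
Proof.
move=> ucvg; have [[mphi iphi] <-] := phi2.
pose h_ n y : R := \1_(`[- ln (u n), ln (u n)]%classic : set R) y * normc (phi y) ^+ 2.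
have mh n : measurable_fun setT (h_ n).
  by apply: measurable_funM; [exact: measurable_indic|exact: cmeas_sqr_normc].
have h_le n y : setT y -> `|h_ n y| <= normc (phi y) ^+ 2.
  move=> _; rewrite /h_ indicE; case: (_ \in _).
    by rewrite mul1r ger0_norm ?sqr_ge0.
  by rewrite mul0r normr0 sqr_ge0.
have h_cvg y : setT y -> h_ n y @[n --> \oo] --> normc (phi y) ^+ 2.
  move=> _; have /cvgryPge/(_ (expR `|y|)) uy := ucvg.
  apply/cvgrPdist_lt => d d0; apply: filterS uy => n un.
  have yn : `|y| <= ln (u n) by rewrite -[leLHS]expRK ler_ln ?posrE ?expR_gt0// (lt_le_trans _ un)// expR_gt0.
  by rewrite /h_ indicE mem_set ?mul1r ?subrr ?normr0//= in_itv/= -ler_norml.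
have [_ h] := rintegral_dct measurableT mh iphi h_le h_cvg.
have h' : sqn phi - \int[mu]_t h_ n t @[n --> \oo] --> (0 : R).
  by rewrite -(subrr (sqn phi)); apply: cvgB => //; exact: cvg_cst.
have := cvgM0 (2 * pi) h'; apply: cvg_trans; apply: near_eq_cvg; near=> n.
by rewrite [in RHS]rintegral_mkcond -/(h_ n) mulrBr.
Unshelve. all: by end_near.
Qed.

(** The inverse transform of [G] is square integrable by Plancherel's theorem, and
   the inversion theorem recovers [G] from it. *)
Lemma mellin_class_minv : mellin_class (minv G).
Proof.
split; first exact: in_L2_minv.
pose F (s : R[i]) := G (Im s).
have F2 : in_L2sigma F by apply/in_L2T; exact: G2.
have sF2 : in_L2sigma (fun s => s * F s).
  apply/in_L2T; have [mG iG] := dG.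
  have ms : cmeas setT (@sigma R) by split=> /=; [exact: measurable_cst|exact: measurable_id].
  have msF : cmeas setT (fun tau => sigma tau * F (sigma tau)) by exact: cmeasM.
  split=> //; apply: (rintegrable_le measurableT (cmeas_sqr_normc msF) iG) => t _.
  rewrite ger0_norm ?sqr_ge0// normc_sigmaM mulrC ler_wpM2l ?sqr_ge0// lerD2r; lra.
exists F; split=> //; last by move=> x x0; rewrite mellin_invE.
split=> //; apply/cvge_pinftyP => u ucvg.
pose s n := sqn (fun t => G t - four (phiA (ln (u n))) t).
have s_cvg : s n @[n --> \oo] --> (0 : R).
  apply: (squeeze_cvgr _ (cvg_cst _) (phi_tail ucvg)); near=> n; rewrite sqn_ge0/=.
  by have [_] := four_inversion (ln (u n)) cG G2.
have : (s n)%:E @[n --> \oo] --> (0 : R)%:E by apply: cvg_EFin; [near=> n|exact: s_cvg].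
apply: cvg_trans; apply: near_eq_cvg.
have /cvgryPge/(_ 1) := ucvg; apply: filterS => n un.
have u0 : 0 < u n by apply: lt_le_trans un.
have [D2 _] := four_inversion (ln (u n)) cG G2.
rewrite /s -(sqnE D2) /sqnorm; apply: eq_integral => t _.
by rewrite (mellin_trunc_four _ u0).
Unshelve. all: by end_near.
Qed.

End mellin_class.

(** * Uniqueness and reciprocity *)

Section reciprocity.
Context {R : realType}.
Local Notation mu := (@lebesgue_measure R).
Implicit Types (G H K v M N : R -> R[i]) (f h g : R -> R[i]) (x y : R).

(** A null function remains null after multiplication by any function, even an
   unbounded one. *)
Lemma sqn_eq0_integral K v : sq_integrable K -> sqn K = 0 -> cmeas setT v ->
  cintegral setT (fun t => K t * v t) = 0.
Proof.
move=> K2 K0 mv; have [mK iK] := K2.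
have mKv : cmeas setT (fun t => K t * v t) by exact: cmeasM.
have K2m : measurable_fun setT (fun t => (normc (K t) ^+ 2)%:E).
  exact/measurable_EFinP/cmeas_sqr_normc.
have ae0 : ae_eq mu setT (fun t => (normc (K t) ^+ 2)%:E) (cst 0%E).
  apply/(@ae_eq_integral_abs _ _ _ mu setT measurableT _ K2m).
  under eq_integral do rewrite gee0_abs ?lee_fin ?sqr_ge0//.
  by rewrite (sqnE K2) K0.
have aeKv (p : R[i] -> R) : p 0 = 0 ->
    ae_eq mu setT (fun t => (p (K t * v t))%:E) (cst 0%E).
  move=> p0; apply: filterS ae0 => t /(_ I) Kt _.
  have /eqP : normc (K t) ^+ 2 = 0 by case: Kt.
  by rewrite sqrf_eq0 normc_eq0 => /eqP ->; rewrite mul0r p0.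
have part (p : R[i] -> R) : p 0 = 0 -> measurable_fun setT (fun t => p (K t * v t)) ->
    \int[mu]_t p (K t * v t) = 0.
  move=> p0 mp; rewrite /Rintegral.
  have mp' : measurable_fun setT (fun t => (p (K t * v t))%:E) by exact/measurable_EFinP.
  have := @ae_eq_integral _ _ _ mu setT (cst 0%E) _ measurableT mp' _ (aeKv p p0).
  by move=> ->//; rewrite integral0.
apply: complex_eq.
  exact: (part (fun z => Re z) erefl mKv.1).
exact: (part (fun z => Im z) erefl mKv.2).
Qed.

(** By Plancherel's theorem the transform is injective up to null sets, on which
   no integral depends. *)
Lemma minv_inj G H v x : decaying G -> decaying H -> cmeas setT v ->
  cintegrable setT (fun t => G t * v t) -> cintegrable setT (fun t => H t * v t) ->
  (forall x, 0 < x -> minv G x = minv H x) ->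
  minv (fun t => G t * v t) x = minv (fun t => H t * v t) x.
Proof.
move=> dG dH mv iGv iHv GH.
have dK := decayingB dG dH; pose K t := G t - H t.
have cG := decaying_integrable dG; have cH := decaying_integrable dH.
have K2 : sq_integrable K := decaying_sq dK.
have cK : cintegrable setT K := decaying_integrable dK.
have four0 y : four K y = 0.
  have e0 := expR_gt0 (- y).
  have : minv K (expR (- y)) = 0 by rewrite minvB// GH// subrr.
  have p0 : ((2 * pi)^-1)%:C * (expR (- y) `^ (- 2^-1))%:C != 0 :> R[i].
    by rewrite -normc_eq0 normcMl !normcR gt_eqF// mulr_gt0// normr_gt0 gt_eqF//;
      rewrite ?invr_gt0 ?powR_gt0// mulr_gt0// pi_gt0.
  by rewrite /minv expRK opprK => /eqP; rewrite mulf_eq0 (negbTE p0) => /eqP.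
(* [ln] maps the half-line onto the line, so that [four K] vanishes everywhere. *)
have K0 : sqn K = 0.
  have : 2 * pi * sqn K = 0.
    rewrite -plancherel// /sqn; under eq_Rintegral do rewrite four0 ComplexField.Normc.normc0 expr0n.
    by rewrite /Rintegral integral0.
  have q0 : 2 * pi != 0 :> R by rewrite mulf_neq0// gt_eqF// pi_gt0.
  by move/eqP; rewrite mulf_eq0 (negbTE q0) => /eqP.
apply/eqP; rewrite -subr_eq0 -minvB//; apply/eqP.
rewrite (eq_minv _ (H := fun t => K t * v t)); last by move=> t; rewrite mulrBl.
rewrite /minv (_ : four _ _ = 0) ?mulr0//.
rewrite /four; under eq_fun do rewrite -mulrA.
apply: sqn_eq0_integral => //; apply: cmeasM => //.
by apply: cmeas_ce; exact: measurable_funM.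
Qed.

(** Two equations whose symbols are inverse to each other solve one another. *)
Lemma reciprocal_equations (E1 E2 : (R -> R[i]) -> (R -> R[i]) -> Prop)
    M N (KM KN : R) :
  cmeas setT M -> cmeas setT N ->
  (forall t, normc (M t) <= KM) -> (forall t, normc (N t) <= KN) ->
  (forall t, M t * N t = 1) ->
  (forall f h G, decaying G -> (forall t, 0 < t -> f t = minv G t) ->
     E1 f h <-> (forall x, 0 < x -> h x = minv (fun t => G t * M t) x)) ->
  (forall f h G, decaying G -> (forall t, 0 < t -> h t = minv G t) ->
     E2 f h <-> (forall x, 0 < x -> f x = minv (fun t => G t * N t) x)) ->
  forall h, mellin_class h -> exists f,
    [/\ mellin_class f, E1 f h, E2 f h &
        forall g, mellin_class g -> E1 g h -> forall x, 0 < x -> g x = f x].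
Proof.
move=> mM mN bM bN MN e1 e2 h /mellin_class_decaying[H [dH hE]].
have dHN := decayingM dH mN bN.
exists (minv (fun t => H t * N t)); split.
- exact: mellin_class_minv.
- apply/(e1 _ _ _ dHN) => // x x0; rewrite hE//; apply: eq_minv => t.
  by rewrite -mulrA [N t * _]mulrC MN mulr1.
- by apply/(e2 _ _ _ dH).
move=> g /mellin_class_decaying[G [dG gE]] /(e1 _ _ _ dG gE) hG x x0.
have dGM := decayingM dG mM bM.
rewrite gE// -(minv_inj _ dGM dH mN) => [||| y y0].
- by apply: eq_minv => t; rewrite -mulrA MN mulr1.
- by apply: decaying_integrable; exact: decayingM dGM mN bN.
- exact: decaying_integrable.
- by rewrite -hG// hE.
Qed.

End reciprocity.

Theorem theorem4 (R : realType) (alpha : R)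
    (alpha_gt0 : 0 < alpha) (alpha_lt1 : alpha < 1) :
  (forall h : R -> complex R, mellin_class h ->
     exists f : R -> complex R,
       [/\ mellin_class f, equationA alpha f h, equationB alpha f h &
           forall g : R -> complex R, mellin_class g -> equationA alpha g h ->
             forall x : R, 0 < x -> g x = f x]) /\
  (forall f : R -> complex R, mellin_class f ->
     exists h : R -> complex R,
       [/\ mellin_class h, equationB alpha f h, equationA alpha f h &
           forall g : R -> complex R, mellin_class g -> equationB alpha f g ->
             forall x : R, 0 < x -> g x = h x]).
Proof.
have a01 : 0 < alpha < 1 by rewrite alpha_gt0.
have mA : cmeas setT (symbolA alpha) by exact: cmeas_symbol.
have mB : cmeas setT (symbolB alpha) by exact: cmeas_symbol.
have AB := symbolAB a01.
have eA f h G := @equationA_symbol R alpha f h G.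
have eB f h G := @equationB_symbol R alpha f h G a01.
have BA t : symbolB alpha t * symbolA alpha t = 1 by rewrite mulrC.
have nA := normc_symbolA alpha; have nB := normc_symbolB a01; split.
  exact: (@reciprocal_equations R (equationA alpha) (equationB alpha) _ _ _ _
    mA mB nA nB AB eA eB).
exact: (@reciprocal_equations R (fun h f => equationB alpha f h)
  (fun h f => equationA alpha f h) _ _ _ _ mB mA nB nA BA
  (fun h f => eB f h) (fun h f => eA f h)).
Qed.
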